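(* Let $f$ be a transcendental entire function which is periodic with period $c$, and let $g=f^m+c$ for some $m\in\mathbb{N}$. Let $U\subset F(f)$ be an invariant component of $F(f)$ and let $\phi$ be a limit function of $(f^n)$ on $U$. Then $\phi$ is a limit function of $((f\circ g)^n)$ on $U$ and $\phi+c$ is a limit function of $((g\circ f)^n)$ on $U$.
   Context: For an entire function $f$, $f^n$ denotes the $n$-th iterate (composition) of $f$, and the Fatou set $F(f)$ is the set of points of $\mathbb{C}$ having a neighborhood on which the family $\{f^n\}_{n\in\mathbb{N}}$ is normal (local uniform convergence to $\infty$ being allowed). A component $U$ of $F(f)$ is invariant if $f(U)\subset U$. A function $\psi$ (possibly the constant $\infty$) is a limit function of a sequence of iterates $(h^n)$ on a domain $U$ if some subsequence of $(h^n)$ converges locally uniformly on $U$ to $\psi$; if $\phi\equiv\infty$ then $\phi+c$ means $\infty$. $f$ has period $c$ means $c\neq 0$ and $f(z+c)=f(z)$ for all $z\in\mathbb{C}$. *)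

(* Defs.v *)
From mathcomp Require Import all_boot all_order all_algebra.
From mathcomp Require Export complex.
From mathcomp Require Import all_classical all_reals all_analysis.

Set Implicit Arguments.
Unset Strict Implicit.
Unset Printing Implicit Defensive.

Import Order.TTheory GRing.Theory Num.Theory.
Import numFieldNormedType.Exports.

Local Open Scope classical_set_scope.
Local Open Scope ring_scope.
Local Open Scope complex_scope.

(* The regular module R[i]^o carries the topology, the uniformity and the
   R[i]-valued norm of the complex plane. *)
Notation CC R := (R[i]^o).

Definition entire (R : realType) (f : CC R -> CC R) : Prop :=
  forall z : CC R, derivable f z 1.

Definition transcendental_entire (R : realType) (f : CC R -> CC R) : Prop :=
  entire f /\ ~ exists p : {poly R[i]}, forall z, f z = p.[z].

Definition has_period (R : realType) (f : CC R -> CC R) (c : CC R) : Prop :=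
  c != 0 /\ forall z, f (z + c) = f z.

(* A possible limit of a sequence of functions: [Some psi] is the finite
   function psi (only its values on the domain considered matter) and [None] is
   the constant infinity. *)
Definition limit_fun (R : realType) : Type := option (CC R -> CC R).

Definition limit_addc (R : realType) (phi : limit_fun R) (c : CC R) : limit_fun R :=
  omap (fun psi z => psi z + c) phi.

(* The order of R[i] only compares numbers with equal imaginary parts, hence the
   bound M has to be real. *)
Definition loc_unif_cvg (R : realType) (D : set (CC R))
    (h : nat -> CC R -> CC R) (phi : limit_fun R) : Prop :=
  forall z, D z -> exists2 V : set (CC R), nbhs z V &
    if phi is Some psi then {uniform V `&` D, h @ \oo --> psi}
    else forall M : R, \forall n \near \oo,
           forall w, (V `&` D) w -> M%:C < `|h n w|.

Definition limit_function (R : realType) (h : nat -> CC R -> CC R)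
    (D : set (CC R)) (phi : limit_fun R) : Prop :=
  exists s : nat -> nat, {homo s : i j / (i < j)%N} /\
    loc_unif_cvg D (h \o s) phi.

(* Here s enumerates an arbitrary sequence of members of the family h. *)
Definition normal_family (R : realType) (h : nat -> CC R -> CC R)
    (D : set (CC R)) : Prop :=
  forall s : nat -> nat, exists phi : limit_fun R, limit_function (h \o s) D phi.

Definition iterates (R : realType) (f : CC R -> CC R) : nat -> CC R -> CC R :=
  fun n => iter n f.

Definition Fatou (R : realType) (f : CC R -> CC R) : set (CC R) :=
  [set z | exists2 V : set (CC R), nbhs z V & normal_family (iterates f) V].

Definition Fatou_component (R : realType) (f : CC R -> CC R)
    (U : set (CC R)) : Prop :=
  exists2 z, Fatou f z & U = connected_component (Fatou f) z.

(* Main.v *)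
(* As [f] has period [c], the [n]-th iterates of [f \o g] and [g \o f] are
   [f ^ ((m + 1) n)] and [f ^ ((m + 1) n) + c].  So it suffices that every limit
   function [psi] of [(f ^ s_j)] on [U] is, for every [k > 0], a limit function of
   [(f ^ (k n))].

   If [psi] is infinite, [s_j] can be rounded down to a multiple of [k], because fewer
   than [k] iterations of [f] map bounded sets to bounded sets.  If [psi] is a
   constant [p], then [f p = p], and rounding up does not affect the limit.  If
   [psi] is not constant, then [f ^ t_j] tends to the identity on [U] for some
   [t_j], so orbits return with bounded gaps and lie in compact subsets of [U].  The
   hull of such a set contains a fixed point [p] of some [f ^ q], since otherwise
   [1 / (f ^ q - id)] would be a limit of polynomials there.  Being periodic, [f] has
   no iterate which is the identity on an open set.  This forces the means over [n]
   of [f ^ (q n + i)] to tend to constants, whence [f p = p], and it prevents the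
   multiplier of [p] from being a root of unity.  The multiplier has modulus 1, so its
   powers with exponent in a given residue class mod [k] come close to 1; along these
   exponents the iterates of [f] tend to the identity on [U], and adding them to
   [s_j] yields multiples of [k].

   Cauchy's estimates rest on Riemann sums instead of integrals: the sums over the
   boundary of a square vanish exactly for affine functions, which is all that
   Goursat's bisection needs. *)
Require Import Defs.
From mathcomp Require Import all_boot all_order all_algebra.
From mathcomp Require Import all_classical all_reals all_analysis.
From mathcomp Require Import ring lra zify.

Set Implicit Arguments.
Unset Strict Implicit.
Unset Printing Implicit Defensive.

Import Order.TTheory GRing.Theory Num.Theory.
Import numFieldNormedType.Exports.

Local Open Scope classical_set_scope.
Local Open Scope ring_scope.
Local Open Scope complex_scope.

(** The classical picture would make [U] a disc on which [f] is conjugate to a rotation. Here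
    neither simple connectedness of [U] nor a conjugacy is established. The fixed point is only
    located in the hull [K] of a compact subset [L] of [U], so it might lie in a hole of [U]; what
    is known on [L] reaches [K] because entire functions obey the maximum principle there. Thus the
    iterates are bounded on [K], the union of [U] and [K] is open and connected, and convergence to
    the identity near the fixed point spreads over it to [U] by Vitali's theorem. Means of iterates
    take over the role of the conjugacy: their bounds do not depend on how many iterates are
    averaged.

    Where a limit function has to be produced, it is taken along an ultrafilter: there every bounded
    family converges pointwise, and for holomorphic functions with a common local bound a pointwise
    limit is already holomorphic. *)

Local Notation Re := (@complex.Re _).
Local Notation Im := (@complex.Im _).

(** * Complex differentiability *)

(* The norm of [R[i]] is complex-valued; [nm] is the same modulus with values in [R]. *)
Definition nm (R : realType) (x : R[i]) : R := Normc.normc x.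
Arguments nm : simpl never.

Section Modulus.
Variable R : realType.
Implicit Types (x y z a b : R[i]) (r e : R).

Lemma normE x : `|x| = (nm x)%:C. Proof. by []. Qed.

Lemma nm_ge0 x : 0 <= nm x.
Proof. by rewrite -ler0c -normE. Qed.

Lemma nm0 : nm (0 : R[i]) = 0.
Proof. exact: Normc.normc0. Qed.

Lemma nm1 : nm (1 : R[i]) = 1.
Proof. exact: Normc.normc1. Qed.

Lemma nm_eq0 x : (nm x == 0) = (x == 0).
Proof. by apply/eqP/eqP => [/Normc.eq0_normc//|->]; exact: nm0. Qed.

Lemma nm_gt0 x : (0 < nm x) = (x != 0).
Proof. by rewrite lt_neqAle eq_sym nm_eq0 nm_ge0 andbT. Qed.

Lemma nmM x y : nm (x * y) = nm x * nm y.
Proof. exact: Normc.normcM. Qed.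

Lemma nmV x : nm x^-1 = (nm x)^-1.
Proof. exact: Normc.normcV. Qed.

Lemma nmN x : nm (- x) = nm x.
Proof. exact: normcN. Qed.

Lemma nmD x y : nm (x + y) <= nm x + nm y.
Proof. exact: le_normcD. Qed.

Lemma nmB x y : nm (x - y) <= nm x + nm y.
Proof. by rewrite -(nmN y) nmD. Qed.

Lemma nm_distC x y : nm (x - y) = nm (y - x).
Proof. by rewrite -nmN opprB. Qed.

Lemma nm_tri y x z : nm (x - z) <= nm (x - y) + nm (y - z).
Proof. by rewrite (_ : x - z = (x - y) + (y - z)) ?nmD //; ring. Qed.

Lemma nm_lerB x y : nm x - nm y <= nm (x - y).
Proof. by have := nmD (x - y) y; rewrite subrK; lra. Qed.

Lemma nmX x n : nm (x ^+ n) = nm x ^+ n.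
Proof. by elim: n => [|n IH]; rewrite ?nm1 // !exprS nmM IH. Qed.

Lemma nm_real r : nm r%:C = `|r|.
Proof. by rewrite /nm /= expr0n addr0 sqrtr_sqr. Qed.

Lemma nm_nat n : nm (n%:R : R[i]) = n%:R.
Proof. by rewrite -(rmorph_nat (real_complex R)) nm_real ger0_norm. Qed.

Lemma rCD r e : (r + e)%:C = r%:C + e%:C :> R[i]. Proof. exact: rmorphD. Qed.
Lemma rCN r : (- r)%:C = - r%:C :> R[i]. Proof. exact: rmorphN. Qed.
Lemma rCB r e : (r - e)%:C = r%:C - e%:C :> R[i]. Proof. exact: rmorphB. Qed.
Lemma rCM r e : (r * e)%:C = r%:C * e%:C :> R[i]. Proof. exact: rmorphM. Qed.
Lemma rCV r : (r^-1)%:C = (r%:C)^-1 :> R[i]. Proof. exact: fmorphV. Qed.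
Lemma rC_nat n : (n%:R)%:C = n%:R :> R[i]. Proof. exact: rmorph_nat. Qed.
Lemma rC_eq0 r : (r%:C == 0 :> R[i]) = (r == 0). Proof. exact: fmorph_eq0. Qed.

Lemma nm_sqr x : nm x ^+ 2 = Re x ^+ 2 + Im x ^+ 2.
Proof. by case: x => p q; rewrite /nm /= sqr_sqrtr ?addr_ge0 ?sqr_ge0. Qed.

Lemma Re_le_nm x : `|Re x| <= nm x.
Proof.
rewrite -(@ler_pXn2r _ 2) ?nnegrE ?nm_ge0 //.
by rewrite nm_sqr -normrX ger0_norm ?sqr_ge0 // lerDl sqr_ge0.
Qed.

Lemma Im_le_nm x : `|Im x| <= nm x.
Proof.
rewrite -(@ler_pXn2r _ 2) ?nnegrE ?nm_ge0 //.
by rewrite nm_sqr -normrX ger0_norm ?sqr_ge0 // lerDr sqr_ge0.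
Qed.

Lemma nm_le_ReIm x : nm x <= `|Re x| + `|Im x|.
Proof.
rewrite -(@ler_pXn2r _ 2) ?nnegrE ?nm_ge0 ?addr_ge0 //.
rewrite nm_sqr -[Re x ^+ 2]real_normK ?num_real // -[Im x ^+ 2]real_normK ?num_real //.
by have := normr_ge0 (Re x); have := normr_ge0 (Im x); nra.
Qed.

Lemma nm_sum (I : Type) (s : seq I) (P : pred I) (F : I -> R[i]) :
  nm (\sum_(i <- s | P i) F i) <= \sum_(i <- s | P i) nm (F i).
Proof.
elim/big_ind2: _ => [|x r y e h1 h2|//]; first by rewrite nm0.
by apply: le_trans (nmD _ _) _; rewrite lerD.
Qed.

Lemma nm_i : nm ('i : R[i]) = 1.
Proof. by rewrite /nm /= expr0n expr1n add0r sqrtr1. Qed.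

End Modulus.

Section Continuity.
Variable R : realType.
Implicit Types (f g q : R[i] -> R[i]) (x y z w d : R[i]) (r e M : R).

Definition ccont f z := forall e, 0 < e ->
  exists2 r, 0 < r & forall w, nm (w - z) < r -> nm (f w - f z) < e.

Lemma ccont_cst d z : ccont (fun _ => d) z.
Proof. by move=> e e0; exists 1 => // w _; rewrite subrr nm0. Qed.

Lemma ccont_id z : ccont id z.
Proof. by move=> e e0; exists e. Qed.

Lemma ccont_ext f g z : (forall w, f w = g w) -> ccont f z -> ccont g z.
Proof. by move=> /funext->. Qed.

Lemma ccontD f g z : ccont f z -> ccont g z -> ccont (fun w => f w + g w) z.
Proof.
move=> fz gz e e0; have e2 : 0 < e / 2 by lra.
have [r r0 rP] := fz _ e2; have [s s0 sP] := gz _ e2.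
exists (Num.min r s) => [|w]; first by rewrite lt_min r0 s0.
rewrite lt_min => /andP[/rP wr /sP ws].
apply: le_lt_trans (_ : nm (f w - f z) + nm (g w - g z) < e); last by lra.
by rewrite (_ : _ - _ = (f w - f z) + (g w - g z)) ?nmD //; ring.
Qed.

Lemma ccontM f g z : ccont f z -> ccont g z -> ccont (fun w => f w * g w) z.
Proof.
move=> fz gz e e0.
pose A := nm (f z) + 1; pose B := nm (g z) + 1.
have A0 : 0 < A by rewrite ltr_wpDl ?nm_ge0.
have B0 : 0 < B by rewrite ltr_wpDl ?nm_ge0.
have eA : 0 < e / (2 * A) by rewrite divr_gt0 // mulr_gt0.
have eB : 0 < e / (2 * B) by rewrite divr_gt0 // mulr_gt0.
have [r r0 rP] := fz _ eB; have [s s0 sP] := gz _ eA.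
have [t t0 tP] := fz _ ltr01.
exists (Num.min t (Num.min r s)) => [|w]; first by rewrite !lt_min t0 r0 s0.
rewrite !lt_min => /and3P[/tP wt /rP wr /sP ws].
rewrite (_ : _ - _ = f w * (g w - g z) + (f w - f z) * g z); last by ring.
apply: le_lt_trans (nmD _ _) _; rewrite !nmM.
have fA : nm (f w) <= A by have := nm_lerB (f w) (f z); rewrite /A; lra.
have h1 : nm (f w) * nm (g w - g z) <= A * nm (g w - g z).
  by rewrite ler_wpM2r ?nm_ge0.
have h2 : A * nm (g w - g z) < A * (e / (2 * A)) by rewrite ltr_pM2l.
have h3 : nm (f w - f z) * nm (g z) <= (e / (2 * B)) * B.
  by rewrite ler_pM ?nm_ge0 ?(ltW wr) // /B; lra.
have -> : e = A * (e / (2 * A)) + (e / (2 * B)) * B.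
  by field; rewrite !gt_eqF.
by lra.
Qed.

Lemma ccontN f z : ccont f z -> ccont (fun w => - f w) z.
Proof.
by move=> fz e /fz [r r0 rP]; exists r => // w /rP; rewrite -opprD nmN.
Qed.

Lemma ccontB f g z : ccont f z -> ccont g z -> ccont (fun w => f w - g w) z.
Proof. by move=> fz gz; apply: ccontD => //; exact: ccontN. Qed.

Lemma ccont_comp f g z : ccont f z -> ccont g (f z) -> ccont (fun w => g (f w)) z.
Proof.
by move=> fz gz e /gz [r /fz [s s0 sP] rP]; exists s => // w /sP /rP.
Qed.

Lemma ccont_neq0 f z : ccont f z -> f z != 0 ->
  exists2 r, 0 < r & forall w, nm (w - z) < r -> nm (f z) / 2 < nm (f w).
Proof.
move=> fz; rewrite -nm_gt0 => f0.
have [|r r0 rP] := fz (nm (f z) / 2); first by lra.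
exists r => // w /rP; rewrite nm_distC; have := nm_lerB (f z) (f w); lra.
Qed.

Lemma ccontV f z : f z != 0 -> ccont f z -> ccont (fun w => (f w)^-1) z.
Proof.
move=> f0 fz e e0; have [r r0 rP] := ccont_neq0 fz f0.
have n0 : 0 < nm (f z) by rewrite nm_gt0.
have [|s s0 sP] := fz (e * nm (f z) ^+ 2 / 2).
  by rewrite divr_gt0 // mulr_gt0 // exprn_gt0.
exists (Num.min r s) => [|w]; first by rewrite lt_min r0 s0.
rewrite lt_min => /andP[/rP wr /sP ws].
have nw : 0 < nm (f w) by lra.
have fw : f w != 0 by rewrite -nm_gt0.
have -> : (f w)^-1 - (f z)^-1 = (f z - f w) / (f w * f z) by field; rewrite fw f0.
rewrite nmM nmV nmM nm_distC ltr_pdivrMr ?mulr_gt0 //.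
apply: lt_trans ws _; rewrite -subr_gt0.
have -> : e * (nm (f w) * nm (f z)) - e * nm (f z) ^+ 2 / 2 =
  e * nm (f z) * (nm (f w) - nm (f z) / 2) by ring.
by rewrite !mulr_gt0 // subr_gt0.
Qed.

(* Caratheodory's form of [f] having derivative [d] at [z]. *)
Definition cdiff f z d :=
  exists q, [/\ ccont q z, q z = d & forall w, f w - f z = q w * (w - z)].

(** With [d] the derivative, the value at [z] makes the quotient continuous there, so bounds on a
    contour around [z] turn into bounds for the derivative. *)
Definition slope f z d w := if w == z then d else (f w - f z) / (w - z).

Lemma slopeE f z d w : f w - f z = slope f z d w * (w - z).
Proof.
rewrite /slope; case: eqP => [->|/eqP wz]; first by rewrite !subrr mulr0.
by rewrite divfK // subr_eq0.
Qed.

Lemma cdiff_slope f z d : cdiff f z d -> ccont (slope f z d) z.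
Proof.
case=> q [qz qzd qE]; apply: ccont_ext qz => w; rewrite /slope.
case: eqP => [->//|/eqP wz]; by rewrite qE mulfK // subr_eq0.
Qed.

Lemma cdiffP f z d : cdiff f z d <-> forall e, 0 < e -> exists2 r, 0 < r &
  forall w, nm (w - z) < r -> nm (f w - f z - d * (w - z)) <= e * nm (w - z).
Proof.
split=> [[q [qz qzd qE]] e /qz [r r0 rP]|H].
  exists r => // w wr; rewrite qE -qzd -mulrBl nmM ler_wpM2r ?nm_ge0 //.
  by rewrite ltW // rP.
exists (slope f z d); split; first last.
- by move=> w; exact: slopeE.
- by rewrite /slope eqxx.
move=> e e0; have [|r r0 rP] := H (e / 2); first by lra.
exists r => // w wr; rewrite /slope eqxx; case: eqP => [_|/eqP wz].
  by rewrite subrr nm0.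
have wz0 : 0 < nm (w - z) by rewrite nm_gt0 subr_eq0.
rewrite -(ltr_pM2r wz0) -nmM mulrBl divfK ?subr_eq0 //.
apply: le_lt_trans (rP _ wr) _; rewrite ltr_pM2r //; lra.
Qed.

Lemma cdiff_uniq f z d1 d2 : cdiff f z d1 -> cdiff f z d2 -> d1 = d2.
Proof.
move=> /cdiffP H1 /cdiffP H2; apply/eqP; rewrite -subr_eq0 -nm_eq0.
apply/eqP/le_anti; rewrite nm_ge0 andbT; apply/ler_addgt0Pl => e e0; rewrite addr0.
have e2 : 0 < e / 2 by lra.
have [r r0 rP] := H1 _ e2; have [s s0 sP] := H2 _ e2.
pose t := Num.min r s / 2.
have t0 : 0 < t by rewrite divr_gt0 // lt_min r0 s0.
have tr : t < r by rewrite /t; have := ge_min r r s; rewrite lexx /=; lra.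
have ts : t < s by rewrite /t; have := ge_min s r s; rewrite lexx orbT /=; lra.
have nt : nm (z + t%:C - z) = t by rewrite addrC addKr nm_real gtr0_norm.
have := rP (z + t%:C); have := sP (z + t%:C); rewrite nt => /(_ ts) h2 /(_ tr) h1.
rewrite -(ler_pM2r t0) -{1}nt -nmM.
apply: le_trans (_ : e / 2 * t + e / 2 * t <= _); last by lra.
apply: le_trans (lerD h2 h1).
rewrite (_ : (d1 - d2) * _ = (f (z + t%:C) - f z - d2 * (z + t%:C - z)) -
  (f (z + t%:C) - f z - d1 * (z + t%:C - z))); last by ring.
exact: nmB.
Qed.

Lemma cdiff_cont f z d : cdiff f z d -> ccont f z.
Proof.
case=> q [qz _ qE]; apply: (@ccont_ext (fun w => f z + q w * (w - z))).
  by move=> w; rewrite -qE; ring.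
apply: ccontD; first exact: ccont_cst.
apply: ccontM => //; apply: ccontB; [exact: ccont_id|exact: ccont_cst].
Qed.

Lemma cdiff_near f g z d r : 0 < r -> (forall w, nm (w - z) < r -> f w = g w) ->
  cdiff f z d -> cdiff g z d.
Proof.
move=> r0 fg /cdiffP H; apply/cdiffP => e /H [s s0 sP].
exists (Num.min r s) => [|w]; first by rewrite lt_min r0 s0.
by rewrite lt_min => /andP[wr /sP]; rewrite !fg // subrr nm0.
Qed.

Lemma cdiff_ext f g z d : (forall w, f w = g w) -> cdiff f z d -> cdiff g z d.
Proof. by move=> /funext->. Qed.

Lemma cdiff_cst c z : cdiff (fun _ => c) z 0.
Proof.
by exists (fun _ => 0); split=> // [|w]; [exact: ccont_cst|rewrite subrr mul0r].
Qed.

Lemma cdiff_id z : cdiff id z 1.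
Proof. by exists (fun _ => 1); split=> // [|w]; [exact: ccont_cst|rewrite mul1r]. Qed.

Lemma cdiffD f g z d1 d2 : cdiff f z d1 -> cdiff g z d2 ->
  cdiff (fun w => f w + g w) z (d1 + d2).
Proof.
move=> [q1 [c1 <- E1]] [q2 [c2 <- E2]]; exists (fun w => q1 w + q2 w).
by split=> // [|w]; [exact: ccontD|rewrite mulrDl -E1 -E2; ring].
Qed.

Lemma cdiffM f g z d1 d2 : cdiff f z d1 -> cdiff g z d2 ->
  cdiff (fun w => f w * g w) z (d1 * g z + f z * d2).
Proof.
move=> [q1 [c1 <- E1]] /[dup]/cdiff_cont cg [q2 [c2 <- E2]].
exists (fun w => q1 w * g w + f z * q2 w).
split=> // [|w]; last by rewrite mulrDl mulrAC -E1 -mulrA -E2; ring.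
apply: ccontD; first exact: ccontM.
by apply: ccontM => //; exact: ccont_cst.
Qed.

Lemma cdiffZ f z d c : cdiff f z d -> cdiff (fun w => c * f w) z (c * d).
Proof.
by move=> h; have := cdiffM (cdiff_cst c z) h; rewrite mul0r add0r.
Qed.

Lemma cdiffN f z d : cdiff f z d -> cdiff (fun w => - f w) z (- d).
Proof.
move=> /(cdiffZ (-1)); rewrite mulN1r; apply: cdiff_ext => w; exact: mulN1r.
Qed.

Lemma cdiffB f g z d1 d2 : cdiff f z d1 -> cdiff g z d2 ->
  cdiff (fun w => f w - g w) z (d1 - d2).
Proof. by move=> h1 /cdiffN h2; exact: (cdiffD h1 h2). Qed.

Lemma cdiff_comp f g z d1 d2 : cdiff f z d1 -> cdiff g (f z) d2 ->
  cdiff (fun w => g (f w)) z (d2 * d1).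
Proof.
move=> /[dup]/cdiff_cont cf [q1 [c1 <- E1]] [q2 [c2 <- E2]].
exists (fun w => q2 (f w) * q1 w); split=> // [|w]; last by rewrite E2 E1 mulrA.
by apply: ccontM => //; exact: (ccont_comp cf).
Qed.

Lemma cdiffV f z d : f z != 0 -> cdiff f z d ->
  cdiff (fun w => (f w)^-1) z (- d / f z ^+ 2).
Proof.
move=> f0 /[dup]/cdiff_cont cf /[dup] h [q [c <- E]].
have [r r0 rP] := ccont_neq0 cf f0.
have := cdiffP (fun w => (f w)^-1) z (- q z / f z ^+ 2) => -[_ ]; apply.
move=> e e0.
have cq : ccont (fun w => - q w / (f w * f z)) z.
  apply: ccontM; first exact: ccontN.
  apply: ccontV; first by rewrite mulf_neq0.
  by apply: ccontM => //; exact: ccont_cst.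
have [s s0 sP] := cq _ e0; exists (Num.min r s) => [|w].
  by rewrite lt_min r0 s0.
rewrite lt_min => /andP[/rP wr /sP ws].
have fw : f w != 0 by rewrite -nm_gt0; have := nm_ge0 (f z); lra.
rewrite (_ : _ - _ = (- q w / (f w * f z) - - q z / (f z * f z)) * (w - z)).
  by rewrite nmM ler_wpM2r ?nm_ge0 ?ltW.
have -> : (- q w / (f w * f z) - - q z / (f z * f z)) * (w - z) =
    - (q w * (w - z)) / (f w * f z) + q z * (w - z) / (f z * f z).
  by field; rewrite f0 fw.
by rewrite -E; field; rewrite f0 fw.
Qed.

Lemma cdiffX f z d n : cdiff f z d -> cdiff (fun w => f w ^+ n) z (d * f z ^+ n.-1 *+ n).
Proof.
move=> h; elim: n => [|n IH]; first exact: cdiff_cst.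
have := cdiffM h IH; rewrite (_ : _ + _ = d * f z ^+ n.+1.-1 *+ n.+1).
  by apply: cdiff_ext => w; rewrite exprS.
case: n {IH} => [|n] /=; first by rewrite !mulr0n mulr0 addr0.
by rewrite !exprS [in RHS]mulrS -mulrnAr mulrCA -mulrnAr; congr (_ + _); ring.
Qed.

Lemma cdiff_poly (p : {poly R[i]}) z : cdiff (fun w => p.[w]) z p^`().[z].
Proof.
elim/poly_ind: p => [|p c IH].
  rewrite deriv0 horner0; apply: cdiff_ext (cdiff_cst 0 z) => w.
  by rewrite horner0.
have := cdiffD (cdiffM IH (cdiff_id z)) (cdiff_cst c z).
have -> : (p * 'X + c%:P)^`().[z] = p^`().[z] * z + p.[z] * 1 + 0.
  by rewrite derivMXaddC hornerD hornerMX addr0 mulr1 addrC.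
by apply: cdiff_ext => w; rewrite hornerD hornerM hornerX hornerC.
Qed.

Lemma cdiff_sum (I : Type) (s : seq I) (F : I -> R[i] -> R[i]) (D : I -> R[i]) z :
  (forall i, cdiff (F i) z (D i)) ->
  cdiff (fun w => \sum_(i <- s) F i w) z (\sum_(i <- s) D i).
Proof.
move=> h; elim: s => [|i s IH].
  rewrite big_nil; apply: cdiff_ext (cdiff_cst 0 z) => w; by rewrite big_nil.
rewrite big_cons; apply: cdiff_ext (cdiffD (h i) IH) => w; by rewrite big_cons.
Qed.

(** Total, with default value 0; differentiability at [z] is therefore expressed by
    [cdiff f z (der f z)]. *)
Definition der f z := xget 0 [set d | cdiff f z d].

Lemma derE f z d : cdiff f z d -> der f z = d.
Proof.
by move=> h; apply: (cdiff_uniq _ h); exact: (xgetPex 0 (ex_intro _ d h)).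
Qed.

Lemma cdiff_der f z d : cdiff f z d -> cdiff f z (der f z).
Proof. by move=> h; rewrite (derE h). Qed.

End Continuity.

(** * Goursat's theorem and Cauchy's estimate *)

Section Bisection.
Variable R : realType.
Implicit Types (x y l d : R).

Lemma half_pow_lt d : 0 < d -> exists k, (2^-1) ^+ k < d.
Proof.
move=> d0; exists (Num.bound d^-1).
have dV : 0 <= d^-1 by rewrite invr_ge0 ltW.
have h : d^-1 < 2 ^+ Num.bound d^-1.
  by rewrite (lt_trans (archi_boundP dV)) // -natrX ltr_nat ltn_expl.
by rewrite exprVn -[ltRHS]invrK ltf_pV2 ?posrE ?invr_gt0 ?exprn_gt0.
Qed.

Lemma nested_point (x : nat -> R) (l : nat -> R) :
  (forall k, x k <= x k.+1 /\ x k.+1 + l k.+1 <= x k + l k) ->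
  (forall k, 0 <= l k) -> exists X, forall k, x k <= X <= x k + l k.
Proof.
move=> H l0.
have mono j k : (j <= k)%N -> x j <= x k /\ x k + l k <= x j + l j.
  move=> /subnK<-; elim: (k - j)%N => [|i [IH1 IH2]]; first by rewrite add0n.
  rewrite addSn; have [h1 h2] := H (i + j)%N.
  by split; [exact: le_trans h1|exact: le_trans IH2].
have cross j k : x j <= x k + l k.
  case/orP: (leq_total j k) => jk.
    by have [h _] := mono _ _ jk; rewrite (le_trans h) // lerDl.
  by have [_ h] := mono _ _ jk; rewrite (le_trans _ h) // lerDl.
exists (sup (range x)) => k; apply/andP; split.
  apply: sup_upper_bound; last by exists k.
  by split; [exists (x 0%N); exists 0%N|exists (x 0%N + l 0%N) => _ [j _ <-]].
apply: ge_sup; first by exists (x 0%N); exists 0%N.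
by move=> _ [j _ <-].
Qed.

(** If [P] failed for the unit square, it would fail for one of its quarters, and so on; the nested
    bad squares shrink to a point [(X, Y)], where the local hypothesis rules them out. A predicate
    that ignores [y] gives bisection of an interval. *)
Lemma bisect2 (P : R -> R -> R -> Prop) :
  (forall x y l, 0 < l ->
     P x y (l / 2) -> P (x + l / 2) y (l / 2) -> P x (y + l / 2) (l / 2) ->
     P (x + l / 2) (y + l / 2) (l / 2) -> P x y l) ->
  (forall X Y, 0 <= X <= 1 -> 0 <= Y <= 1 -> exists2 d, 0 < d &
     forall x y l, 0 < l < d -> 0 <= x <= X -> 0 <= y <= Y ->
       X <= x + l <= 1 -> Y <= y + l <= 1 -> P x y l) ->
  P 0 0 1.
Proof.
move=> sub loc; apply: contrapT => nP.
(* A square is encoded as [(x, y, l)]: lower left corner and side. *)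
pose child (p q : R * R * R) := [/\ (q.1.1 = p.1.1) \/ (q.1.1 = p.1.1 + p.2 / 2),
  (q.1.2 = p.1.2) \/ (q.1.2 = p.1.2 + p.2 / 2) & q.2 = p.2 / 2].
pose bad (p : R * R * R) := ~ P p.1.1 p.1.2 p.2.
pose nxt p := xget p [set q | child p q /\ bad q].
have nxtP p : 0 < p.2 -> bad p -> child p (nxt p) /\ bad (nxt p).
  case: p => -[x y] l /= l0 bp.
  apply: (@xgetPex _ (x, y, l) [set q | child (x, y, l) q /\ bad q]).
  apply: contrapT => /forallNP nq; apply: bp => /=; apply: sub => //.
  - apply: contrapT => h; apply: (nq (x, y, l / 2)); split=> //=.
    by split=> /=; auto.
  - apply: contrapT => h; apply: (nq (x + l / 2, y, l / 2)); split=> //=.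
    by split=> /=; auto.
  - apply: contrapT => h; apply: (nq (x, y + l / 2, l / 2)); split=> //=.
    by split=> /=; auto.
  - apply: contrapT => h; apply: (nq (x + l / 2, y + l / 2, l / 2)); split=> //=.
    by split=> /=; auto.
pose u k := iter k nxt (0, 0, 1).
have ul k : (u k).2 = (2^-1) ^+ k /\ bad (u k).
  elim: k => [|k [IH1 IH2]]; first by rewrite expr0.
  have p0 : 0 < (u k).2 by rewrite IH1 exprn_gt0 ?invr_gt0.
  have [[_ _ h] hb] := nxtP _ p0 IH2.
  by rewrite exprSr -IH1.
have upos k : 0 < (u k).2 by rewrite (ul k).1 exprn_gt0 ?invr_gt0.
have uc k : child (u k) (u k.+1) by apply: (nxtP _ (upos k) (ul k).2).1.
have [X XP] : exists X, forall k, (u k).1.1 <= X <= (u k).1.1 + (u k).2.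
  apply: nested_point => k; last exact: ltW.
  by have [h1 _ ->] := uc k; have := upos k; case: h1 => ->; split; lra.
have [Y YP] : exists Y, forall k, (u k).1.2 <= Y <= (u k).1.2 + (u k).2.
  apply: nested_point => k; last exact: ltW.
  by have [_ h1 ->] := uc k; have := upos k; case: h1 => ->; split; lra.
have [||d d0 dP] := loc X Y.
- by have := XP 0%N; rewrite /= add0r.
- by have := YP 0%N; rewrite /= add0r.
have [k kd] := half_pow_lt d0.
have inv j : [/\ 0 <= (u j).1.1, (u j).1.1 + (u j).2 <= 1,
    0 <= (u j).1.2 & (u j).1.2 + (u j).2 <= 1].
  elim: j => [|j [h1 h2 h3 h4]]; first by rewrite /= !add0r.
  have [c1 c2 ->] := uc j; have := upos j.
  by case: c1 => ->; case: c2 => ->; split; lra.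
apply: (ul k).2; have [h1 h2 h3 h4] := inv k.
have /andP[h5 h6] := XP k; have /andP[h7 h8] := YP k.
apply: dP; [|by apply/andP..].
by rewrite upos (ul k).1.
Qed.

End Bisection.

Section Contour.
Variable R : realType.
Implicit Types (f g : R[i] -> R[i]) (a v w z h : R[i]) (r e M t s : R).

(* Left Riemann sums of [f] over the segment from [a] to [a + v]. *)
Definition edge f n a v : R[i] :=
  \sum_(k < 2 ^ n) f (a + v * (k%:R / 2 ^+ n)) * (v / 2 ^+ n).

Lemma edgeS f n a v :
  edge f n.+1 a v = edge f n a (v / 2) + edge f n (a + v / 2) (v / 2).
Proof.
have n0 : 2 ^+ n != 0 :> R[i] by rewrite expf_neq0 // pnatr_eq0.
have two0 : 2%:R != 0 :> R[i] by rewrite pnatr_eq0.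
rewrite /edge expnS mul2n -addnn big_split_ord /=; congr (_ + _).
  apply: eq_bigr => k _; rewrite exprS; congr (f _ * _); field; rewrite n0 //.
apply: eq_bigr => k _; rewrite exprS natrD natrX.
by congr (f _ * _); field; rewrite n0.
Qed.

Lemma edgeB f g n a v :
  edge (fun w => f w - g w) n a v = edge f n a v - edge g n a v.
Proof. by rewrite /edge -sumrB; apply: eq_bigr => k _; rewrite mulrBl. Qed.

Lemma edgeZ f n a v c : edge (fun w => c * f w) n a v = c * edge f n a v.
Proof. by rewrite /edge mulr_sumr; apply: eq_bigr => k _; rewrite -mulrA. Qed.

Lemma edgeN f n a v : edge (fun w => - f w) n a v = - edge f n a v.
Proof. by rewrite /edge -sumrN; apply: eq_bigr => k _; rewrite mulNr. Qed.

Lemma edge_bound f n a v B :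
  (forall t, 0 <= t <= 1 -> nm (f (a + v * t%:C)) <= B) ->
  nm (edge f n a v) <= nm v * B.
Proof.
move=> fB; apply: le_trans (nm_sum _ _ _) _.
have n0 : 0 < 2 ^+ n :> R by rewrite exprn_gt0.
apply: (@le_trans _ _ (\sum_(k < 2 ^ n) (B * (nm v / 2 ^+ n)))).
  apply: ler_sum => k _.
  have -> : k%:R / 2 ^+ n = (k%:R / 2 ^+ n : R)%:C.
    by rewrite rmorphM fmorphV rmorphXn !rmorph_nat.
  rewrite nmM [nm (v / _)]nmM nmV nmX nm_nat ler_wpM2r //.
    by rewrite divr_ge0 ?nm_ge0 // ltW.
  apply: fB; apply/andP; split; first by rewrite divr_ge0 // ltW.
  by rewrite ler_pdivrMr // mul1r -natrX ler_nat ltnW.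
rewrite sumr_const card_ord -[_ *+ _]mulr_natr natrX.
by rewrite le_eqVlt; apply/orP; left; apply/eqP; field; rewrite gt_eqF.
Qed.

(** The error of the left sum is [v ^+ 2] times a quantity depending on [n] alone, so it cancels
    between opposite sides of a square. *)
Lemma edge_affine (al be b : R[i]) n a v :
  edge (fun w => al + be * (w - b)) n a v = v * al + be * ((a - b) * v +
    v ^+ 2 * \sum_(k < 2 ^ n) (k%:R / 2 ^+ n / 2 ^+ n)).
Proof.
have n0 : 2 ^+ n != 0 :> R[i] by rewrite expf_neq0 // pnatr_eq0.
rewrite /edge.
under eq_bigr => k _.
  rewrite (_ : _ * _ = ((al + be * (a - b)) * (v / 2 ^+ n)) +
    be * (v ^+ 2 * (k%:R / 2 ^+ n / 2 ^+ n))); last by field; rewrite n0.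
  over.
rewrite big_split /= sumr_const card_ord -!mulr_sumr -[X in X + _ = _]mulr_natr natrX.
by rewrite [in RHS]mulrDr [RHS]addrA; congr (_ + _); field; rewrite n0.
Qed.

(* The Riemann sum of [f] around the square with corner [a] and side [h]. *)
Definition contour f n a h := edge f n a h + edge f n (a + h) (h * 'i)
  - edge f n (a + h * 'i) h - edge f n a (h * 'i).

(** By [edgeS] the sum at level [n.+1] over a segment is the sum at level [n] over its two halves,
    so the inner edges of the four quarters cancel exactly and not only in the limit. *)
Lemma contourS f n a h : contour f n.+1 a h =
  contour f n a (h / 2) + contour f n (a + h / 2) (h / 2) +
  contour f n (a + h / 2 * 'i) (h / 2) + contour f n (a + h / 2 + h / 2 * 'i) (h / 2).
Proof.
rewrite /contour !edgeS.
have -> : h * 'i / 2 = h / 2 * 'i by rewrite mulrAC.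
have two0 : 2%:R != 0 :> R[i] by rewrite pnatr_eq0.
have e1 : a + h / 2 + h / 2 = a + h by field.
have e2 : a + h / 2 * 'i + h / 2 * 'i = a + h * 'i by field.
have e3 : a + h / 2 + h / 2 * 'i + h / 2 = a + h + h / 2 * 'i by field.
have e4 : a + h / 2 + h / 2 * 'i + h / 2 * 'i = a + h * 'i + h / 2 by field.
have e5 : a + h / 2 * 'i + h / 2 = a + h / 2 + h / 2 * 'i by ring.
by rewrite !(e1, e2, e3, e4, e5); ring.
Qed.

Lemma contourB f g n a h :
  contour (fun w => f w - g w) n a h = contour f n a h - contour g n a h.
Proof. by rewrite /contour !edgeB; ring. Qed.

Lemma contourZ f n a h c : contour (fun w => c * f w) n a h = c * contour f n a h.
Proof. by rewrite /contour !edgeZ; ring. Qed.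

Lemma contour_affine al be b n a h :
  contour (fun w => al + be * (w - b)) n a h = 0.
Proof. by rewrite /contour !edge_affine; ring. Qed.

Definition frame a h w := exists2 t, 0 <= t <= 1 &
  [\/ w = a + h * t%:C, w = a + h + h * 'i * t%:C, w = a + h * 'i + h * t%:C |
    w = a + h * 'i * t%:C].

Lemma contour_bound f n a h B : (forall w, frame a h w -> nm (f w) <= B) ->
  nm (contour f n a h) <= 4 * nm h * B.
Proof.
move=> fB; have hi : nm (h * 'i) = nm h by rewrite nmM nm_i mulr1.
have b1 : nm (edge f n a h) <= nm h * B.
  by apply: edge_bound => t tP; apply: fB; exists t => //; constructor.
have b2 : nm (edge f n (a + h) (h * 'i)) <= nm h * B.
  by rewrite -hi; apply: edge_bound => t tP; apply: fB; exists t => //; constructor.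
have b3 : nm (edge f n (a + h * 'i) h) <= nm h * B.
  by apply: edge_bound => t tP; apply: fB; exists t => //; constructor.
have b4 : nm (edge f n a (h * 'i)) <= nm h * B.
  by rewrite -hi; apply: edge_bound => t tP; apply: fB; exists t => //; constructor.
rewrite /contour; apply: le_trans (nmB _ _) _.
apply: le_trans (lerD (nmB _ _) (lexx _)) _.
apply: le_trans (lerD (lerD (nmD _ _) (lexx _)) (lexx _)) _.
by lra.
Qed.

Definition square a h w := exists s t, [/\ 0 <= s <= 1, 0 <= t <= 1 &
  w = a + h * (s%:C + 'i * t%:C)].

Lemma frame_square a h w : frame a h w -> square a h w.
Proof.
case=> t tP [] ->.
- by exists t, 0; split; rewrite ?lexx ?ler01 // rmorph0; ring.
- by exists 1, t; split; rewrite ?lexx ?ler01 // rmorph1; ring.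
- by exists t, 1; split; rewrite ?lexx ?ler01 // rmorph1; ring.
- by exists 0, t; split; rewrite ?lexx ?ler01 // rmorph0; ring.
Qed.

Lemma nm_st s t : nm (s%:C + 'i * t%:C) <= `|s| + `|t|.
Proof. by apply: le_trans (nmD _ _) _; rewrite nmM nm_i mul1r !nm_real. Qed.

Lemma square_diam a h w z : square a h w -> square a h z -> nm (w - z) <= 2 * nm h.
Proof.
move=> [s [t [sP tP ->]]] [s' [t' [sP' tP' ->]]].
rewrite (_ : _ - _ = h * ((s - s')%:C + 'i * (t - t')%:C)).
  rewrite nmM mulrC ler_wpM2r ?nm_ge0 //; apply: le_trans (nm_st _ _) _.
  have h1 : `|s - s'| <= 1 by rewrite ler_norml; apply/andP; split; lra.
  have h2 : `|t - t'| <= 1 by rewrite ler_norml; apply/andP; split; lra.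
  by lra.
by rewrite !rCB; ring.
Qed.

Definition vanish (c : nat -> R[i]) :=
  forall e, 0 < e -> exists N, forall n, (N <= n)%N -> nm (c n) <= e.

(** The bound to be bisected is proportional to the area of the square, hence additive over
    quarters. On a small square [f] differs little from an affine function, whose contour sum is 0.
    The level from which the bound holds may depend on the square. *)
Lemma goursat f a h : (forall w, square a h w -> exists d, cdiff f w d) ->
  vanish (fun n => contour f n a h).
Proof.
move=> df; have [->|h0] := eqVneq h 0.
  move=> e e0; exists 0%N => n _; rewrite (_ : contour _ _ _ _ = 0) ?nm0 ?ltW //.
  apply/eqP; rewrite -nm_eq0; apply/eqP/le_anti; rewrite nm_ge0 andbT.
  apply: le_trans (@contour_bound f n a 0 (nm (f a)) _) _.
    by move=> w [t _]; rewrite !mul0r !addr0 => -[] ->.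
  by rewrite nm0 mulr0 mul0r.
have hp : 0 < nm h by rewrite nm_gt0.
move=> e e0.
(* Normalised so that the area bound for the full square is [e]. *)
pose A := e / nm h ^+ 2.
have A0 : 0 < A by rewrite divr_gt0 // exprn_gt0.
pose P (x y l : R) := exists N, forall n, (N <= n)%N ->
  nm (contour f n (a + h * (x%:C + 'i * y%:C)) (h * l%:C)) <=
    A * (nm h * l) ^+ 2.
have [] : P 0 0 1; last first.
  move=> N NP; exists N => n /NP; rewrite !rmorph0 rmorph1 !mulr0 !mulr1 addr0 mulr0 addr0.
  by rewrite /A divfK // gt_eqF // exprn_gt0.
apply: bisect2 => [x y l l0 [N1 P1] [N2 P2] [N3 P3] [N4 P4]|X Y XP YP].
  exists (maxn (maxn N1 N2) (maxn N3 N4)).+1 => -[//|n].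
  rewrite ltnS !geq_max => /andP[/andP[/P1 h1 /P2 h2] /andP[/P3 h3 /P4 h4]].
  have two0 : 2%:R != 0 :> R[i] by rewrite pnatr_eq0.
  have hl : h * (l / 2)%:C = h * l%:C / 2 by rewrite rCM rCV rC_nat mulrA.
  rewrite contourS; move: h1 h2 h3 h4; rewrite !rCD !hl.
  rewrite !rCM !rCV !rC_nat.
  have -> : a + h * (x%:C + l%:C / 2 + 'i * y%:C) =
    a + h * (x%:C + 'i * y%:C) + h * l%:C / 2 by field.
  have -> : a + h * (x%:C + 'i * (y%:C + l%:C / 2)) =
    a + h * (x%:C + 'i * y%:C) + h * l%:C / 2 * 'i by field.
  have -> : a + h * (x%:C + l%:C / 2 + 'i * (y%:C + l%:C / 2)) =
    a + h * (x%:C + 'i * y%:C) + h * l%:C / 2 + h * l%:C / 2 * 'i by field.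
  move=> h1 h2 h3 h4.
  apply: le_trans (nmD _ _) _; apply: le_trans (lerD (nmD _ _) (lexx _)) _.
  apply: le_trans (lerD (lerD (nmD _ _) (lexx _)) (lexx _)) _.
  have -> : A * (nm h * l) ^+ 2 = A * (nm h * (l / 2)) ^+ 2 + A * (nm h * (l / 2)) ^+ 2 +
    A * (nm h * (l / 2)) ^+ 2 + A * (nm h * (l / 2)) ^+ 2 by field.
  by rewrite !lerD.
pose z := a + h * (X%:C + 'i * Y%:C).
have [|b /cdiffP zb] := df z; first by exists X, Y.
(* The perimeter is 4 times the side and points of the square are within 2 sides of [z], so the
   factor [A / 8] yields [A] times the square of the side. *)
have [|r r0 rP] := zb (A / 8); first by lra.
exists (r / (2 * nm h)) => [|x y l /andP[l0 ld] /andP[x0 xX] /andP[y0 yY]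
    /andP[Xl xl] /andP[Yl yl]]; first by rewrite divr_gt0 // mulr_gt0.
exists 0%N => n _; pose a' := a + h * (x%:C + 'i * y%:C); pose h' := h * l%:C.
rewrite -/a' -/h'.
have nh' : nm h' = nm h * l by rewrite nmM nm_real gtr0_norm.
have zsq : square a' h' z.
  exists ((X - x) / l), ((Y - y) / l); split.
  - by rewrite divr_ge0 ?ler_pdivrMr /=; lra.
  - by rewrite divr_ge0 ?ler_pdivrMr /=; lra.
  have l0' : l%:C != 0 :> R[i] by rewrite rC_eq0 gt_eqF.
  by rewrite /z /a' /h' !rCM !rCV !rCB; field.
have -> : contour f n a' h' =
    contour (fun w => f w - (f z + b * (w - z))) n a' h'.
  by rewrite contourB contour_affine subr0.
have -> : A * (nm h * l) ^+ 2 = 4 * nm h' * (A / 8 * (2 * nm h')) by rewrite nh'; field.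
apply: contour_bound => w /frame_square wsq; have wz := square_diam wsq zsq.
rewrite opprD addrA; apply: le_trans (rP _ _) _.
  apply: le_lt_trans wz _; rewrite nh' -(ltr_pdivlMl _ _ (_ : 0 < 2)) //.
  rewrite -ltr_pdivlMl // (lt_le_trans ld) // le_eqVlt; apply/orP; left.
  by apply/eqP; field; rewrite gt_eqF.
by rewrite ler_wpM2l // divr_ge0 // ltW.
Qed.

End Contour.

Section CenterEstimate.
Variable R : realType.
Implicit Types (f g F : R[i] -> R[i]) (a v w z h d : R[i]) (r e M t s x y : R).

Lemma frame_center z s w : 0 < s -> frame (z - s%:C * (1 + 'i)) (2 * s%:C) w ->
  s <= nm (w - z) <= 2 * s.
Proof.
move=> s0 [t /andP[t0 t1] H].
have [x [y [-> xy hx hy]]] : exists x y, [/\ w - z = s%:C * (x%:C + 'i * y%:C),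
    `|x| = 1 \/ `|y| = 1, `|x| <= 1 & `|y| <= 1].
  have ht : `|2 * t - 1| <= 1 by rewrite ler_norml; apply/andP; split; lra.
  have n1 : `|-1| = 1 :> R by rewrite normrN1.
  have ii : 'i * 'i = -1 :> R[i] by rewrite -expr2 sqr_i.
  case: H => ->.
  - exists (2 * t - 1), (-1); split; rewrite ?n1 ?lexx; auto.
    by rewrite rCB rCM rC_nat rCN rmorph1; ring.
  - exists 1, (2 * t - 1); split; rewrite ?normr1 ?lexx; auto.
    by rewrite rCB rCM rC_nat rmorph1; ring.
  - exists (2 * t - 1), 1; split; rewrite ?normr1 ?lexx; auto.
    by rewrite rCB rCM rC_nat rmorph1; ring.
  - exists (-1), (2 * t - 1); split; rewrite ?n1 ?lexx; auto.
    by rewrite rCB rCM rC_nat rCN rmorph1; ring.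
rewrite nmM nm_real gtr0_norm // mulrC ler_pMl // ler_pM2r //.
apply/andP; split; last by apply: le_trans (nm_st _ _) _; lra.
have rx : Re (x%:C + 'i * y%:C) = x by rewrite /= !mul0r mul1r; ring.
have iy : Im (x%:C + 'i * y%:C) = y by rewrite /= !mul0r !mul1r; ring.
case: xy => <-; first by rewrite -{1}rx Re_le_nm.
by rewrite -{1}iy Im_le_nm.
Qed.

(** For integers [p] and [q] from -2 to 1, these are the twelve outer cells of a 4 by 4 grid centred
    at 0; they do not touch the centre. *)
Lemma nm_cell_ge x y s t p q : 0 <= s <= 1 -> 0 <= t <= 1 ->
  p <= -2 \/ 1 <= p \/ q <= -2 \/ 1 <= q ->
  (p + s)%:C + 'i * (q + t)%:C != 0 :> R[i].
Proof.
move=> /andP[s0 s1] /andP[t0 t1] H; rewrite -nm_gt0.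
have rx : Re ((p + s)%:C + 'i * (q + t)%:C) = p + s by rewrite /= !mul0r !mul1r; ring.
have iy : Im ((p + s)%:C + 'i * (q + t)%:C) = q + t by rewrite /= !mul0r !mul1r; ring.
have := Re_le_nm ((p + s)%:C + 'i * (q + t)%:C); rewrite rx.
have := Im_le_nm ((p + s)%:C + 'i * (q + t)%:C); rewrite iy.
rewrite !ler_norml => /andP[h1 h2] /andP[h3 h4].
by case: H => [|[|[]]] h; lra.
Qed.

Lemma vanishD (c c' : nat -> R[i]) : vanish c -> vanish c' ->
  vanish (fun n => c n + c' n).
Proof.
move=> h h' e e0; have e2 : 0 < e / 2 by lra.
have [N NP] := h _ e2; have [N' NP'] := h' _ e2.
exists (maxn N N') => n; rewrite geq_max => /andP[/NP h1 /NP' h2].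
by apply: le_trans (nmD _ _) _; lra.
Qed.

Definition cell f z h n (p q : R[i]) := contour f n (z + h * (p + 'i * q)) h.

Lemma contour_cells f z h n :
  contour f n.+1 (z - h * (1 + 'i)) (2 * h) =
  cell f z h n (-1) (-1) + cell f z h n 0 (-1) +
  cell f z h n (-1) 0 + cell f z h n 0 0.
Proof.
have two0 : 2%:R != 0 :> R[i] by rewrite pnatr_eq0.
have h2 : 2 * h / 2 = h by field.
rewrite contourS h2 /cell.
by congr (_ + _ + _ + _); congr (contour f n _ h); ring.
Qed.

(** Two subdivisions cut the square of side [4 h] about [z] into 16 cells; the four inner ones make
    up the square of side [2 h], and the twelve others are listed. *)
Lemma contour_cells2 f z h n :
  contour f n.+2 (z - 2 * h * (1 + 'i)) (2 * (2 * h)) =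
  contour f n.+1 (z - h * (1 + 'i)) (2 * h) +
  ((cell f z h n (-2) (-2) + cell f z h n (-1) (-2)) +
   (cell f z h n 0 (-2) + cell f z h n 1 (-2)) +
   (cell f z h n (-2) 1 + cell f z h n (-1) 1) +
   (cell f z h n 0 1 + cell f z h n 1 1) +
   (cell f z h n (-2) (-1) + cell f z h n (-2) 0) +
   (cell f z h n 1 (-1) + cell f z h n 1 0)).
Proof.
have two0 : 2%:R != 0 :> R[i] by rewrite pnatr_eq0.
have h2 : 2 * h / 2 = h by field.
have h4 : 2 * (2 * h) / 2 = 2 * h by field.
have E a p q : a = z + h * (p + 'i * q) -> contour f n.+1 a (2 * h) =
    cell f z h n p q + cell f z h n (p + 1) q + cell f z h n p (q + 1) +
    cell f z h n (p + 1) (q + 1).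
  move=> ->; rewrite contourS h2 /cell.
  by congr (_ + _ + _ + _); congr (contour f n _ h); ring.
have two1 : -2 + 1 = -1 :> R[i] by ring.
rewrite [LHS]contourS h4 contour_cells.
rewrite (E _ (-2) (-2)); last by ring.
rewrite (E _ 0 (-2)); last by ring.
rewrite (E _ (-2) 0); last by ring.
rewrite (E _ 0 0); last by ring.
by rewrite two1 !add0r; ring.
Qed.

End CenterEstimate.

Section CenterEstimate2.
Variable R : realType.
Implicit Types (f g F : R[i] -> R[i]) (a v w z d : R[i]) (r e M t s x y h B : R).

(** The contour sum over the square with centre [z] and side [2 s]. *)
Let ctr f n z s := contour f n (z - s%:C * (1 + 'i)) (2 * s%:C).

Lemma cell_vanish f z s p q : 0 < s ->
  (forall w, w != z -> nm (w - z) <= 2 * s -> exists d, cdiff f w d) ->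
  p <= -2 \/ 1 <= p \/ q <= -2 \/ 1 <= q -> -2 <= p <= 1 -> -2 <= q <= 1 ->
  vanish (fun n => cell f z (s / 2)%:C n p%:C q%:C).
Proof.
move=> s0 df pq /andP[p1 p2] /andP[q1 q2]; apply: goursat => w [x [y [xP yP wE]]].
have wz : w - z = (s / 2)%:C * ((p + x)%:C + 'i * (q + y)%:C).
  by rewrite wE !rCD; ring.
have h0 : (s / 2)%:C != 0 :> R[i] by rewrite rC_eq0 gt_eqF // divr_gt0.
apply: df.
  by rewrite -subr_eq0 wz mulf_neq0 // nm_cell_ge.
rewrite wz nmM nm_real gtr0_norm ?divr_gt0 //.
have b1 : `|p + x| <= 2 by rewrite ler_norml; apply/andP; split; lra.
have b2 : `|q + y| <= 2 by rewrite ler_norml; apply/andP; split; lra.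
have := nm_st (p + x) (q + y); nra.
Qed.

(** Goursat's theorem applies to the twelve outer cells, which avoid [z]. Hence halving the square
    costs nothing in the limit, although [f] may be singular at [z]. *)
Lemma ctr_shrink f z s : 0 < s ->
  (forall w, w != z -> nm (w - z) <= 2 * s -> exists d, cdiff f w d) ->
  vanish (fun n => ctr f n.+2 z s - ctr f n.+1 z (s / 2)).
Proof.
move=> s0 df; pose h : R[i] := (s / 2)%:C.
have two0 : 2%:R != 0 :> R[i] by rewrite pnatr_eq0.
have sh : s%:C = 2 * h :> R[i] by rewrite /h rCM rCV rC_nat; field.
rewrite (_ : (fun n => _) = fun n =>
  ((cell f z h n (-2) (-2) + cell f z h n (-1) (-2)) +
   (cell f z h n 0 (-2) + cell f z h n 1 (-2)) +
   (cell f z h n (-2) 1 + cell f z h n (-1) 1) +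
   (cell f z h n 0 1 + cell f z h n 1 1) +
   (cell f z h n (-2) (-1) + cell f z h n (-2) 0) +
   (cell f z h n 1 (-1) + cell f z h n 1 0))); last first.
  by apply/funext => n; rewrite /ctr sh contour_cells2 -/h; ring.
have W (p q : R) (p' q' : R[i]) : p%:C = p' -> q%:C = q' ->
  p <= -2 \/ 1 <= p \/ q <= -2 \/ 1 <= q -> -2 <= p <= 1 -> -2 <= q <= 1 ->
   vanish (fun n => cell f z h n p' q') by move=> <- <-; exact: cell_vanish.
have m2 : (-2)%:C = -2 :> R[i] by rewrite rCN rC_nat.
have m1 : (-1)%:C = -1 :> R[i] by rewrite rCN.
have c0 : 0%:C = 0 :> R[i] by [].
have c1 : 1%:C = 1 :> R[i] by [].
have v1 : vanish (fun n => cell f z h n (-2) (-2)).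
  by apply: (W _ _ _ _ m2 m2); [left; lra|lra|lra].
have v2 : vanish (fun n => cell f z h n (-1) (-2)).
  by apply: (W _ _ _ _ m1 m2); [right; right; left; lra|lra|lra].
have v3 : vanish (fun n => cell f z h n (0) (-2)).
  by apply: (W _ _ _ _ c0 m2); [right; right; left; lra|lra|lra].
have v4 : vanish (fun n => cell f z h n (1) (-2)).
  by apply: (W _ _ _ _ c1 m2); [right; left; lra|lra|lra].
have v5 : vanish (fun n => cell f z h n (-2) (1)).
  by apply: (W _ _ _ _ m2 c1); [left; lra|lra|lra].
have v6 : vanish (fun n => cell f z h n (-1) (1)).
  by apply: (W _ _ _ _ m1 c1); [right; right; right; lra|lra|lra].
have v7 : vanish (fun n => cell f z h n (0) (1)).
  by apply: (W _ _ _ _ c0 c1); [right; right; right; lra|lra|lra].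
have v8 : vanish (fun n => cell f z h n (1) (1)).
  by apply: (W _ _ _ _ c1 c1); [right; left; lra|lra|lra].
have v9 : vanish (fun n => cell f z h n (-2) (-1)).
  by apply: (W _ _ _ _ m2 m1); [left; lra|lra|lra].
have v10 : vanish (fun n => cell f z h n (-2) (0)).
  by apply: (W _ _ _ _ m2 c0); [left; lra|lra|lra].
have v11 : vanish (fun n => cell f z h n (1) (-1)).
  by apply: (W _ _ _ _ c1 m1); [right; left; lra|lra|lra].
have v12 : vanish (fun n => cell f z h n (1) (0)).
  by apply: (W _ _ _ _ c1 c0); [right; left; lra|lra|lra].
exact: (vanishD (vanishD (vanishD (vanishD (vanishD (vanishD v1 v2) (vanishD v3 v4)) (vanishD v5 v6)) (vanishD v7 v8)) (vanishD v9 v10)) (vanishD v11 v12)).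
Qed.

Lemma ctr_bound_shrink f z j s B e : 0 < s -> 0 < e ->
  (forall w, w != z -> nm (w - z) <= 2 * s -> exists d, cdiff f w d) ->
  (forall n, nm (ctr f n z (s / 2 ^+ j)) <= B) ->
  exists N, forall n, (N <= n)%N -> nm (ctr f n z s) <= B + e.
Proof.
move=> s0 e0; elim: j s s0 e e0 => [|j IH] s s0 e e0 df hB.
  by exists 0%N => n _; have := hB n; rewrite expr0 divr1; lra.
have e2 : 0 < e / 2 by lra.
have [|||N NP] := IH (s / 2) _ (e / 2) e2; first by rewrite divr_gt0.
- by move=> w wz ws; apply: df => //; apply: le_trans ws _; lra.
- by move=> n; rewrite -mulrA -invfM -exprS.
have [N' N'P] := ctr_shrink s0 df e2.
exists (maxn N N').+2 => -[//|[//|n]]; rewrite !ltnS geq_max => /andP[Nn N'n].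
have h1 := NP n.+1 (leqW Nn); have h2 := N'P n N'n.
have := nm_lerB (ctr f n.+2 z s) (ctr f n.+1 z (s / 2)); lra.
Qed.

Lemma ctr_quotient_vanish F z s : 0 < s -> ccont F z ->
  (forall w, w != z -> nm (w - z) <= 2 * s -> exists d, cdiff F w d) ->
  vanish (fun n => ctr (fun w => (F w - F z) / (w - z)) n z s).
Proof.
move=> s0 cF dF e e0.
(* On the square of half side [s'] the quotient is at most [e / 16 / s'] and the perimeter is
   [8 s'], which gives the bound [e / 2] needed below. *)
have [|r r0 rP] := cF (e / 16); first by lra.
have [j jr] := half_pow_lt (divr_gt0 r0 (mulr_gt0 (ltr0n R 3) s0)).
pose s' := s / 2 ^+ j.
have s'0 : 0 < s' by rewrite divr_gt0 // exprn_gt0.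
have s'r : 2 * s' < r.
  move: jr; rewrite exprVn => jr; rewrite /s'.
  have : 0 < (2 ^+ j)^-1 :> R by rewrite invr_gt0 exprn_gt0.
  by move: jr; rewrite ltr_pdivlMr ?mulr_gt0 //; nra.
have e2 : 0 < e / 2 by lra.
have [||N NP] := @ctr_bound_shrink (fun w => (F w - F z) / (w - z)) z j s (e / 2) _ s0 e2.
- move=> w wz ws; have [d hd] := dF w wz ws.
  have wz0 : w - z != 0 by rewrite subr_eq0.
  eexists; apply: cdiffM.
    by apply: cdiffB; [exact: hd|exact: cdiff_cst].
  apply: cdiffV => //; apply: cdiffB; [exact: cdiff_id|exact: cdiff_cst].
- move=> n; apply: le_trans (@contour_bound _ _ _ _ _ (e / 16 / s') _) _.
    move=> w /(frame_center s'0) /andP[w1 w2].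
    have wz0 : 0 < nm (w - z) by exact: lt_le_trans w1.
    rewrite nmM nmV ler_pM ?nm_ge0 ?invr_ge0 ?nm_ge0 //.
      by rewrite ltW // rP // (le_lt_trans w2).
    by rewrite lef_pV2 ?posrE.
  rewrite nmM nm_real gtr0_norm // (_ : nm 2 = 2) ?nm_nat //.
  rewrite -/s' le_eqVlt; apply/orP; left; apply/eqP.
  by field; rewrite gt_eqF.
by exists N => n /NP; lra.
Qed.

Lemma edge_Im_ge f n a v B :
  (forall t, 0 <= t <= 1 -> B <= Im (f (a + v * t%:C) * v)) -> B <= Im (edge f n a v).
Proof.
move=> fB; have n0 : 0 < 2 ^+ n :> R by rewrite exprn_gt0.
have -> : edge f n a v = (2 ^+ n)^-1%:C *
    \sum_(k < 2 ^ n) f (a + v * (k%:R / 2 ^+ n : R)%:C) * v.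
  rewrite /edge mulr_sumr; apply: eq_bigr => k _.
  rewrite !(rCM, rCV) rC_nat -(rC_nat _ 2) -rmorphXn /=.
  by rewrite rmorphXn /= rC_nat; ring.
have ImM (x : R) (y : R[i]) : Im (x%:C * y) = x * Im y by case: y => p q /=; ring.
have ImS (I : Type) (r : seq I) (G : I -> R[i]) :
    Im (\sum_(i <- r) G i) = \sum_(i <- r) Im (G i).
  by apply: (@big_morph _ _ (@complex.Im R) 0 +%R 0 +%R) => // -[? ?] [? ?].
rewrite ImM ImS mulrC ler_pdivlMr //.
have -> : B * 2 ^+ n = \sum_(k < 2 ^ n) B by rewrite sumr_const card_ord -[RHS]mulr_natr natrX.
apply: ler_sum => k _; apply: fB; apply/andP; split; first by rewrite divr_ge0 // ltW.
by rewrite ler_pdivrMr // mul1r -natrX ler_nat ltnW.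
Qed.

Lemma ReV (x y : R) : Re (x%:C + 'i * y%:C)^-1 = x / (x ^+ 2 + y ^+ 2).
Proof. by rewrite /= !mul0r !mul1r !(oppr0, addr0, add0r). Qed.

Lemma ImV (x y : R) : Im (x%:C + 'i * y%:C)^-1 = - y / (x ^+ 2 + y ^+ 2).
Proof. by rewrite /= !mul0r !mul1r !(oppr0, addr0, add0r) mulNr. Qed.

(** On each side, after scaling and with the orientation included, the imaginary part of the
    integrand is [2 / (1 + x ^+ 2)] with [x ^+ 2 <= 1], hence at least 1. So every Riemann sum, at
    any level, gets at least 1 from each side. *)
Lemma winding_ge z s n : 0 < s -> 4 <= Im (ctr (fun w => (w - z)^-1) n z s).
Proof.
move=> s0; have sC0 : s%:C != 0 :> R[i] by rewrite rC_eq0 gt_eqF.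
have ii : 'i * 'i = -1 :> R[i] by rewrite -expr2 sqr_i.
have sX (X k : R[i]) : (s%:C * X)^-1 * (k * s%:C) = k * X^-1.
  by rewrite invfM; move: (X^-1) => Y; field.
have unit_ge (x y : R) : y ^+ 2 = 1 -> x ^+ 2 <= 1 -> 1 <= 2 / (x ^+ 2 + y ^+ 2).
  by move=> -> x1; have x0 := sqr_ge0 x; rewrite ler_pdivlMr; lra.
have I2 (u : R[i]) : Im (2 * u) = 2 * Im u by case: u => a b /=; ring.
have I2i (u : R[i]) : Im (2 * 'i * u) = 2 * Re u by case: u => a b /=; ring.
have IN (u : R[i]) : Im (- u) = - Im u by case: u.
have ID (u v : R[i]) : Im (u + v) = Im u + Im v by case: u v => ? ? [? ?].
have tsq (t : R) : 0 <= t <= 1 -> (2 * t - 1) ^+ 2 <= 1 by move=> /andP[? ?]; nra.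
rewrite /ctr /contour !ID !IN.
have h1 : 1 <= Im (edge (fun w => (w - z)^-1) n (z - s%:C * (1 + 'i)) (2 * s%:C)).
  apply: edge_Im_ge => t /tsq tP.
  rewrite (_ : _ * _ = 2 * ((2 * t - 1)%:C + 'i * (-1)%:C)^-1); last first.
    have -> : z - s%:C * (1 + 'i) + 2 * s%:C * t%:C - z =
      s%:C * ((2 * t - 1)%:C + 'i * (-1)%:C).
      by rewrite rCB rCM rC_nat rCN rmorph1; ring.
    exact: sX.
  by rewrite I2 ImV opprK mulrA mulr1; apply: unit_ge => //; rewrite sqrrN expr1n.
have h2 : 1 <= Im (edge (fun w => (w - z)^-1) n (z - s%:C * (1 + 'i) + 2 * s%:C)
    (2 * s%:C * 'i)).
  apply: edge_Im_ge => t /tsq tP.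
  rewrite (_ : _ * _ = 2 * 'i * (1%:C + 'i * (2 * t - 1)%:C)^-1); last first.
    have -> : z - s%:C * (1 + 'i) + 2 * s%:C + 2 * s%:C * 'i * t%:C - z =
      s%:C * (1%:C + 'i * (2 * t - 1)%:C).
      by rewrite rCB rCM rC_nat rmorph1; ring.
    by rewrite -[2 * _ * 'i]mulrAC sX.
  by rewrite I2i ReV mulrA mulr1 addrC; apply: unit_ge => //; rewrite expr1n.
have h3 : Im (edge (fun w => (w - z)^-1) n (z - s%:C * (1 + 'i) + 2 * s%:C * 'i)
    (2 * s%:C)) <= -1.
  rewrite -lerNr -IN -edgeN.
  apply: edge_Im_ge => t /tsq tP.
  rewrite (_ : _ * _ = - (2 * ((2 * t - 1)%:C + 'i * 1%:C)^-1)); last first.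
    have -> : z - s%:C * (1 + 'i) + 2 * s%:C * 'i + 2 * s%:C * t%:C - z =
      s%:C * ((2 * t - 1)%:C + 'i * 1%:C).
      by rewrite rCB rCM rC_nat rmorph1; ring.
    by rewrite mulNr sX.
  by rewrite IN I2 ImV mulNr mulrN opprK mulrA mulr1; apply: unit_ge => //; rewrite expr1n.
have h4 : Im (edge (fun w => (w - z)^-1) n (z - s%:C * (1 + 'i)) (2 * s%:C * 'i)) <= -1.
  rewrite -lerNr -IN -edgeN.
  apply: edge_Im_ge => t /tsq tP.
  rewrite (_ : _ * _ = - (2 * 'i * ((-1)%:C + 'i * (2 * t - 1)%:C)^-1)); last first.
    have -> : z - s%:C * (1 + 'i) + 2 * s%:C * 'i * t%:C - z =
      s%:C * ((-1)%:C + 'i * (2 * t - 1)%:C).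
      by rewrite rCB rCM rC_nat rCN rmorph1; ring.
    by rewrite mulNr -[2 * _ * 'i]mulrAC sX.
  rewrite IN I2i ReV mulNr mulrN opprK mulrA mulr1 addrC.
  by apply: unit_ge => //; rewrite sqrrN expr1n.
lra.
Qed.

(* As in Cauchy's formula, [F z] times the winding sum is, up to a vanishing term,
   the contour sum of [F w / (w - z)], which only sees [F] on the contour. *)
Lemma center_est F z s M : 0 < s -> ccont F z ->
  (forall w, w != z -> nm (w - z) <= 2 * s -> exists d, cdiff F w d) ->
  (forall w, s <= nm (w - z) <= 2 * s -> nm (F w) <= M) -> nm (F z) <= 2 * M.
Proof.
move=> s0 cF dF FM; apply/ler_addgt0Pl => e e0.
have [N NP] := ctr_quotient_vanish s0 cF dF e0.
have w4 := winding_ge z N s0.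
have nk : 4 <= nm (ctr (fun w => (w - z)^-1) N z s).
  by apply: le_trans w4 _; apply: le_trans (ler_norm _) (Im_le_nm _).
have E : F z * ctr (fun w => (w - z)^-1) N z s =
  ctr (fun w => F w / (w - z)) N z s - ctr (fun w => (F w - F z) / (w - z)) N z s.
  rewrite -contourZ -contourB; congr contour; apply/funext => w.
  by ring.
(* Perimeter [8 s] times the bound [M / s]; divided by the winding bound 4 this leaves the factor 2
   of the conclusion. *)
have b1 : nm (ctr (fun w => F w / (w - z)) N z s) <= 8 * M.
  have -> : 8 * M = 4 * nm (2 * s%:C : R[i]) * (M / s).
    by rewrite nmM nm_nat nm_real gtr0_norm //; field; rewrite gt_eqF.
  apply: contour_bound => w /(frame_center s0) /[dup] ws /andP[w1 w2].
  have wz0 : 0 < nm (w - z) by exact: lt_le_trans w1.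
  rewrite nmM nmV ler_pM ?nm_ge0 ?invr_ge0 ?nm_ge0 ?FM //.
  by rewrite lef_pV2 ?posrE.
have b2 := NP N (leqnn N).
have : nm (F z) * nm (ctr (fun w => (w - z)^-1) N z s) <= 8 * M + e.
  by rewrite -nmM E; apply: le_trans (nmB _ _) _; exact: lerD.
have := nm_ge0 (F z); nra.
Qed.

(** The slope of [f] at [z] takes the value [d] at [z] and is at most [2 M / s] at distance at least
    [s]; [center_est] doubles this. Only continuity of the slope at [z] is available at this stage,
    which is why [center_est] asks for no more. *)
Lemma cauchy_est f z d s M : 0 < s -> cdiff f z d ->
  (forall w, nm (w - z) <= 2 * s -> exists d, cdiff f w d) ->
  (forall w, nm (w - z) <= 2 * s -> nm (f w) <= M) -> nm d <= 4 * M / s.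
Proof.
move=> s0 fz df fM.
have -> : nm d = nm (slope f z d z) by rewrite /slope eqxx.
have -> : 4 * M / s = 2 * (2 * M / s) by ring.
apply: (center_est s0 (cdiff_slope fz)) => w.
- move=> wz ws; have [d' hd] := df w ws.
  have wz0 : w - z != 0 by rewrite subr_eq0.
  have h : cdiff (fun w => (f w - f z) / (w - z)) w
      ((d' - 0) / (w - z) + (f w - f z) * (- (1 - 0) / (w - z) ^+ 2)).
    apply: cdiffM; first by apply: cdiffB => //; exact: cdiff_cst.
    by apply: cdiffV => //; apply: cdiffB; [exact: cdiff_id|exact: cdiff_cst].
  eexists; apply: (@cdiff_near _ _ _ _ _ (nm (w - z)) _ _ h).
    by rewrite nm_gt0.
  move=> x xw; rewrite /slope; case: eqP => // xz.
  by move: xw; rewrite xz nm_distC ltxx.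
- move=> /andP[w1 w2].
  have wz0 : 0 < nm (w - z) := lt_le_trans s0 w1.
  have wz : w != z by rewrite -subr_eq0 -nm_gt0.
  rewrite /slope (negbTE wz) nmM nmV ler_pM ?nm_ge0 ?invr_ge0 ?nm_ge0 //.
    have := fM z; rewrite subrr nm0 => /(_ (mulr_ge0 (ler0n _ _) (ltW s0))) h.
    by apply: le_trans (nmB _ _) _; have := fM w w2; lra.
  by rewrite lef_pV2 ?posrE.
Qed.

End CenterEstimate2.

(** * Local theory of holomorphic functions *)

Section LocalTheory.
Variable R : realType.
Implicit Types (f g F G : R[i] -> R[i]) (a v w z d u : R[i]) (r e M t s K : R).

Definition holoB f z r := forall w, nm (w - z) < r -> cdiff f w (der f w).

(** The inequality with slack [E] is additive under bisection of the segment, and near a point [X]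
    it follows from the derivative there by comparing both endpoints with [X]. *)
Lemma mean_value f (u v : R[i]) M :
  (forall t, 0 <= t <= 1 -> exists2 d, cdiff f (u + (v - u) * t%:C) d & nm d <= M) ->
  nm (f v - f u) <= M * nm (v - u).
Proof.
move=> H; have M0 : 0 <= M.
  by have [|d _] := H 0; [lra|exact: le_trans (nm_ge0 d)].
have L0 := nm_ge0 (v - u).
apply/ler_addgt0Pl => e e0.
(* The 1 covers the case [u = v]; over the whole segment the slack adds up to at most [e]. *)
pose E := e / (nm (v - u) + 1).
have E0 : 0 < E by rewrite divr_gt0 // ltr_wpDl.
pose P (x y l : R) := nm (f (u + (v - u) * (x + l)%:C) - f (u + (v - u) * x%:C)) <=
  (M + E) * (l * nm (v - u)).
have P01 : P 0 0 1.
  apply: (@bisect2 R P) => [x y l l0 P1 P2 _ _|X Y XP _].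
    rewrite /P in P1 P2 *; have xl : x + l = x + l / 2 + l / 2 by field.
    apply: le_trans (nm_tri (f (u + (v - u) * (x + l / 2)%:C)) _ _) _.
    rewrite {1}xl; apply: le_trans (lerD P2 P1) _; nra.
  have [d /cdiffP fd dM] := H X XP.
  have [r r0 rP] := fd _ E0.
  exists (r / (nm (v - u) + 1)) => [|x y l /andP[l0 ld] /andP[x0 xX] _ /andP[Xl xl] _].
    by rewrite divr_gt0 // ltr_wpDl.
  have near t : x <= t <= x + l ->
      nm (f (u + (v - u) * t%:C) - f (u + (v - u) * X%:C)) <= (M + E) * (`|t - X| * nm (v - u)).
    move=> /andP[t1 t2]; pose z := u + (v - u) * X%:C; pose w := u + (v - u) * t%:C.
    have wz : w - z = (v - u) * (t - X)%:C by rewrite rCB /w /z; ring.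
    have nwz : nm (w - z) = `|t - X| * nm (v - u) by rewrite wz nmM nm_real mulrC.
    have tX : `|t - X| <= l by rewrite ler_norml; apply/andP; split; lra.
    have wr : nm (w - z) < r.
      rewrite nwz; move: ld; rewrite ltr_pdivlMr ?ltr_wpDl //; nra.
    have := rP w wr; rewrite -/z -/w -nwz => h.
    rewrite (_ : f w - f z = (f w - f z - d * (w - z)) + d * (w - z)); last by ring.
    apply: le_trans (nmD _ _) _; rewrite nmM mulrDl addrC lerD //.
    by rewrite ler_wpM2r ?nm_ge0.
  rewrite /P.
  have h1 : nm (f (u + (v - u) * (x + l)%:C) - f (u + (v - u) * X%:C)) <=
      (M + E) * ((x + l - X) * nm (v - u)).
    by have := near (x + l); rewrite ger0_norm ?subr_ge0 //; apply; lra.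
  have h2 : nm (f (u + (v - u) * x%:C) - f (u + (v - u) * X%:C)) <=
      (M + E) * ((X - x) * nm (v - u)).
    by have := near x; rewrite ler0_norm ?subr_le0 // opprB; apply; lra.
  apply: le_trans (nm_tri (f (u + (v - u) * X%:C)) _ _) _.
  rewrite [X in _ + X]nm_distC; apply: le_trans (lerD h1 h2) _.
  by rewrite le_eqVlt; apply/orP; left; apply/eqP; ring.
have := P01; rewrite /P add0r rmorph1 rmorph0 mulr1 mulr0 addr0 subrKC mul1r.
have : E * nm (v - u) <= e.
  by rewrite /E mulrAC ler_pdivrMr ?ltr_wpDl // ler_pM2l //; lra.
by lra.
Qed.

Lemma nm_segment z r (x y : R[i]) t : nm (x - z) < r -> nm (y - z) < r -> 0 <= t <= 1 ->
  nm (x + (y - x) * t%:C - z) < r.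
Proof.
move=> xr yr /andP[t0 t1].
have -> : x + (y - x) * t%:C - z = (1 - t)%:C * (x - z) + t%:C * (y - z).
  by rewrite rCB rmorph1; ring.
apply: le_lt_trans (nmD _ _) _; rewrite !nmM !nm_real !ger0_norm ?subr_ge0 //.
have [->|tn0] := eqVneq t 0; first by rewrite subr0 mul0r mul1r addr0.
have tp : 0 < t by rewrite lt_neqAle eq_sym tn0.
have h1 : (1 - t) * nm (x - z) <= (1 - t) * r by rewrite ler_wpM2l ?subr_ge0 // ltW.
have h2 : t * nm (y - z) < t * r by rewrite ltr_pM2l.
by lra.
Qed.

Lemma mean_value_ball f z r M (x y : R[i]) : holoB f z r ->
  (forall w, nm (w - z) < r -> nm (der f w) <= M) ->
  nm (x - z) < r -> nm (y - z) < r -> nm (f y - f x) <= M * nm (y - x).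
Proof.
move=> fh fM xr yr; apply: mean_value => t tP; have h := nm_segment xr yr tP.
by exists (der f (x + (y - x) * t%:C)); [exact: fh|exact: fM].
Qed.

Lemma cauchy_ball f z r M : 0 < r -> holoB f z (2 * r) ->
  (forall w, nm (w - z) < 2 * r -> nm (f w) <= M) ->
  forall w, nm (w - z) < r -> nm (der f w) <= 8 * M / r.
Proof.
move=> r0 fh fM w wr.
have sub x : nm (x - w) <= 2 * (r / 2) -> nm (x - z) < 2 * r.
  by move=> xw; apply: le_lt_trans (nm_tri w _ _) _; lra.
have fw : cdiff f w (der f w) by apply: fh; lra.
have -> : 8 * M / r = 4 * M / (r / 2) by field; rewrite gt_eqF.
apply: (cauchy_est _ fw); first by lra.
  by move=> x /sub xz; exists (der f x); exact: fh.
by move=> x /sub; exact: fM.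
Qed.

Lemma lip_ball f z r M (x y : R[i]) : 0 < r -> holoB f z (2 * r) ->
  (forall w, nm (w - z) < 2 * r -> nm (f w) <= M) ->
  nm (x - z) < r -> nm (y - z) < r -> nm (f y - f x) <= 8 * M / r * nm (y - x).
Proof.
move=> r0 fh fM; apply: mean_value_ball.
  by move=> w wr; apply: fh; lra.
exact: cauchy_ball.
Qed.

(** Cauchy's estimate for [f (w + (y - x)) - f w], which the Lipschitz bound makes of order
    [nm (y - x)]. No second derivative is needed. *)
Lemma der_lip f z r M (x y : R[i]) : 0 < r -> holoB f z (8 * r) ->
  (forall w, nm (w - z) < 8 * r -> nm (f w) <= M) ->
  nm (x - z) < r -> nm (y - z) < r ->
  nm (der f y - der f x) <= 16 * M / r ^+ 2 * nm (y - x).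
Proof.
move=> r0 fh fM xr yr.
have fx : cdiff f x (der f x) by apply: fh; lra.
have fy : cdiff f y (der f y) by apply: fh; lra.
have yx2 : nm (y - x) < 2 * r.
  by apply: le_lt_trans (nm_tri z _ _) _; rewrite [nm (z - x)]nm_distC; lra.
have sub1 w : nm (w - x) <= 2 * (r / 2) -> nm (w - z) < 4 * r.
  by move=> wx; apply: le_lt_trans (nm_tri x _ _) _; lra.
have sub2 w : nm (w - x) <= 2 * (r / 2) -> nm (w + (y - x) - z) < 4 * r.
  move=> wx; rewrite (_ : _ - z = (w - x) + (y - z)); last by ring.
  by apply: le_lt_trans (nmD _ _) _; lra.
have sh w d : cdiff f (w + (y - x)) d -> cdiff (fun w => f (w + (y - x))) w d.
  move=> h; have := cdiff_comp (cdiffD (cdiff_id w) (cdiff_cst (y - x) w)) h.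
  by rewrite addr0 mulr1.
have -> : 16 * M / r ^+ 2 * nm (y - x) = 4 * (8 * M / (4 * r) * nm (y - x)) / (r / 2).
  by field; rewrite gt_eqF.
apply: (@cauchy_est _ (fun w => f (w + (y - x)) - f w) x); first by lra.
- by apply: cdiffB => //; apply: sh; rewrite subrKC.
- move=> w wx; exists (der f (w + (y - x)) - der f w); apply: cdiffB.
    by apply: sh; apply: fh; have := sub2 w wx; lra.
  by apply: fh; have := sub1 w wx; lra.
- move=> w wx.
  have e8 : 2 * (4 * r) = 8 * r by ring.
  have -> : nm (y - x) = nm (w + (y - x) - w) by congr nm; ring.
  by apply: (@lip_ball f z (4 * r) M); rewrite ?e8 //; [lra|exact: sub1|exact: sub2].
Qed.

Lemma taylor2 f z r M (x y : R[i]) : 0 < r -> holoB f z (8 * r) ->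
  (forall w, nm (w - z) < 8 * r -> nm (f w) <= M) ->
  nm (x - z) < r -> nm (y - z) < r ->
  nm (f y - f x - der f x * (y - x)) <= 16 * M / r ^+ 2 * nm (y - x) ^+ 2.
Proof.
move=> r0 fh fM xr yr.
have M0 : 0 <= M by apply: le_trans (nm_ge0 (f z)) (fM _ _); rewrite subrr nm0; lra.
have K0 : 0 <= 16 * M / r ^+ 2 by apply: divr_ge0; [exact: mulr_ge0|rewrite exprn_ge0 // ltW].
have -> : f y - f x - der f x * (y - x) = (f y - der f x * y) - (f x - der f x * x).
  by ring.
rewrite expr2 mulrA; apply: (@mean_value (fun w => f w - der f x * w)) => t tP.
have wr := nm_segment xr yr tP; set w := x + _ in wr *.
exists (der f w - der f x).
  apply: cdiffB; first by apply: fh; lra.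
  by rewrite -[X in cdiff _ _ X]mulr1; apply: cdiffZ; exact: cdiff_id.
apply: le_trans (der_lip r0 fh fM xr wr) _; rewrite ler_wpM2l //.
have /andP[t0 t1] := tP.
have -> : w - x = (y - x) * t%:C by rewrite /w; ring.
by rewrite nmM nm_real ger0_norm // ler_piMr ?nm_ge0.
Qed.

End LocalTheory.

(** * Limits along filters and compactness in the plane *)

Section Limits.
Variable R : realType.
Implicit Types (x y z l : R[i]) (r e B : R).

Lemma nbhs_nmP (z : CC R) (V : set (CC R)) :
  nbhs z V <-> exists2 r : R, 0 < r & forall w, nm (w - z) < r -> V w.
Proof.
split=> [/(@nbhs_normP _ (CC R)) [e /= e0 eV]|[r r0 rV]].
  have eE : e = (Re e)%:C by rewrite RRe_real // gtr0_real.
  move: e0 eV; rewrite eE => e0 eV.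
  exists (Re e); first by rewrite -ltcR.
  by move=> w wz; apply: eV; rewrite /= normE ltcR nm_distC.
apply/(@nbhs_normP _ (CC R)); exists r%:C; first by rewrite /= ltcR.
by move=> w; rewrite /= normE ltcR nm_distC; exact: rV.
Qed.

Definition cvC (I : Type) (F : set_system I) (a : I -> R[i]) l :=
  forall e, 0 < e -> \forall i \near F, nm (a i - l) < e.

Section Filtered.
Variables (I : Type) (F : set_system I).
Context {FF : ProperFilter F}.
Implicit Types a b : I -> R[i].

Lemma cvC_le a l B : cvC F a l -> (\forall i \near F, nm (a i) <= B) -> nm l <= B.
Proof.
move=> al aB; apply/ler_addgt0Pl => e e0; near F => i.
have h1 : nm (a i - l) < e by near: i; exact: al.
have h2 : nm (a i) <= B by near: i.
by have := nm_lerB l (a i); rewrite nm_distC; lra.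
Unshelve. all: by end_near. Qed.

Lemma cvC_cst l : cvC F (fun _ => l) l.
Proof. by move=> e e0; near=> i; rewrite subrr nm0. Unshelve. all: by end_near. Qed.

Lemma cvCD a b l l' : cvC F a l -> cvC F b l' -> cvC F (fun i => a i + b i) (l + l').
Proof.
move=> al bl e e0; have e2 : 0 < e / 2 by lra.
near=> i; have h1 : nm (a i - l) < e / 2 by near: i; exact: al.
have h2 : nm (b i - l') < e / 2 by near: i; exact: bl.
rewrite (_ : _ - _ = (a i - l) + (b i - l')); last by ring.
by apply: le_lt_trans (nmD _ _) _; lra.
Unshelve. all: by end_near. Qed.

Lemma cvCZ a l x : cvC F a l -> cvC F (fun i => x * a i) (x * l).
Proof.
move=> al e e0; have x1 : 0 < nm x + 1 by rewrite ltr_wpDl ?nm_ge0.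
near=> i; have h1 : nm (a i - l) < e / (nm x + 1) by near: i; apply: al; rewrite divr_gt0.
rewrite -mulrBr nmM; move: h1; rewrite ltr_pdivlMr //.
by have := nm_ge0 (a i - l); nra.
Unshelve. all: by end_near. Qed.

Lemma cvCB a b l l' : cvC F a l -> cvC F b l' -> cvC F (fun i => a i - b i) (l - l').
Proof.
move=> al /(cvCZ (-1)); rewrite mulN1r => bl; have := cvCD al bl.
by congr cvC; apply/funext => i; rewrite mulN1r.
Qed.

Lemma cvC_uniq a l l' : cvC F a l -> cvC F a l' -> l = l'.
Proof.
move=> al al'; apply/eqP; rewrite -subr_eq0 -nm_eq0; apply/eqP/le_anti.
rewrite nm_ge0 andbT; apply: (cvC_le (cvCB al al')).
by near=> i; rewrite subrr nm0.
Unshelve. all: by end_near. Qed.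

Lemma cvC_eq a b l : (\forall i \near F, a i = b i) -> cvC F a l -> cvC F b l.
Proof.
move=> ab al e e0; near=> i; have <- : a i = b i by near: i.
by near: i; exact: al.
Unshelve. all: by end_near. Qed.

Lemma cvC_ReIm a (p q : R) : (Re \o a) @ F --> p -> (Im \o a) @ F --> q ->
  cvC F a (p%:C + 'i * q%:C).
Proof.
move=> /cvgrPdist_lt ap /cvgrPdist_lt aq e e0; have e2 : 0 < e / 2 by lra.
near=> i; apply: le_lt_trans (nm_le_ReIm _) _.
have h1 : `|p - Re (a i)| < e / 2 by near: i; exact: ap.
have h2 : `|q - Im (a i)| < e / 2 by near: i; exact: aq.
move: h1 h2; case: (a i) => u v /=; rewrite !(mul0r, mul1r, mulr0, subr0, addr0, add0r, sub0r, oppr0).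
by move=> h1 h2; rewrite [`|u - p|]distrC [`|v - q|]distrC; lra.
Unshelve. all: by end_near. Qed.

Lemma cauchy_cvC a : (forall e, 0 < e -> exists l0, \forall i \near F, nm (a i - l0) < e) ->
  exists l, cvC F a l.
Proof.
move=> H.
have /cvg_ex[p ap] : cvg ((Re \o a) @ F).
  apply: R_complete; apply: cauchy_exP => e e0.
  have [l0 l0P] := H e e0; exists (Re l0).
  apply: filterS l0P => i h; rewrite /ball /= distrC.
  apply: le_lt_trans h; apply: le_trans (Re_le_nm _).
  by case: (a i) l0 => [u v] [u' v'].
have /cvg_ex[q aq] : cvg ((Im \o a) @ F).
  apply: R_complete; apply: cauchy_exP => e e0.
  have [l0 l0P] := H e e0; exists (Im l0).
  apply: filterS l0P => i h; rewrite /ball /= distrC.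
  apply: le_lt_trans h; apply: le_trans (Im_le_nm _).
  by case: (a i) l0 => [u v] [u' v'].
by exists (p%:C + 'i * q%:C); exact: cvC_ReIm.
Qed.

End Filtered.

(** Replaces the extraction of convergent subsequences: real and imaginary parts stay in a compact
    interval, and a cluster point of an ultrafilter is a limit. *)
Lemma ultra_cvC (I : Type) (F : set_system I) (a : I -> R[i]) B : UltraFilter F ->
  (\forall i \near F, nm (a i) <= B) -> exists l, cvC F a l.
Proof.
move=> FU aB.
have seg (g : R[i] -> R) : (forall z, `|g z| <= nm z) -> exists p : R, (g \o a) @ F --> p.
  move=> gn; have PF : ProperFilter F by exact: ultra_proper.
  have [|p [_ ap]] := @segment_compact R (- B) B ((g \o a) @ F) _.
    by apply: filterS aB => i h; rewrite /= in_itv /= -ler_norml (le_trans (gn _)).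
  exists p => V pV; have [//|FV] := in_ultra_setVsetC ((g \o a) @^-1` V) FU.
  by have [y [/= nVy Vy]] := ap (~` V) V FV pV.
have [p ap] := seg _ (@Re_le_nm R).
have [q aq] := seg _ (@Im_le_nm R).
by exists (p%:C + 'i * q%:C); exact: cvC_ReIm.
Qed.

Lemma compactC (A : set (CC R)) B : (forall w, A w -> nm w <= B) ->
  (forall z, (forall r, 0 < r -> exists2 w, A w & nm (w - z) < r) -> A z) -> compact A.
Proof.
move=> AB Ac; rewrite compact_ultra => F FU FA.
have [|l Fl] := @ultra_cvC _ F id B FU; first by near=> w; apply: AB; near: w.
exists l; split.
  apply: Ac => r r0; have FP : ProperFilter F by exact: ultra_proper.
  near F => w; exists w; near: w; [exact: FA|exact: Fl].
move=> V /nbhs_nmP [r r0 rV]; near=> w; apply: rV; near: w; exact: Fl.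
Unshelve. all: by end_near. Qed.

Lemma compact_uniform (K : set (CC R)) (I : Type) (F : set_system I)
    (P : I -> R[i] -> Prop) : Filter F -> compact K ->
  (forall x, K x -> exists2 r, 0 < r & \forall i \near F, forall w, nm (w - x) < r -> P i w) ->
  \forall i \near F, forall w, K w -> P i w.
Proof.
move=> FF /compact_near_coveringP cK H; apply: cK => x Kx.
have [r r0 rP] := H x Kx.
exists ([set w | nm (w - x) < r], [set i | forall w, nm (w - x) < r -> P i w]).
  by split=> //=; apply/nbhs_nmP; exists r.
by move=> [w i] /= [wr]; apply.
Qed.

Lemma closed_ball_compact z r : compact [set w : CC R | nm (w - z) <= r].
Proof.
apply: (@compactC _ (r + nm z)) => [w /= wr|x H /=].
  by have := nm_lerB w z; lra.
apply/ler_addgt0Pl => e /H [w /= wr we].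
by apply: le_trans (nm_tri w _ _) _; rewrite nm_distC; lra.
Qed.

End Limits.

(** * Second derivatives and pointwise limits of holomorphic functions *)

Section Analyticity.
Variable R : realType.
Implicit Types (f g F G : R[i] -> R[i]) (a v w z d u : R[i]) (r e M t s K : R).

Lemma inv_succ_cvg K e : 0 < e -> \forall n \near \oo, K / n.+1%:R < e.
Proof.
move=> e0; near=> n.
rewrite ltr_pdivrMr // mulrC -ltr_pdivrMr //.
apply: le_lt_trans (ler_norm _) _.
have : (Num.bound `|K / e| <= n)%N by near: n; exists (Num.bound `|K / e|).
rewrite -(ler_nat R) => h; have h2 := archi_boundP (normr_ge0 (K / e)).
have h3 : n%:R < n.+1%:R :> R by rewrite ltr_nat.
by lra.
Unshelve. all: by end_near. Qed.

Lemma cdiff_bounded f z d : cdiff f z d ->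
  exists r M, [/\ 0 < r, 0 <= M & forall w, nm (w - z) < r -> nm (f w) <= M].
Proof.
move=> /cdiff_cont /(_ _ ltr01) [r r0 rP]; exists r, (nm (f z) + 1); split=> //.
  by rewrite addr_ge0 ?nm_ge0.
by move=> w /rP; have := nm_lerB (f w) (f z); lra.
Qed.

Lemma holoB_bounded f z r : 0 < r -> holoB f z r ->
  exists s M, [/\ 0 < s, 0 <= M, 8 * s <= r, holoB f z (8 * s) &
    forall w, nm (w - z) < 8 * s -> nm (f w) <= M].
Proof.
move=> r0 fh; have [|s [M [s0 M0 sM]]] := @cdiff_bounded f z (der f z).
  by apply: fh; rewrite subrr nm0.
exists (Num.min r s / 8), M; have m0 : 0 < Num.min r s by rewrite lt_min r0 s0.
have e8 : 8 * (Num.min r s / 8) = Num.min r s by field.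
split=> //; rewrite ?e8 ?divr_gt0 ?ge_min ?lexx //.
- by move=> w; rewrite lt_min => /andP[/fh].
- by move=> w; rewrite lt_min => /andP[_ /sM].
Qed.

Lemma nm_scaled x (r : R) : nm (x * r%:C) = nm x * `|r| :> R.
Proof. by rewrite nmM nm_real. Qed.

(** By [taylor2] the difference quotients [g k] and [g l] of [f] differ by O([nm k + nm l]) on a
    disc. Cauchy's estimate transfers this to their derivatives at [z], which are the difference
    quotients of [der f]; these therefore satisfy Cauchy's criterion. *)
Lemma der_diff f z r : 0 < r -> holoB f z r -> exists d, cdiff (der f) z d.
Proof.
move=> r0 /(holoB_bounded r0) [s [M [s0 M0 _ fh fM]]].
pose C := 16 * M / s ^+ 2.
have C0 : 0 <= C by apply: divr_ge0; [exact: mulr_ge0|rewrite exprn_ge0 // ltW].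
pose g (k : R[i]) w := (f (w + k) - f w) / k.
have zs : nm (z - z) < s by rewrite subrr nm0.
have gz k : k != 0 -> nm k < s / 2 -> forall w, nm (w - z) <= 2 * (s / 4) ->
    nm (g k w - der f w) <= C * nm k /\ cdiff (g k) w ((der f (w + k) - der f w) / k).
  move=> k0 ks w ws; have kp : 0 < nm k by rewrite nm_gt0.
  have ws1 : nm (w - z) < s by lra.
  have ws2 : nm (w + k - z) < s.
    by rewrite addrAC; apply: le_lt_trans (nmD _ _) _; lra.
  split.
    have := taylor2 s0 fh fM ws1 ws2; rewrite (_ : w + k - w = k); last by ring.
    move=> h.
    rewrite (_ : g k w - der f w = (f (w + k) - f w - der f w * k) / k).
      by rewrite nmM nmV ler_pdivrMr //; apply: le_trans h _; rewrite -/C expr2 mulrA.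
    by rewrite /g; field.
  have h1 : cdiff f (w + k) (der f (w + k)) by apply: fh; lra.
  have h2 : cdiff f w (der f w) by apply: fh; lra.
  have h3 : cdiff (fun w => f (w + k)) w (der f (w + k)).
    have := cdiff_comp (cdiffD (cdiff_id w) (cdiff_cst k w)) h1.
    by rewrite addr0 mulr1.
  have := cdiffZ k^-1 (cdiffB h3 h2); rewrite mulrC; apply: cdiff_ext => x.
  by rewrite mulrC.
pose q k := (der f (z + k) - der f z) / k.
have qq k l : k != 0 -> l != 0 -> nm k < s / 2 -> nm l < s / 2 ->
    nm (q k - q l) <= 16 * C / s * (nm k + nm l).
  move=> k0 l0 ks ls; have s4 : 0 < s / 4 by lra.
  have -> : 16 * C / s * (nm k + nm l) = 4 * (C * (nm k + nm l)) / (s / 4).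
    by field; rewrite gt_eqF.
  have zz : nm (z - z) <= 2 * (s / 4) by rewrite subrr nm0; lra.
  have [_ hk] := gz k k0 ks z zz; have [_ hl] := gz l l0 ls z zz.
  apply: (cauchy_est s4 (cdiffB hk hl)) => w ws.
    have [_ hk'] := gz k k0 ks w ws; have [_ hl'] := gz l l0 ls w ws.
    by eexists; exact: cdiffB hk' hl'.
  have [hk' _] := gz k k0 ks w ws; have [hl' _] := gz l l0 ls w ws.
  rewrite (_ : _ - _ = (g k w - der f w) - (g l w - der f w)); last by ring.
  by apply: le_trans (nmB _ _) _; lra.
pose k (n : nat) : R[i] := (s / 4 / n.+1%:R)%:C.
have nk n : nm (k n) = s / 4 / n.+1%:R by rewrite nm_real ger0_norm // !divr_ge0 // ltW.
have k0 n : k n != 0 by rewrite -nm_gt0 nk !divr_gt0.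
have ks n : nm (k n) < s / 2.
  rewrite nk ltr_pdivrMr //; have : 1 <= n.+1%:R :> R by rewrite ler1n.
  by nra.
have D0 : 0 <= 16 * C / s by apply: divr_ge0; [exact: mulr_ge0|exact: ltW].
have [d qd] : exists d, cvC \oo (fun n => q (k n)) d.
  apply: cauchy_cvC => e e0.
  have e2 : 0 < e / (16 * C / s + 1) / 2 by rewrite !divr_gt0 // ltr_wpDl.
  have [N _ NP] := @inv_succ_cvg (s / 4) _ e2.
  exists (q (k N)); exists N => // n /= Nn.
  apply: le_lt_trans (qq _ _ (k0 _) (k0 _) (ks _) (ks _)) _.
  have h1 := NP N (leqnn N); have h2 := NP n Nn; rewrite /= -!nk in h1 h2.
  have : nm (k n) + nm (k N) < e / (16 * C / s + 1) by lra.
  rewrite ltr_pdivlMr ?ltr_wpDl //.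
  by have := nm_ge0 (k n); have := nm_ge0 (k N); nra.
exists d; apply/cdiffP => e e0.
pose D := 16 * C / s + 1; have D1 : 0 < D by rewrite ltr_wpDl.
exists (Num.min (s / 2) (e / D)) => [|w]; first by rewrite lt_min !divr_gt0.
rewrite lt_min => /andP[w1 w2].
have [->|wz] := eqVneq w z; first by rewrite !subrr mulr0 subrr nm0 mulr0.
have l0 : w - z != 0 by rewrite subr_eq0.
have -> : der f w - der f z - d * (w - z) = (q (w - z) - d) * (w - z).
  by rewrite /q subrKC; field.
rewrite nmM ler_wpM2r ?nm_ge0 //.
apply: (@le_trans _ _ (16 * C / s * nm (w - z))); last first.
  by move: w2; rewrite ltr_pdivlMr // /D; have := nm_ge0 (w - z); nra.
apply/ler_addgt0Pl => e' e'0.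
have D' : 0 < e' / D by rewrite divr_gt0.
apply: (@cvC_le _ _ \oo _ (fun n => q (w - z) - q (k n))).
  by apply: cvCB => //; exact: cvC_cst.
have [N _ NP] := @inv_succ_cvg (s / 4) _ D'.
exists N => // n /= Nn; apply: le_trans (qq _ _ l0 (k0 _) w1 (ks _)) _.
have := NP n Nn; rewrite /= -nk ltr_pdivlMr // /D.
by have := nm_ge0 (k n); nra.
Qed.

(** Only the point [z] is at issue. The derivative of the slope there is half the second derivative
    [e2] of [f], by the mean value inequality for [f] minus its Taylor polynomial of degree 2. *)
Lemma slope_holo f z r : 0 < r -> holoB f z r -> holoB (slope f z (der f z)) z r.
Proof.
move=> r0 fh w wr; have [->|wz] := eqVneq w z.
  have [e2 /cdiffP H] := der_diff r0 fh.
  apply: (@cdiff_der _ _ _ (e2 / 2)); apply/cdiffP => e e0.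
  have [s s0 sP] := H e e0.
  exists (Num.min r s) => [|x]; first by rewrite lt_min r0 s0.
  rewrite lt_min => /andP[xr xs].
  have [->|xz] := eqVneq x z; first by rewrite !subrr mulr0 subrr nm0 mulr0.
  have x0 : x - z != 0 by rewrite subr_eq0.
  have xp : 0 < nm (x - z) by rewrite nm_gt0.
  rewrite /slope eqxx (negbTE xz).
  pose h u := f u - der f z * u - e2 / 2 * (u - z) ^+ 2.
  have -> : (f x - f z) / (x - z) - der f z - e2 / 2 * (x - z) = (h x - h z) / (x - z).
    by rewrite /h subrr expr0n /=; field.
  rewrite nmM nmV ler_pdivrMr //; apply: mean_value => t /andP[t0 t1].
  set u := z + (x - z) * t%:C.
  have uz : u - z = (x - z) * t%:C by rewrite /u; ring.
  have nu : nm (u - z) <= nm (x - z) by rewrite uz nm_scaled ger0_norm // ler_piMr ?nm_ge0.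
  exists (der f u - der f z - e2 * (u - z)).
    apply: cdiffB; first apply: cdiffB.
    - by apply: fh; apply: le_lt_trans xr.
    - by rewrite -[X in cdiff _ _ X]mulr1; apply: cdiffZ; exact: cdiff_id.
    have <- : e2 / 2 * ((1 - 0) * (u - z) ^+ 2.-1 *+ 2) = e2 * (u - z).
      by rewrite subr0 mul1r expr1 mulr2n; field.
    apply: (cdiffZ _ (cdiffX 2 _)).
    by apply: cdiffB; [exact: cdiff_id|exact: cdiff_cst].
  apply: le_trans (sP _ _) _; first exact: le_lt_trans xs.
  by rewrite ler_pM2l.
have wz0 : w - z != 0 by rewrite subr_eq0.
have h : cdiff (fun w => (f w - f z) / (w - z)) w
    ((der f w - 0) / (w - z) + (f w - f z) * (- (1 - 0) / (w - z) ^+ 2)).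
  apply: cdiffM; first by apply: cdiffB; [exact: fh|exact: cdiff_cst].
  by apply: cdiffV => //; apply: cdiffB; [exact: cdiff_id|exact: cdiff_cst].
apply: (cdiff_der (d := _)).
apply: (@cdiff_near _ _ _ _ _ (nm (w - z)) _ _ h); first by rewrite nm_gt0.
move=> x xw; rewrite /slope; case: eqP => // xz.
by move: xw; rewrite xz nm_distC ltxx.
Qed.

Section PointwiseLimit.
Variables (I : Type) (F : set_system I).
Context {FF : ProperFilter F}.

(** The common bound [M] gives a quadratic Taylor remainder uniform in [i]. It makes the derivatives
    at [z] a Cauchy family and survives the pointwise limit. *)
Lemma limit_cdiff (f : I -> R[i] -> R[i]) g z r M : 0 < r ->
  (\forall i \near F, holoB (f i) z r /\ forall w, nm (w - z) < r -> nm (f i w) <= M) ->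
  (forall w, nm (w - z) < r -> cvC F (f ^~ w) (g w)) ->
  exists2 d, cdiff g z d & cvC F (fun i => der (f i) z) d.
Proof.
move=> r0 fH fg; pose s := r / 8; have s0 : 0 < s by rewrite divr_gt0.
have rs : r = 8 * s by rewrite /s; field.
have M0 : 0 <= M.
  near F => i; have [_ h] : holoB (f i) z r /\ forall w, nm (w - z) < r -> nm (f i w) <= M.
    by near: i.
  by apply: le_trans (nm_ge0 (f i z)) (h z _); rewrite subrr nm0.
pose C := 16 * M / s ^+ 2.
have C0 : 0 <= C by apply: divr_ge0; [exact: mulr_ge0|by apply: exprn_ge0; exact: ltW].
have zs : nm (z - z) < s by rewrite subrr nm0.
have T w : nm (w - z) < s -> \forall i \near F,
    nm (f i w - f i z - der (f i) z * (w - z)) <= C * nm (w - z) ^+ 2.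
  by move=> ws; apply: filterS fH => i; rewrite rs => -[h1 h2]; exact: (taylor2 s0 h1 h2 zs ws).
have zr : nm (z - z) < r by rewrite subrr nm0.
have [d hd] : exists d, cvC F (fun i => der (f i) z) d.
  apply: cauchy_cvC => e e0.
  pose t := Num.min (s / 2) (e / 2 / (C + 1)).
  have C1 : 0 < C + 1 by rewrite ltr_wpDl.
  have t0 : 0 < t by rewrite lt_min !divr_gt0.
  pose w := z + t%:C; have wz : w - z = t%:C by rewrite /w; ring.
  have nw : nm (w - z) = t by rewrite wz nm_real gtr0_norm.
  have ws : nm (w - z) < s by rewrite nw; have := ge_min (s / 2) (s / 2) (e / 2 / (C + 1)); rewrite lexx -/t; lra.
  have te : t * (C + 1) <= e / 2.
    by rewrite -ler_pdivlMr // /t ge_min lexx orbT.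
  have q : cvC F (fun i => (w - z)^-1 * (f i w - f i z)) ((w - z)^-1 * (g w - g z)).
    by apply: cvCZ; apply: cvCB; apply: fg => //; lra.
  have e2 : 0 < e / 2 by lra.
  exists ((w - z)^-1 * (g w - g z)).
  apply: filterS2 (q _ e2) (T w ws) => i h1 h2.
  apply: le_lt_trans (nm_tri ((w - z)^-1 * (f i w - f i z)) _ _) _.
  have wz0 : w - z != 0 by rewrite -nm_gt0 nw.
  have : nm (der (f i) z - (w - z)^-1 * (f i w - f i z)) <= C * t.
    rewrite (_ : _ - _ = - (w - z)^-1 * (f i w - f i z - der (f i) z * (w - z))); last by field.
    by rewrite nmM nmN nmV nw mulrC ler_pdivrMr // -[leRHS]mulrA -expr2 -nw.
  by nra.
exists d => //; apply/cdiffP => e e0.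
have C1 : 0 < C + 1 by rewrite ltr_wpDl.
exists (Num.min s (e / (C + 1))) => [|w]; first by rewrite lt_min s0 divr_gt0.
rewrite lt_min => /andP[ws we].
have wr : nm (w - z) < r by rewrite rs; lra.
have h : cvC F (fun i => f i w - f i z - der (f i) z * (w - z)) (g w - g z - d * (w - z)).
  apply: cvCB; first by apply: cvCB; exact: fg.
  rewrite mulrC; apply: cvC_eq (cvCZ (w - z) hd); apply: nearW => i; exact: mulrC.
apply: le_trans (cvC_le h (T w ws)) _; rewrite expr2 mulrA ler_wpM2r ?nm_ge0 //.
by move: we; rewrite ltr_pdivlMr //; have := nm_ge0 (w - z); nra.
Unshelve. all: by end_near. Qed.

End PointwiseLimit.

End Analyticity.

(** * Maximum principle and identity theorem *)

Section MaximumPrinciple.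
Variable R : realType.
Implicit Types (f g F G : R[i] -> R[i]) (a v w z d u x : R[i]) (r e M t s : R).

Lemma holoB_sub f z r w s : nm (w - z) + s <= r -> holoB f z r -> holoB f w s.
Proof. by move=> h fh x xw; apply: fh; apply: le_lt_trans (nm_tri w _ _) _; lra. Qed.

Lemma holoB_cdiff f z r : (forall w, nm (w - z) < r -> exists d, cdiff f w d) ->
  holoB f z r.
Proof. by move=> fh w /fh[d /cdiff_der]. Qed.

(** Squaring [y = x ^+ (2 ^ k)] multiplies its distance to 1 by [nm (y + 1)], which is at least 3/2;
    a nonzero distance would outgrow 1/2. *)
Lemma powers_near_1 x : (forall n, nm (x ^+ n - 1) <= 2^-1) -> x = 1.
Proof.
move=> H; apply/eqP; rewrite -subr_eq0 -nm_eq0; apply/negPn/negP => a0.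
have {}a0 : 0 < nm (x - 1) by rewrite lt_neqAle eq_sym a0 nm_ge0.
have grow k : (1 + k%:R / 2) * nm (x - 1) <= nm (x ^+ (2 ^ k) - 1).
  elim: k => [|k IH]; first by rewrite mul0r addr0 mul1r expr1.
  rewrite expnSr exprM.
  have -> : (x ^+ (2 ^ k)) ^+ 2 - 1 = (x ^+ (2 ^ k) - 1) * (x ^+ (2 ^ k) + 1) by ring.
  rewrite nmM; have h1 := H (2 ^ k)%N.
  have h2 : 3 / 2 <= nm (x ^+ (2 ^ k) + 1).
    have := nm_lerB (2 : R[i]) (1 - x ^+ (2 ^ k)); rewrite nm_nat.
    rewrite (_ : 2 - (1 - _) = x ^+ (2 ^ k) + 1); last by ring.
    by rewrite [nm (1 - _)]nm_distC; lra.
  have k0 := ler0n R k; rewrite -natr1.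
  apply: (@le_trans _ _ ((1 + k%:R / 2) * nm (x - 1) * (3 / 2))); first by nra.
  by apply: ler_pM => //; nra.
pose k := Num.bound (nm (x - 1))^-1.
have := archi_boundP (_ : 0 <= (nm (x - 1))^-1); rewrite invr_ge0 nm_ge0 => /(_ isT).
rewrite -/k -(ltr_pM2r a0) mulVf ?gt_eqF // => h.
by have := grow k; have := H (2 ^ k)%N; nra.
Qed.

(* If [G z = 1], Cauchy's estimate is uniform in [n] for the functions [G ^+ n], so all
   powers of [G w] stay close to 1. *)
Lemma strong_max G z r : 0 < r -> holoB G z r ->
  (forall w, nm (w - z) < r -> nm (G w) <= nm (G z)) ->
  forall w, nm (w - z) <= r / 64 -> nm (G w) = nm (G z).
Proof.
move=> r0 Gh GM w ws; have [Gz|Gz] := eqVneq (G z) 0.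
  apply: le_anti; rewrite GM ?Gz ?nm0 ?nm_ge0 //; lra.
have Gp : 0 < nm (G z) by rewrite nm_gt0.
pose H u := (G z)^-1 * G u.
suff : H w = 1 by move=> /(congr1 (fun v => nm (G z * v))); rewrite /H mulVKf // mulr1.
have HM u : nm (u - z) < r -> nm (H u) <= 1.
  by move=> /GM; rewrite nmM nmV mulrC ler_pdivrMr // mul1r.
have Hz : H z = 1 by rewrite /H mulVf.
apply: powers_near_1 => n; have [->|wz] := eqVneq w z.
  by rewrite Hz expr1n subrr nm0 invr_ge0.
have Hh : holoB (fun u => H u ^+ n) z r.
  by apply: holoB_cdiff => u /Gh h; eexists; apply: cdiffX; apply: cdiffZ; exact: h.
have qh := slope_holo r0 Hh; set q := slope _ _ _ in qh.
have qE u : H u ^+ n - 1 = q u * (u - z) by rewrite -slopeE Hz expr1n.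
have r4 : 0 < r / 4 by lra.
(* On the contour about [w] the numerator is at most 2 and the distance to [z] at least [r / 8]. The
   radius [r / 64] in the statement then brings [q w * (w - z)] down to the 1/2 required by
   [powers_near_1]. *)
have : nm (q w) <= 2 * (16 / r).
  apply: (center_est r4).
  - by apply: cdiff_cont (qh w _); lra.
  - move=> u uw us; exists (der q u); apply: qh.
    by apply: le_lt_trans (nm_tri w _ _) _; lra.
  - move=> u /andP[u1 u2].
    have uz : r / 8 <= nm (u - z).
      have := nm_tri z u w; rewrite [nm (z - w)]nm_distC [nm (u - w)]nm_distC in u1 *.
      by have := nm_tri z w u; rewrite [nm (z - u)]nm_distC; lra.
    have ur : nm (u - z) < r by apply: le_lt_trans (nm_tri w _ _) _; lra.
    have up : 0 < nm (u - z) by lra.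
    rewrite -(ler_pM2r up) -nmM -qE; apply: (@le_trans _ _ 2).
      apply: le_trans (nmB _ _) _; rewrite nm1 nmX.
      by have := exprn_ile1 n (nm_ge0 (H u)) (HM u ur); lra.
    by rewrite mulrAC ler_pdivlMr //; lra.
rewrite qE nmM => qw.
have : 2 * (16 / r) * (r / 64) = 2^-1 by field; rewrite gt_eqF.
have : 0 <= 2 * (16 / r) by rewrite mulr_ge0 // divr_ge0 // ltW.
have := nm_ge0 (w - z); have := nm_ge0 (q w); nra.
Qed.

(** As [F] vanishes near [y], the quotient by [(u - y) ^+ n] is holomorphic for every [n]. A contour
    at distance at least [2 r] from [y] then bounds [F w] by [2 M] times the [n]-th power of 1/2. *)
Lemma identity_local F y r M : 0 < r -> holoB F y (8 * r) ->
  (forall w, nm (w - y) < 8 * r -> nm (F w) <= M) ->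
  (exists2 s, 0 < s & forall w, nm (w - y) < s -> F w = 0) ->
  forall w, nm (w - y) < r -> F w = 0.
Proof.
move=> r0 Fh FM [s s0 Fs] w wr.
have [->|wy] := eqVneq w y; first by apply: Fs; rewrite subrr nm0.
have M0 : 0 <= M by apply: le_trans (nm_ge0 (F y)) (FM _ _); rewrite subrr nm0; lra.
have wp : 0 < nm (w - y) by rewrite nm_gt0 subr_eq0.
have key n : nm (F w) <= 2 * M * 2^-1 ^+ n.
  pose q u := F u / (u - y) ^+ n.
  have qh : holoB q y (8 * r).
    apply: holoB_cdiff => u ur; have [uy|uy] := eqVneq u y.
      exists 0; apply: (@cdiff_near _ (fun=> 0) _ _ _ s) => //; last exact: cdiff_cst.
      by move=> x; rewrite uy /q => /Fs->; rewrite mul0r.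
    eexists; apply: cdiffM; first exact: Fh.
    apply: cdiffV; first by rewrite expf_neq0 // subr_eq0.
    by apply: cdiffX; apply: cdiffB; [exact: cdiff_id|exact: cdiff_cst].
  have r3 : 0 < 3 * r by lra.
  have : nm (q w) <= 2 * (M / (2 * r) ^+ n).
    apply: (center_est r3).
    - by apply: cdiff_cont (qh w _); lra.
    - move=> u uw us; exists (der q u); apply: qh.
      by apply: le_lt_trans (nm_tri w _ _) _; lra.
    - move=> u /andP[u1 u2].
      have uz : 2 * r <= nm (u - y).
        by have := nm_tri y w u; rewrite [nm (w - u)]nm_distC in u1 *;
          have := nm_tri y u w; rewrite [nm (y - w)]nm_distC; lra.
      have ur : nm (u - y) < 8 * r by apply: le_lt_trans (nm_tri w _ _) _; lra.
      have up : 0 < nm (u - y) by lra.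
      have r2 : 0 < 2 * r by lra.
      rewrite /q nmM nmV nmX ler_pM ?nm_ge0 ?invr_ge0 ?exprn_ge0 ?nm_ge0 ?FM //.
      rewrite lef_pV2 ?posrE ?exprn_gt0 //.
      by apply: lerXn2r; rewrite ?nnegrE ?nm_ge0 // ltW.
  rewrite /q nmM nmV nmX ler_pdivrMr ?exprn_gt0 // => h; apply: le_trans h _.
  have -> : 2 * (M / (2 * r) ^+ n) * nm (w - y) ^+ n =
      2 * M * (nm (w - y) / (2 * r)) ^+ n by rewrite expr_div_n; ring.
  apply: ler_wpM2l; first by rewrite mulr_ge0.
  have w2 : nm (w - y) / (2 * r) <= 2^-1 by rewrite ler_pdivrMr; lra.
  apply: lerXn2r => //; rewrite nnegrE ?invr_ge0 // divr_ge0 ?nm_ge0 //; lra.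
apply/eqP; rewrite -nm_eq0; apply/eqP/le_anti; rewrite nm_ge0 andbT.
apply/ler_addgt0Pl => e e0; rewrite addr0.
have M1 : 0 < 2 * M + 1 by lra.
have [k kP] := half_pow_lt (divr_gt0 e0 M1).
move: kP; rewrite ltr_pdivlMr // => kP; apply: le_trans (key k) _.
have : 0 < 2^-1 ^+ k :> R by rewrite exprn_gt0 ?invr_gt0.
by nra.
Qed.

Lemma compact_sub (K Z : set (CC R)) : compact K -> Z `<=` K ->
  (forall x, K x -> ~ Z x -> exists2 r, 0 < r & forall w, nm (w - x) < r -> ~ Z w) ->
  compact Z.
Proof.
move=> cK ZK Zc; apply/compact_near_coveringP => I F P FF cov.
have : \forall i \near F, forall w, K w -> Z w -> P i w.
  apply: (@compact_uniform _ K I F (fun i w => Z w -> P i w) FF cK) => x Kx.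
  have [Zx|nZx] := pselect (Z x); last first.
    by have [r r0 rP] := Zc x Kx nZx; exists r => //; near=> i => w /rP.
  have [[V A] [/= /nbhs_nmP[r r0 rV] FA] VA] := cov x Zx.
  exists r => //; apply: filterS FA => i Ai w wr _.
  by apply: (VA (w, i)); split => //=; exact: rV.
by apply: filterS => i H w Zw; exact: H (ZK _ Zw) Zw.
Unshelve. all: by end_near. Qed.

Lemma compact_max (K : set (CC R)) (h : R[i] -> R) : compact K -> K !=set0 ->
  (forall x, K x -> forall e, 0 < e ->
     exists2 r, 0 < r & forall w, nm (w - x) < r -> `|h w - h x| < e) ->
  exists2 c, K c & forall w, K w -> h w <= h c.
Proof.
move=> cK K0 hc.
have [|c] := @compact_EVT_max (CC R) R h K K0 cK.
  apply: continuous_in_subspaceT => x; rewrite inE => Kx.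
  move=> V /nbhs_ballP [e /= e0 eV]; have [r r0 rP] := hc x Kx e e0.
  apply: (iffRL (@nbhs_nmP R x (h @^-1` V))).
  by exists r => // w /rP wr; apply: eV; rewrite /ball /= distrC.
by rewrite inE => Kc cP; exists c => // w Kw; apply: cP; rewrite inE.
Qed.

Lemma nm_ccont g x : ccont g x -> forall e, 0 < e ->
  exists2 r, 0 < r & forall w, nm (w - x) < r -> `|nm (g w) - nm (g x)| < e.
Proof.
move=> gx e /gx [r r0 rP]; exists r => // w /rP h.
rewrite ltr_norml; apply/andP; split.
  by have := nm_lerB (g x) (g w); rewrite nm_distC; lra.
by have := nm_lerB (g w) (g x); lra.
Qed.

(** [L] acts as the boundary of [K]. If the maximum of [nm g] exceeded [M], the compact set [Z]
    where it is attained would avoid [L], and at the point of [Z] with greatest real part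
    [strong_max] would provide a point of [Z] further to the right. *)
Lemma max_principle (K L : set (CC R)) g M : compact K ->
  (forall z, K z -> exists2 r, 0 < r & holoB g z r) ->
  (forall z, K z -> ~ L z -> exists2 r, 0 < r & forall w, nm (w - z) < r -> K w) ->
  (forall z, K z -> L z -> nm (g z) <= M) -> forall z, K z -> nm (g z) <= M.
Proof.
move=> cK gh Kint gL z0 Kz0.
have gc x : K x -> ccont g x.
  by move=> /gh [r r0 gr]; apply: cdiff_cont (gr x _); rewrite subrr nm0.
have [|c Kc cP] := @compact_max K (fun w => nm (g w)) cK (ex_intro _ z0 Kz0).
  by move=> x /gc /nm_ccont.
apply: le_trans (cP _ Kz0) _ => /=; rewrite leNgt; apply/negP => Mc.
pose Z : set (CC R) := [set w | K w /\ nm (g w) = nm (g c)].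
have cZ : compact Z.
  apply: (compact_sub cK) => [w []//|x Kx nZx].
  have gx : nm (g x) < nm (g c).
    by rewrite lt_neqAle cP // andbT; apply/eqP => E; exact: nZx.
  have gp : 0 < nm (g c) - nm (g x) by lra.
  have [r r0 rP] := nm_ccont (gc x Kx) gp.
  by exists r => // w /rP; rewrite ltr_norml => /andP[_ h] [_ E]; lra.
have [|d [Kd gd] dP] := @compact_max Z (fun w => Re w) cZ (ex_intro _ c (conj Kc erefl)).
  move=> x _ e e0; exists e => // w; apply: le_lt_trans; apply: le_trans (Re_le_nm _).
  by case: w x => [? ?] [? ?].
have [|r r0 rP] := Kint d Kd.
  by move=> Ld; have := gL d Kd Ld; rewrite gd; lra.
have [s s0 gs] := gh d Kd.
pose t := Num.min r s; have t0 : 0 < t by rewrite lt_min r0 s0.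
have tr : t <= r by rewrite ge_min lexx.
have ts : t <= s by rewrite ge_min lexx orbT.
pose w := d + (t / 64)%:C.
have wd : nm (w - d) = t / 64.
  by rewrite /w addrC addKr nm_real ger0_norm // divr_ge0 // ltW.
have gw : nm (g w) = nm (g d).
  apply: (@strong_max g d t) => //; last by rewrite wd.
    by apply: holoB_sub gs; rewrite subrr nm0 add0r.
  by move=> x xt; rewrite gd; apply: cP; apply: rP; lra.
have Zw : Z w by split; [apply: rP; rewrite wd; lra|rewrite gw].
by have := dP w Zw; rewrite /w; case: (d) => p q /=; lra.
Qed.

End MaximumPrinciple.

(** * Polynomial approximation and fixed points in hulls *)

Section Approximation.
Variable R : realType.
Implicit Types (f g F u v : R[i] -> R[i]) (a b w z x : R[i]) (r e M t s : R).
Implicit Types (p : {poly R[i]}) (K L : set (CC R)).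

Lemma slope_entire F : (forall z, cdiff F z (der F z)) ->
  forall z, cdiff (slope F 0 (der F 0)) z (der (slope F 0 (der F 0)) z).
Proof.
move=> Fh z; have z1 : 0 < nm z + 1 by rewrite ltr_wpDl ?nm_ge0.
by apply: (slope_holo z1) => [w _//|]; rewrite subr0; lra.
Qed.

(** The bound is clear on the circle; the maximum principle carries it inside, where dividing by [z]
    would spoil it. *)
Lemma slope_bound F r M : 0 < r -> (forall z, cdiff F z (der F z)) ->
  (forall z, nm z <= r -> nm (F z) <= M) ->
  forall z, nm z <= r -> nm (slope F 0 (der F 0) z) <= 2 * M / r.
Proof.
move=> r0 Fh FM z zr.
apply: (@max_principle _ [set w | nm (w - 0) <= r] [set w | nm w = r]).
- exact: closed_ball_compact.
- by move=> w _; exists 1 => // x _; exact: slope_entire.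
- move=> w /=; rewrite subr0 => wr /eqP wn.
  exists (r - nm w); first by rewrite subr_gt0 lt_neqAle wn.
  by move=> x xw; rewrite subr0; have := nm_lerB x w; lra.
- move=> w _ /= wr; have wp : 0 < nm w by rewrite wr.
  rewrite ler_pdivlMr // -wr -nmM -{2}(subr0 w) -slopeE.
  apply: le_trans (nmB _ _) _.
  have h1 := FM w; have h2 := FM 0; rewrite nm0 wr lexx (ltW r0) in h1 h2.
  by have := h1 isT; have := h2 isT; lra.
- by rewrite /= subr0.
Qed.

(** Iterated slopes at 0 give the Taylor polynomials with remainder [z ^+ n * fn n z]. On the disc
    of radius [4 r] each slope divides the bound by [2 r], so on the disc of radius [r] the
    remainder is at most [M / 2 ^+ n]. *)
Lemma taylor_approx F r e : 0 < r -> 0 < e -> (forall z, cdiff F z (der F z)) ->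
  exists p, forall z, nm z <= r -> nm (F z - p.[z]) <= e.
Proof.
move=> r0 e0 Fh.
pose T f := slope f 0 (der f 0); pose fn n := iter n T F.
have fnh n : forall z, cdiff (fn n) z (der (fn n) z).
  by elim: n => [//|n IH]; exact: slope_entire.
pose P n : {poly R[i]} := \sum_(k < n) (fn k 0) *: 'X^k.
have FE n z : F z = (P n).[z] + z ^+ n * fn n z.
  elim: n => [|n ->]; first by rewrite /P big_ord0 horner0 add0r mul1r.
  rewrite /P big_ord_recr /= hornerD hornerZ hornerXn -addrA; congr (_ + _).
  have -> : fn n z = fn n 0 + fn n.+1 z * z.
    by have := slopeE (fn n) 0 (der (fn n) 0) z; rewrite subr0 -/(T _) => <-; ring.
  by rewrite exprS -[T (fn n)]/(fn n.+1); ring.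
have r4 : 0 < 4 * r by lra.
have [M M0 FM] : exists2 M, 0 < M & forall z, nm z <= 4 * r -> nm (F z) <= M.
  have K0 : [set w : CC R | nm (w - 0) <= 4 * r] !=set0.
    by exists 0 => /=; rewrite subrr nm0 ltW.
  have [|c _ cP] := @compact_max _ _ (fun w => nm (F w)) (@closed_ball_compact R 0 (4 * r)) K0.
    by move=> x _; apply: nm_ccont; exact: cdiff_cont (Fh x).
  exists (nm (F c) + 1); first by rewrite ltr_wpDl ?nm_ge0.
  by move=> z zr; have := cP z; rewrite /= subr0 => /(_ zr); lra.
have fnM n z : nm z <= 4 * r -> nm (fn n z) <= M / (2 * r) ^+ n.
  elim: n z => [|n IH] z zr; first by rewrite expr0 divr1 FM.
  have := slope_bound r4 (fnh n) IH zr.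
  rewrite (_ : 2 * _ / (4 * r) = M / (2 * r) ^+ n.+1) // exprS.
  by field; rewrite expf_neq0 ?gt_eqF // mulr_gt0.
have [n nP] := half_pow_lt (divr_gt0 e0 M0).
exists (P n) => z zr; rewrite (FE n z) addrC addKr nmM nmX.
have zr4 : nm z <= 4 * r by lra.
apply: (@le_trans _ _ (r ^+ n * (M / (2 * r) ^+ n))).
  apply: ler_pM; rewrite ?exprn_ge0 ?nm_ge0 //; last exact: fnM.
  by apply: lerXn2r; rewrite ?nnegrE ?nm_ge0 // ltW.
move: nP; rewrite ltr_pdivlMr // exprVn => nP.
have -> : r ^+ n * (M / (2 * r) ^+ n) = (2 ^+ n)^-1 * M.
  by rewrite exprMn; field; rewrite !expf_neq0 ?gt_eqF.
exact: ltW.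
Qed.

Definition papprox L u := forall e, 0 < e ->
  exists p, forall z, L z -> nm (u z - p.[z]) <= e.

Section OnCompact.
Variables (L : set (CC R)) (B : R).
Hypothesis LB : forall z, L z -> nm z <= B.

Lemma papprox_poly p : papprox L (fun z => p.[z]).
Proof. by move=> e e0; exists p => z _; rewrite subrr nm0 ltW. Qed.

Lemma poly_bounded p : exists2 M, 0 < M & forall z, L z -> nm p.[z] <= M.
Proof.
elim/poly_ind: p => [|p c [M M0 IH]].
  by exists 1 => // z _; rewrite horner0 nm0.
exists (M * `|B| + nm c + 1) => [|z Lz].
  by rewrite ltr_wpDl // addr_ge0 ?nm_ge0 // mulr_ge0 // ltW.
rewrite hornerD hornerMX hornerC; apply: le_trans (nmD _ _) _; rewrite nmM.
have := IH z Lz; have := LB Lz; have := ler_norm B; have := nm_ge0 z; have := nm_ge0 p.[z].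
by nra.
Qed.

Lemma papprox_bounded u : papprox L u -> exists2 M, 0 < M & forall z, L z -> nm (u z) <= M.
Proof.
move=> /(_ _ ltr01) [p pP]; have [M M0 pM] := poly_bounded p.
exists (M + 1) => [|z Lz]; first by lra.
have := pM z Lz; have := pP z Lz; have := nm_lerB (u z) p.[z]; lra.
Qed.

Lemma papproxD u v : papprox L u -> papprox L v -> papprox L (fun z => u z + v z).
Proof.
move=> ua va e e0; have e2 : 0 < e / 2 by lra.
have [p pP] := ua _ e2; have [q qP] := va _ e2; exists (p + q) => z Lz.
rewrite hornerD (_ : _ - _ = (u z - p.[z]) + (v z - q.[z])); last by ring.
by apply: le_trans (nmD _ _) _; have := pP z Lz; have := qP z Lz; lra.
Qed.

Lemma papproxM u v : papprox L u -> papprox L v -> papprox L (fun z => u z * v z).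
Proof.
move=> /[dup] ua /papprox_bounded[M M0 uM] va e e0.
have [q qP] := va (e / 2 / M) (divr_gt0 (divr_gt0 e0 (ltr0n R 2)) M0).
have [N N0 qN] := poly_bounded q.
have [p pP] := ua (e / 2 / N) (divr_gt0 (divr_gt0 e0 (ltr0n R 2)) N0).
exists (p * q) => z Lz.
rewrite hornerM (_ : _ - _ = u z * (v z - q.[z]) + (u z - p.[z]) * q.[z]); last by ring.
apply: le_trans (nmD _ _) _; rewrite !nmM.
have h1 : nm (u z) * nm (v z - q.[z]) <= M * (e / 2 / M).
  by apply: ler_pM; rewrite ?nm_ge0 ?uM ?qP.
have h2 : nm (u z - p.[z]) * nm q.[z] <= e / 2 / N * N.
  by apply: ler_pM; rewrite ?nm_ge0 ?pP ?qN.
have E1 : M * (e / 2 / M) = e / 2 by field; rewrite gt_eqF.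
by rewrite E1 in h1; rewrite divfK ?gt_eqF // in h2; lra.
Qed.

Lemma papprox_ext u v : (forall z, L z -> u z = v z) -> papprox L u -> papprox L v.
Proof. by move=> uv ua e /ua[p pP]; exists p => z Lz; rewrite -uv ?pP. Qed.

Lemma papproxX u n : papprox L u -> papprox L (fun z => u z ^+ n).
Proof.
move=> ua; elim: n => [|n IH].
  by apply: papprox_ext (papprox_poly 1) => z _; rewrite hornerE.
by apply: papprox_ext (papproxM ua IH) => z _; rewrite exprS.
Qed.

Lemma papprox_cst c : papprox L (fun=> c).
Proof. by apply: papprox_ext (papprox_poly c%:P) => z _; rewrite hornerC. Qed.

Lemma papprox_sum u n : papprox L u -> papprox L (fun z => \sum_(k < n) u z ^+ k).
Proof.
move=> ua; elim: n => [|n IH].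
  by apply: papprox_ext (papprox_cst 0) => z _; rewrite big_ord0.
by apply: papprox_ext (papproxD IH (papproxX n ua)) => z _; rewrite big_ord_recr.
Qed.

Lemma papprox_lim u : (forall e, 0 < e ->
  exists2 v, papprox L v & forall z, L z -> nm (u z - v z) <= e) -> papprox L u.
Proof.
move=> H e e0; have e2 : 0 < e / 2 by lra.
have [v va uv] := H _ e2; have [p pP] := va _ e2; exists p => z Lz.
by apply: le_trans (nm_tri (v z) _ _) _; have := uv z Lz; have := pP z Lz; lra.
Qed.

Lemma neumann u : papprox L u -> (forall z, L z -> nm (u z) <= 2^-1) ->
  papprox L (fun z => (1 - u z)^-1).
Proof.
move=> ua u2; apply: papprox_lim => e e0.
have [n nP] := half_pow_lt (divr_gt0 e0 (ltr0n R 2)).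
exists (fun z => \sum_(k < n) u z ^+ k); first exact: papprox_sum.
move=> z Lz; have uz := u2 z Lz.
have n1 : 2^-1 <= nm (1 - u z) by have := nm_lerB 1 (u z); rewrite nm1; lra.
have n0 : 1 - u z != 0 by rewrite -nm_gt0; lra.
have -> : (1 - u z)^-1 - \sum_(k < n) u z ^+ k = u z ^+ n / (1 - u z).
  have := subrX1 (u z) n; set S := \sum_(_ < _) _ => E.
  have -> : u z ^+ n = 1 - (1 - u z) * S by rewrite -[u z ^+ n](subrK 1) E; ring.
  by field.
have p0 : 0 < nm (1 - u z) by lra.
rewrite nmM nmV nmX ler_pdivrMr //.
have : nm (u z) ^+ n <= 2^-1 ^+ n by apply: lerXn2r; rewrite ?nnegrE ?nm_ge0 // invr_ge0.
by nra.
Qed.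

(* For compact [L], the points which are not good form the polynomially convex hull
   of [L]. *)
Definition good a := ~ L a /\ papprox L (fun z => (z - a)^-1).

Lemma good_far a : 0 < B -> 2 * B <= nm a -> good a.
Proof.
move=> B0 aB; have a0 : a != 0 by rewrite -nm_gt0; lra.
have aL : ~ L a by move=> /LB; lra.
split=> //; have ua : papprox L (fun z => a^-1 * z).
  by apply: papprox_ext (papprox_poly (a^-1 *: 'X)) => z _; rewrite hornerZ hornerX.
have un z : L z -> nm (a^-1 * z) <= 2^-1.
  by move=> Lz; rewrite nmM nmV mulrC ler_pdivrMr ?nm_gt0 //; have := LB Lz; lra.
apply: papprox_ext (papproxM (papprox_cst (- a^-1)) (neumann ua un)) => z Lz.
have za : z - a != 0 by apply/eqP => /subr0_eq zE; rewrite zE in Lz.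
have za' : a - z != 0 by rewrite -opprB oppr_eq0.
have -> : 1 - a^-1 * z = (a - z) / a by field.
by field; rewrite a0 za za'.
Qed.

(** Runge's pole pushing: [1 / (z - a)] is [1 / (z - b)] times the geometric series in
    [(a - b) / (z - b)], whose modulus on [L] is at most 1/2. *)
Lemma good_move a b r : good b -> ~ L a -> (forall z, L z -> r <= nm (z - b)) ->
  nm (a - b) <= r / 2 -> good a.
Proof.
move=> [bL ba] aL rP ab; split=> //.
have ua : papprox L (fun z => (a - b) * (z - b)^-1) by exact: papproxM (papprox_cst _) ba.
have Lb z : L z -> z - b != 0 by move=> Lz; apply/eqP => /subr0_eq zE; rewrite zE in Lz.
have un z : L z -> nm ((a - b) * (z - b)^-1) <= 2^-1.
  move=> Lz; have zb := Lb z Lz.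
  by rewrite nmM nmV ler_pdivrMr ?nm_gt0 //; have := rP z Lz; lra.
apply: papprox_ext (papproxM ba (neumann ua un)) => z Lz; have zb := Lb z Lz.
have za : z - a != 0 by apply/eqP => /subr0_eq zE; rewrite zE in Lz.
have -> : 1 - (a - b) * (z - b)^-1 = (z - a) / (z - b) by field.
by field; rewrite zb za.
Qed.

Lemma papprox_inv_poly p : p != 0 -> (forall a, root p a -> good a) ->
  papprox L (fun z => p.[z]^-1).
Proof.
move=> p0 pg; have [rs pE] := closed_field_poly_normal p.
have lp : lead_coef p != 0 by rewrite lead_coef_eq0.
have : forall a, a \in rs -> good a.
  by move=> a ars; apply: pg; rewrite pE rootZ // root_prod_XsubC.
rewrite pE => {pE pg p0} rg.
have : papprox L (fun z => (\prod_(a <- rs) ('X - a%:P)).[z]^-1).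
  elim: rs rg => [|a rs IH] rg.
    by apply: papprox_ext (papprox_cst 1) => z _; rewrite big_nil hornerE invr1.
  have ha : papprox L (fun z => (z - a)^-1) by apply: (rg a _).2; rewrite inE eqxx.
  have hr : papprox L (fun z => (\prod_(a <- rs) ('X - a%:P)).[z]^-1).
    by apply: IH => b brs; apply: rg; rewrite inE brs orbT.
  apply: papprox_ext (papproxM ha hr) => z _.
  by rewrite big_cons hornerM hornerXsubC invfM.
move=> h; apply: papprox_ext (papproxM (papprox_cst (lead_coef p)^-1) h) => z _.
by rewrite hornerZ invfM.
Qed.

End OnCompact.

Lemma antiderivative p : exists q : {poly R[i]}, q^`() = p.
Proof.
exists (\poly_(i < (size p).+1) (p`_i.-1 / i%:R)).
apply/polyP => i; rewrite coef_deriv coef_poly ltnS.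
case: ltnP => [_|/(nth_default 0)->]; last by rewrite mul0rn.
by rewrite -[LHS]mulr_natr divfK // pnatr_eq0.
Qed.

End Approximation.

(** * Polynomially convex hulls *)

Section Hull.
Variable R : realType.
Implicit Types (h : R[i] -> R[i]) (a b w z x : R[i]) (r e M t s : R) (K L A : set (CC R)).

Lemma compact_nm_bounded L : compact L -> exists2 B, 0 < B & forall z, L z -> nm z <= B.
Proof.
move=> cL; have : \forall n \near \oo, forall z, L z -> nm z <= (n.+1%:R : R).
  apply: (@compact_uniform _ L _ _ (fun n z => nm z <= n.+1%:R)) => // x Lx.
  exists 1 => //; exists (Num.bound (nm x)) => // n /= nx w wx.
  have := archi_boundP (nm_ge0 x); have := nm_lerB w x.
  by have : (Num.bound (nm x))%:R <= n%:R :> R by [rewrite ler_nat]; rewrite -natr1; lra.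
by case=> N _ /(_ N (leqnn N)) NP; exists N.+1%:R.
Qed.

Lemma compact_away L a : compact L -> ~ L a ->
  exists2 r, 0 < r & forall z, L z -> r <= nm (z - a).
Proof.
move=> cL La; have : \forall n \near \oo, forall z, L z -> 1 / n.+1%:R <= nm (z - a).
  apply: (@compact_uniform _ L _ _ (fun n z => 1 / n.+1%:R <= nm (z - a))) => // x Lx.
  have x0 : 0 < nm (x - a).
    by rewrite nm_gt0 subr_eq0; apply/eqP => xa; apply: La; rewrite -xa.
  exists (nm (x - a) / 2); first by lra.
  apply: filterS (inv_succ_cvg 1 (_ : 0 < nm (x - a) / 2)); last by lra.
  move=> n /=; move: (1 / _) => u uP w wx; have := nm_tri w x a.
  by rewrite [nm (x - w)]nm_distC; lra.
by case=> N _ /(_ N (leqnn N)) NP; exists (1 / N.+1%:R) => //; rewrite divr_gt0.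
Qed.

(** Off [L], goodness is locally constant, because poles can be pushed in both directions. So the
    hull is closed and its points outside [L] are interior; it is bounded since far points are
    good. *)
Lemma hull_exists L : compact L -> exists K, [/\ compact K, L `<=` K,
  (forall z, K z -> ~ L z -> exists2 r, 0 < r & forall w, nm (w - z) < r -> K w) &
  forall a, ~ K a -> good L a].
Proof.
move=> cL; have [B B0 LB] := compact_nm_bounded cL.
pose K : set (CC R) := [set a | L a \/ ~ good L a].
have Kgood a : ~ K a -> good L a.
  by move=> /not_orP[_ /contrapT].
have near_same a : ~ L a -> exists2 r, 0 < r & forall w, nm (w - a) < r ->
    ~ L w /\ (good L w <-> good L a).
  move=> La; have [r r0 rP] := compact_away cL La.
  (* A nearby [w] keeps distance at least [3 r / 4] from [L], and [r / 4] is less than half of that,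
     so [good_move] also works from [w] to [a]. *)
  exists (r / 4) => [|w wr]; first by lra.
  have rw z : L z -> r * (3 / 4) <= nm (z - w).
    by move=> /rP; have := nm_tri w z a; lra.
  have Lw : ~ L w by move=> /rw; rewrite subrr nm0; lra.
  split=> //; split=> [gw|ga].
    apply: (@good_move _ L B LB a w (r * (3 / 4))) => //.
    by rewrite nm_distC; lra.
  by apply: (@good_move _ L B LB w a r) => //; lra.
exists K; split=> //; first last.
- move=> z [//|zg] Lz; have [r r0 rP] := near_same z Lz.
  by exists r => // w /rP [_ wz]; right => /wz.
- by move=> z Lz; left.
apply: (@compactC _ _ (2 * B)) => [w|z zK].
  case=> [/LB|wg]; first by lra.
  by rewrite leNgt; apply/negP => wB; apply: wg; apply: (good_far LB) => //; lra.
have [Lz|Lz] := pselect (L z); first by left.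
have [r r0 rP] := near_same z Lz; have [w Kw wz] := zK r r0.
by have [Lw wg] := rP w wz; case: Kw => // nw; right => /wg.
Qed.

(* If [h] had no fixed point on [K], then [1 / (h - id)] would be a uniform limit
   on [L] of polynomials; a primitive [T] of such a polynomial would satisfy
   [Re (T (h w)) >= Re (T w) + 2/5] along the orbits in [A], although it is bounded. *)
Lemma fixed_point_in_hull h K L A : compact K -> compact L -> L `<=` K ->
  (forall a, ~ K a -> good L a) -> (forall z, cdiff h z (der h z)) ->
  A !=set0 -> (forall w, A w -> A (h w)) ->
  (forall w t, A w -> 0 <= t <= 1 -> L (w + (h w - w) * t%:C) /\
     let x := w + (h w - w) * t%:C in nm ((h x - x) - (h w - w)) <= nm (h w - w) / 4) ->
  exists2 p, K p & h p = p.
Proof.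
move=> cK cL LK Kgood hh [w0 Aw0] Ah AL; apply: contrapT => nofix.
have D0 z : K z -> h z - z != 0.
  by move=> Kz; apply/eqP => /subr0_eq hz; apply: nofix; exists z.
pose D z := h z - z.
have Dh z : cdiff D z (der D z).
  by apply: cdiff_der; apply: cdiffB; [exact: hh|exact: cdiff_id].
have LA w : A w -> L w.
  by move=> Aw; have [|] := AL w 0 Aw; rewrite ?lexx ?ler01 // rmorph0 mulr0 addr0.
have [B B0 LB] := compact_nm_bounded cL; have [rho rho0 Kr] := compact_nm_bounded cK.
have [|c Kc cP] := @compact_max _ K (fun z => - nm (D z)) cK (ex_intro _ w0 (LK _ (LA _ Aw0))).
  move=> x _ e e0; have [r r0 rP] := nm_ccont (cdiff_cont (Dh x)) e0.
  by exists r => // w /rP; rewrite -opprD normrN.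
pose eta := nm (D c).
have eta0 : 0 < eta by rewrite nm_gt0 D0.
have Deta z : K z -> eta <= nm (D z) by move=> /cP; rewrite lerN2.
(* [D] may have infinitely many zeros, so a polynomial [p] replaces it. The error [eta / 20] keeps
   [p] free of zeros on [K]; all its roots are good, and [1 / p] is approximable on [L]. *)
have [|p pP] := taylor_approx (e := eta / 20) rho0 _ Dh; first by rewrite divr_gt0.
have pK z : K z -> eta * (19 / 20) <= nm p.[z].
  move=> Kz; have := pP z (Kr z Kz); have := Deta z Kz.
  by have := nm_lerB (D z) p.[z]; have := nm_lerB (D z) (D z - p.[z]);
    rewrite opprB subrKC; lra.
have p0 : p != 0.
  by apply/eqP => pE; have := pK c Kc; rewrite pE horner0 nm0; lra.
have pg a : root p a -> good L a.
  by move=> /rootP pa; apply: Kgood => Ka; have := pK a Ka; rewrite pa nm0; lra.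
have Dp : papprox L D.
  move=> e e0; have [q qP] := taylor_approx B0 e0 Dh.
  by exists q => z /LB /qP.
have [N N0 DN] := papprox_bounded LB Dp.
have [|q qP] := papprox_inv_poly LB p0 pg (e := 1 / 20 / N); first by rewrite !divr_gt0.
have qD z : L z -> nm (q.[z] * D z - 1) <= 1 / 5.
  move=> Lz; have Kz := LK z Lz; have pz := pK z Kz.
  have pp : 0 < nm p.[z] by lra.
  have pz0 : p.[z] != 0 by rewrite -nm_gt0.
  have -> : q.[z] * D z - 1 = (D z - p.[z]) / p.[z] - (p.[z]^-1 - q.[z]) * D z by field.
  apply: le_trans (nmB _ _) _; rewrite !nmM nmV.
  have h1 : nm (D z - p.[z]) / nm p.[z] <= 1 / 10.
    by rewrite ler_pdivrMr //; have := pP z (Kr z Kz); lra.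
  have h2 : nm (p.[z]^-1 - q.[z]) * nm (D z) <= 1 / 20 / N * N.
    by apply: ler_pM; rewrite ?nm_ge0 ?qP ?DN.
  by rewrite divfK ?gt_eqF // in h2; lra.
have [T TE] := antiderivative q.
have step w : A w -> Re T.[w] + 2 / 5 <= Re T.[h w].
  move=> Aw; pose Phi z := T.[w + D w * z] - z.
  (* The derivative of [Phi] is [q.[x] * D w - 1]. Replacing [D w] by [D x] leaves at most 1/5, and
     the replacement costs at most a third of [nm (q.[x] * D x)], that is 2/5. Since [Phi 1 - Phi 0]
     is [T.[h w] - T.[w] - 1], the real part of [T] gains at least 2/5. *)
  have : nm (Phi 1 - Phi 0) <= 3 / 5 * nm (1 - 0).
    apply: mean_value => t tP; rewrite add0r subr0 mul1r.
    have [Lx xw] := AL w t Aw tP; set x := w + D w * t%:C in Lx xw.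
    exists (q.[x] * D w - 1).
      apply: cdiffB; last exact: cdiff_id.
      rewrite -TE; apply: (cdiff_comp (f := fun z => w + D w * z)); last exact: cdiff_poly.
      have := cdiffD (cdiff_cst w t%:C) (cdiffZ (D w) (cdiff_id t%:C)).
      by rewrite add0r mulr1.
    have -> : q.[x] * D w - 1 = (q.[x] * D x - 1) - q.[x] * (D x - D w) by ring.
    apply: le_trans (nmB _ _) _; rewrite nmM; have qx := qD x Lx.
    have Dx : nm (D w) * (3 / 4) <= nm (D x).
      have h1 := nm_lerB (D w) (D w - D x).
      have h2 : D w - (D w - D x) = D x by ring.
      by rewrite h2 [nm (D w - D x)]nm_distC in h1; rewrite /D in xw *; lra.
    have h1 : nm q.[x] * nm (D x) <= 6 / 5.
      by rewrite -nmM; have := nm_lerB (q.[x] * D x) 1; rewrite nm1; lra.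
    have h2 : nm q.[x] * nm (D x - D w) <= nm q.[x] * (nm (D w) / 4).
      by rewrite ler_wpM2l ?nm_ge0.
    by have := nm_ge0 q.[x]; nra.
  rewrite subr0 nm1 mulr1 /Phi mulr0 mulr1 addr0 subr0 /D subrKC => /(le_trans (Re_le_nm _)).
  by case: (T.[h w]) (T.[w]) => [u v] [u' v'] /=; rewrite ler_norml => /andP[]; lra.
have iterA n : A (iter n h w0) /\ Re T.[w0] + n%:R * (2 / 5) <= Re T.[iter n h w0].
  elim: n => [|n [IH1 IH2]]; first by rewrite mul0r addr0.
  split=> /=; first exact: Ah.
  by have := step _ IH1; rewrite -natr1; lra.
have [M M0 TM] := poly_bounded LB T.
pose n := Num.bound (M * 5).
have := archi_boundP (_ : 0 <= M * 5); rewrite mulr_ge0 ?(ltW M0) // => /(_ isT).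
rewrite -/n => nM; have [An hn] := iterA n.
have h1 := TM _ (LA _ An); have h2 := TM _ (LA _ Aw0).
have := Re_le_nm T.[iter n h w0]; have := Re_le_nm T.[w0].
by rewrite !ler_norml => /andP[h3 h4] /andP[h5 h6]; lra.
Qed.

End Hull.

(** * Normal families *)

Section Topology.
Variable R : realType.
Implicit Types (f psi : CC R -> CC R) (h : nat -> CC R -> CC R).
Implicit Types (z w x y : R[i]) (r e M d : R) (A D : set (CC R)).

Lemma connected_ind D A : connected D -> (exists2 x, D x & A x) ->
  (forall x, D x -> A x -> exists2 r, 0 < r & forall w, D w -> nm (w - x) < r -> A w) ->
  (forall x, D x -> ~ A x -> exists2 r, 0 < r & forall w, D w -> nm (w - x) < r -> ~ A w) ->
  D `<=` A.
Proof.
move=> cD [x0 Dx0 Ax0] Ao Ac.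
have interE (P : set (CC R)) (x : CC R) : interior P x <->
    exists2 r, 0 < r & forall w, nm (w - x) < r -> P w by exact: nbhs_nmP.
suff E : D `&` A = D by move=> x Dx; have : (D `&` A) x by [rewrite E]; case.
apply: cD.
- by exists x0.
- exists (interior [set w | D w -> A w]); first exact: open_interior.
  apply/seteqP; split=> x /= [Dx Ax]; split=> //.
    apply/interE; have [r r0 rP] := Ao x Dx Ax.
    by exists r => // w wr Dw; exact: rP.
  by move/interE: Ax => [r r0 /(_ x)]; rewrite subrr nm0 => /(_ r0 Dx).
- exists (~` interior [set w | D w -> ~ A w]).
    by apply: open_closedC; exact: open_interior.
  apply/seteqP; split=> x /= [Dx Ax]; split=> //.
    by move=> /interE[r r0 /(_ x)]; rewrite subrr nm0 => /(_ r0 Dx).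
  apply: contrapT => nAx; apply: Ax; apply/interE.
  by have [r r0 rP] := Ac x Dx nAx; exists r => // w wr Dw; exact: rP.
Qed.

Lemma segmentC_connected x y :
  connected ([set x + (y - x) * t%:C | t in `[0, 1]] : set (CC R)).
Proof.
apply: (@connected_continuous_connected R (CC R)); first exact: segment_connected.
apply: continuous_subspaceT => t V /nbhs_nmP [r r0 rV].
have c0 : 0 < nm (y - x) + 1 by rewrite ltr_wpDl ?nm_ge0.
apply/nbhs_ballP; exists (r / (nm (y - x) + 1)); first by rewrite /= divr_gt0.
move=> s; rewrite /ball /= distrC => st; apply: rV.
rewrite (_ : _ - _ = (y - x) * (s - t)%:C); last by rewrite rCB; ring.
rewrite nmM nm_real; move: st; rewrite ltr_pdivlMr //.
by have := normr_ge0 (s - t); nra.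
Qed.

Lemma unif_nmP A h psi : {uniform A, h @ \oo --> psi} <->
  forall e, 0 < e -> \forall n \near \oo, forall w, A w -> nm (h n w - psi w) < e.
Proof.
split=> [H e e0|H P /uniform_nbhs [E [entE EP]]].
  have : nbhs (psi : {uniform` A -> CC R}) [set g | forall w, A w -> nm (g w - psi w) < e].
    apply/uniform_nbhs; exists [set p | ball p.1 e%:C p.2]; split.
      by rewrite -entourage_ballE; exists e%:C => //=; rewrite ltcR.
    by move=> g gP w /gP; rewrite /ball /= normE ltcR nm_distC.
  by move=> /H.
apply: (filterS EP); move: entE; rewrite -entourage_ballE => -[e /= e0 eE].
have eR : e = (Re e)%:C by rewrite RRe_real // gtr0_real.
have Re0 : 0 < Re e by rewrite -ltcR -eR.
apply: filterS (H _ Re0) => n hn w Aw /=; apply: eE => /=.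
by rewrite /ball /= eR normE ltcR nm_distC hn.
Qed.

Lemma luc_Some D h psi : loc_unif_cvg D h (Some psi) <->
  forall z, D z -> exists2 r, 0 < r & forall e, 0 < e ->
    \forall n \near \oo, forall w, nm (w - z) < r -> D w -> nm (h n w - psi w) < e.
Proof.
split=> [H z Dz|H z Dz].
  have [V /nbhs_nmP[r r0 rV] /unif_nmP VD] := H z Dz.
  exists r => // e e0; apply: filterS (VD _ e0) => n hn w wr Dw.
  by apply: hn; split=> //; exact: rV.
have [r r0 rP] := H z Dz.
exists [set w | nm (w - z) < r]; first by apply/nbhs_nmP; exists r.
by apply/unif_nmP => e /rP; apply: filterS => n hn w [/= wr Dw]; exact: hn.
Qed.

Lemma luc_None D h : loc_unif_cvg D h None <->
  forall z, D z -> exists2 r, 0 < r & forall M,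
    \forall n \near \oo, forall w, nm (w - z) < r -> D w -> M < nm (h n w).
Proof.
split=> [H z Dz|H z Dz].
  have [V /nbhs_nmP[r r0 rV] VD] := H z Dz.
  exists r => // M; apply: filterS (VD M) => n hn w wr Dw.
  by rewrite -ltcR -normE; apply: hn; split=> //; exact: rV.
have [r r0 rP] := H z Dz.
exists [set w | nm (w - z) < r]; first by apply/nbhs_nmP; exists r.
by move=> M; apply: filterS (rP M) => n hn w [/= wr Dw]; rewrite normE ltcR; exact: hn.
Qed.

Lemma cdiff_derivable f z : derivable f z 1 -> exists l, cdiff f z l.
Proof.
move=> /cvg_ex[l fl]; exists l; apply/cdiffP => e e0.
have : nbhs (l : CC R) [set w : CC R | nm (w - l) < e] by apply/nbhs_nmP; exists e.
move=> /fl /=; rewrite /nbhs /= /dnbhs /within /= => /nbhs_nmP [r r0 rP].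
exists r => // w wr; have [->|wz] := eqVneq w z.
  by rewrite !subrr mulr0 subrr nm0 mulr0.
have wz0 : w - z != 0 by rewrite subr_eq0.
have := rP (w - z); rewrite subr0 => /(_ wr wz0) /=.
rewrite /GRing.scale /= mulr1 subrK => h.
rewrite (_ : _ - _ = ((w - z)^-1 * (f w - f z) - l) * (w - z)); last by field.
by rewrite nmM ler_wpM2r ?nm_ge0 // ltW.
Qed.

End Topology.

(** * Vitali's theorem *)

Section Vitali.
Variable R : realType.
Implicit Types (z w x y : R[i]) (r e M : R) (D : set (CC R)).

Lemma frequently_ultra (I : Type) (F : set_system I) (S : set I) :
  ProperFilter F -> ~ F (~` S) -> exists G, [/\ UltraFilter G, F `<=` G & G S].
Proof.
move=> PF nS; have PW : ProperFilter (within S F).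
  split; last by exact: within_filter.
  by move=> WS; apply: nS; apply: filterS WS.
have [G [UG FG]] := ultraFilterLemma PW; exists G; split=> //.
  by move=> A FA; apply: FG; apply: filterS FA.
by apply: FG; rewrite /within /=; apply: filterE.
Qed.

Lemma cvC_sub (I : Type) (F G : set_system I) (a : I -> R[i]) l :
  F `<=` G -> cvC F a l -> cvC G a l.
Proof. by move=> FG al e e0; apply: FG; exact: al. Qed.

(** Takes the place of Montel's theorem: along an ultrafilter pointwise limits exist by boundedness,
    and [limit_cdiff] makes them holomorphic. *)
Lemma ultra_limit (I : Type) (F : set_system I) (u : I -> R[i] -> R[i]) x r M :
  UltraFilter F -> 0 < r ->
  (\forall i \near F, holoB (u i) x r /\ forall w, nm (w - x) < r -> nm (u i w) <= M) ->
  exists L, [/\ forall w, nm (w - x) < r -> cvC F (u ^~ w) (L w), holoB L x r &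
    forall w, nm (w - x) < r -> nm (L w) <= M].
Proof.
move=> UF r0 uF; have PF : ProperFilter F by exact: ultra_proper.
have /choice[L LP] : forall w, exists l, nm (w - x) < r -> cvC F (u ^~ w) l.
  move=> w; have [wr|wr] := boolP (nm (w - x) < r); last by exists 0.
  have [|l ul] := @ultra_cvC _ _ F (u ^~ w) M UF; last by exists l.
  by apply: filterS uF => i [_]; apply.
exists L; split=> // [w wr|w wr].
  have s0 : 0 < r - nm (w - x) by lra.
  have [||d Ld _] := @limit_cdiff _ I F PF u L w _ M s0.
  - apply: filterS uF => i [h1 h2]; split.
      by apply: holoB_sub h1; lra.
    by move=> v vw; apply: h2; apply: le_lt_trans (nm_tri w _ _) _; lra.
  - by move=> v vw; apply: LP; apply: le_lt_trans (nm_tri w _ _) _; lra.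
  exact: cdiff_der Ld.
by apply: (cvC_le (LP w wr)); apply: filterS uF => i [_]; apply.
Qed.

(** The points near which [u] tends to 0 form an open set [A]. If convergence failed at some [v]
    close to a point [y] of [A], an ultrafilter along which [u i v] stays away from 0 would give a
    holomorphic limit that vanishes near [y], hence at [v]. So [A] is closed in [D]. *)
Lemma vitali (I : Type) (F : set_system I) (u : I -> R[i] -> R[i]) D :
  ProperFilter F -> connected D ->
  (forall z, D z -> exists r M, 0 < r /\ \forall i \near F,
     holoB (u i) z r /\ forall w, nm (w - z) < r -> nm (u i w) <= M) ->
  (exists2 y, D y & exists2 r, 0 < r & forall w, nm (w - y) < r -> cvC F (u ^~ w) 0) ->
  forall w, D w -> cvC F (u ^~ w) 0.
Proof.
move=> PF cD ub uy.
pose A : set (CC R) := [set x : R[i] | exists2 r, 0 < r &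
  forall w, nm (w - x) < r -> cvC F (u ^~ w) 0].
suff DA : D `<=` A by move=> w /DA[r r0]; apply; rewrite subrr nm0.
apply: connected_ind => // [x Dx [r r0 rP]|x Dx nAx].
  exists (r / 2) => [|w Dw wx]; first by lra.
  exists (r / 2) => [|v vw]; first by lra.
  by apply: rP; apply: le_lt_trans (nm_tri w _ _) _; lra.
have [r [M [r0 rM]]] := ub x Dx.
exists (r / 32) => [|y Dy yx [s s0 sP]]; first by lra.
apply: nAx; exists (r / 32) => [|v vx]; first by lra.
have vy : nm (v - y) < r / 16.
  by apply: le_lt_trans (nm_tri x _ _) _; rewrite [nm (x - y)]nm_distC; lra.
apply: contrapT => /existsNP[e /not_implyP[e0 nF]].
have [G [UG FG GS]] := @frequently_ultra I F [set i | ~ nm (u i v - 0) < e] PF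
  (fun h => nF (filterS (fun i => @contrapT _) h)).
have PG : ProperFilter G by exact: ultra_proper.
have [|L [uL Lh LM]] := @ultra_limit I G u x r M UG r0; first exact: FG.
have r8 : 8 * (r / 16) = r / 2 by field.
have Lv : L v = 0.
  apply: (@identity_local _ L y (r / 16) M) => //; rewrite ?r8; first by lra.
  - by apply: holoB_sub Lh; lra.
  - by move=> w wy; apply: LM; apply: le_lt_trans (nm_tri y _ _) _; lra.
  exists (Num.min s (r / 2)) => [|w]; first by rewrite lt_min s0; lra.
  rewrite lt_min => /andP[ws wr].
  apply: (@cvC_uniq _ _ G _ (u ^~ w)); last exact: cvC_sub FG (sP w ws).
  by apply: uL; apply: le_lt_trans (nm_tri y _ _) _; lra.
have vr : nm (v - x) < r by lra.
have := uL v vr; rewrite Lv => /(_ _ e0) => h.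
have [i [/= h1 h2]] := filter_ex (filterI h GS).
exact: h2.
Qed.

End Vitali.

(** * Boundedness and equicontinuity on the Fatou set *)

Section Fatou.
Variable R : realType.
Variable f : CC R -> CC R.
Hypothesis fh : forall z, cdiff f z (der f z).
Implicit Types (z w x y : R[i]) (r e M : R) (m n j : nat).

Lemma homo_ge (s : nat -> nat) : {homo s : i j / (i < j)%N} -> forall n, (n <= s n)%N.
Proof. by move=> hs; elim=> // n IH; apply: leq_ltn_trans IH (hs _ _ _). Qed.

Lemma iter_diff n z : cdiff (iter n f) z (der (iter n f) z).
Proof.
have [d] : exists d, cdiff (iter n f) z d; last exact: cdiff_der.
elim: n => [|n [d IH]]; first by exists 1; exact: cdiff_id.
by exists (der f (iter n f z) * d); exact: (cdiff_comp IH (fh _)).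
Qed.

Lemma iter_cont n z : ccont (iter n f) z.
Proof. exact: cdiff_cont (iter_diff n z). Qed.

Definition bdd z := exists M, forall n, nm (iter n f z) <= M.

Lemma Fatou_open z : Fatou f z -> exists2 r, 0 < r & forall w, nm (w - z) < r -> Fatou f w.
Proof.
case=> V /nbhs_nmP[r r0 rV] VN; exists (r / 2) => [|w wz]; first by lra.
exists V => //; apply/nbhs_nmP; exists (r / 2) => [|v vw]; first by lra.
by apply: rV; apply: le_lt_trans (nm_tri w _ _) _; lra.
Qed.

(** Choose times at which the orbit of [w'] exceeds [j]. A limit function of these iterates cannot
    be finite because of [w'], nor infinite because of the bounded orbit of [w]. *)
Lemma Fatou_bdd z : Fatou f z -> exists2 r, 0 < r &
  forall w w', nm (w - z) < r -> nm (w' - z) < r -> bdd w -> bdd w'.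
Proof.
case=> V /nbhs_nmP[r r0 rV] VN; exists r => // w w' wr w'r [M wM].
apply: contrapT => nb.
have /choice[s sP] : forall j, exists n, j%:R < nm (iter n f w').
  move=> j; apply: contrapT => /forallNP h; apply: nb; exists j%:R => n.
  by rewrite leNgt; apply/negP; exact: h.
have [[psi|] [t [th]]] := VN s.
  move=> /luc_Some /(_ w' (rV _ w'r)) [q q0 /(_ _ ltr01)] [N _ NP].
  pose j := maxn N (Num.bound (nm (psi w') + 1)).
  have := NP j (leq_maxl _ _) w'; rewrite subrr nm0 => /(_ q0 (rV _ w'r)) /= h1.
  have h2 := sP (t j); have := nm_lerB (iter (s (t j)) f w') (psi w').
  have h3 : (Num.bound (nm (psi w') + 1))%:R <= (t j)%:R :> R.
    by rewrite ler_nat (leq_trans _ (homo_ge th j)) // leq_maxr.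
  have : nm (psi w') + 1 < (Num.bound (nm (psi w') + 1))%:R.
    by apply: archi_boundP; rewrite addr_ge0 ?nm_ge0.
  by rewrite /iterates in h1; lra.
move=> /luc_None /(_ w (rV _ wr)) [q q0 /(_ M)] [N _ NP].
have := NP N (leqnn N) w; rewrite subrr nm0 => /(_ q0 (rV _ wr)).
by rewrite ltNge wM.
Qed.

(** Equicontinuity in the plane can fail where iterates tend to infinity; one value of modulus at
    most [M] near [z] singles out the iterates for which it holds. Counterexamples approaching [z]
    would form a sequence of iterates with a limit function, infinite against that bound or finite
    against the continuity of a single iterate. *)
Lemma Fatou_equicont z M e : Fatou f z -> 0 < e -> exists2 d, 0 < d & forall n,
  (exists2 w, nm (w - z) < d & nm (iter n f w) <= M) ->
  forall w, nm (w - z) < d -> nm (iter n f w - iter n f z) <= e.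
Proof.
case=> V /nbhs_nmP[r r0 rV] VN e0; apply: contrapT => nex.
have /choice[g gP] : forall j : nat, exists p : nat * (R[i] * R[i]),
    [/\ nm (p.2.1 - z) < 1 / j.+1%:R, nm (iter p.1 f p.2.1) <= M,
        nm (p.2.2 - z) < 1 / j.+1%:R & e < nm (iter p.1 f p.2.2 - iter p.1 f z)].
  move=> j; apply: contrapT => /forallNP h; apply: nex.
  exists (1 / j.+1%:R) => [|n [w wd wM] w' w'd]; first by rewrite divr_gt0.
  by rewrite leNgt; apply/negP => lt; apply: (h (n, (w, w'))).
have Vz : V z by apply: rV; rewrite subrr nm0.
have small (t : nat -> nat) (q : R) : {homo t : i j / (i < j)%N} -> 0 < q ->
    \forall j \near \oo, 1 / (t j).+1%:R < q.
  move=> th q0; apply: filterS (inv_succ_cvg 1 q0) => j; apply: le_lt_trans.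
  by rewrite !div1r lef_pV2 ?posrE // ler_nat ltnS homo_ge.
have [[psi|] [t [th]]] := VN (fun j => (g j).1).
  move=> /luc_Some /(_ z Vz) [q q0 H].
  have e8 : 0 < e / 8 by lra.
  have [N _ NP] := H _ e8.
  (* Continuity of [psi] is not at hand; one iterate uniformly close to [psi] stands in for it. *)
  have [s s0 sP] := iter_cont (g (t N)).1 z e8.
  have q'0 : 0 < Num.min (Num.min q s) r by rewrite !lt_min q0 s0 r0.
  have [N' _ N'P] := small t _ th q'0.
  pose j := maxn N N'; have := N'P j (leq_maxr _ _).
  rewrite /= !lt_min => /andP[/andP[jq js] jr].
  have [_ _ h1 h2] := gP (t j).
  set w := (g (t j)).2.2 in h1 h2.
  have Vw : V w by apply: rV; exact: lt_trans h1 jr.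
  have zq : nm (z - z) < q by rewrite subrr nm0.
  have wq : nm (w - z) < q by exact: lt_trans h1 jq.
  have a1 := NP j (leq_maxl _ _) w wq Vw; have a2 := NP j (leq_maxl _ _) z zq Vz.
  have a3 := NP N (leqnn _) w wq Vw; have a4 := NP N (leqnn _) z zq Vz.
  have a5 : nm (iter (g (t N)).1 f w - iter (g (t N)).1 f z) < e / 8.
    by apply: sP; exact: lt_trans h1 js.
  rewrite /= /iterates in a1 a2 a3 a4.
  move: a1 a2 a3 a4 a5 h2; set x1 := iter _ f w; set x2 := iter _ f z.
  set x3 := iter _ f w; set x4 := iter _ f z => a1 a2 a3 a4 a5 h2.
  have := nm_tri (psi w) x1 x2; have := nm_tri x3 (psi w) x2; have := nm_tri x4 x3 x2.
  have := nm_tri (psi z) x4 x2.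
  by rewrite [nm (psi w - x3)]nm_distC [nm (psi z - x2)]nm_distC; lra.
move=> /luc_None /(_ z Vz) [q q0 /(_ M)] [N _ NP].
have q'0 : 0 < Num.min q r by rewrite lt_min q0 r0.
have [N' _ N'P] := small t _ th q'0.
pose j := maxn N N'; have := N'P j (leq_maxr _ _); rewrite /= lt_min => /andP[jq jr].
have [h1 h2 _ _] := gP (t j).
have Vw : V (g (t j)).2.1 by apply: rV; exact: lt_trans h1 jr.
have := NP j (leq_maxl _ _) (g (t j)).2.1 (lt_trans h1 jq) Vw.
by rewrite ltNge h2.
Qed.

Section Component.
Variable U : set (CC R).
Hypothesis Ucomp : Fatou_component f U.

Lemma comp_Fatou z : U z -> Fatou f z.
Proof. by case: Ucomp => x _ -> /connected_component_sub. Qed.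

Lemma comp_connected : connected U.
Proof. by case: Ucomp => x _ ->; exact: component_connected. Qed.

Lemma comp_open z : U z -> exists2 r, 0 < r & forall w, nm (w - z) < r -> U w.
Proof.
move=> Uz; have [r r0 rF] := Fatou_open (comp_Fatou Uz).
exists r => // w wr; have [x _ UE] := Ucomp; rewrite UE in Uz *.
apply: connected_component_trans Uz _.
exists ([set z + (w - z) * t%:C | t in `[0, 1]] : set (CC R)).
  split; last exact: segmentC_connected.
    by exists 0; rewrite /= ?in_itv /= ?lexx ?ler01 // rmorph0 mulr0 addr0.
  move=> v [t /= tP <-]; rewrite in_itv /= in tP; apply: rF.
  by apply: nm_segment => //; rewrite subrr nm0.
by exists 1; rewrite /= ?in_itv /= ?lexx ?ler01 // rmorph1 mulr1 subrKC.
Qed.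

End Component.

End Fatou.

Section IdentityLimit.
Variable R : realType.
Implicit Types (f : CC R -> CC R) (z w : R[i]) (D : set (CC R)) (t : nat -> nat).

Definition locbdd f D := forall z, D z -> exists r M : R, [/\ 0 < r, 0 <= M &
  forall n w, nm (w - z) < r -> nm (iter n f w) <= M].

Lemma vitali_id f D t : (forall z, cdiff f z (der f z)) -> connected D -> locbdd f D ->
  (exists2 y, D y & exists2 r, 0 < r &
     forall w, nm (w - y) < r -> cvC \oo (fun j => iter (t j) f w) w) ->
  forall z, D z -> cvC \oo (fun j => iter (t j) f z) z.
Proof.
move=> fh cD lb [y Dy [r r0 yr]] z Dz.
have V := @vitali _ nat \oo (fun j w => iter (t j) f w - w) D _ cD.
have -> : z = z + 0 by rewrite addr0.
apply: (cvC_eq (a := fun j => z + (iter (t j) f z - z))).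
  by apply: nearW => j; rewrite addr0 subrKC.
apply: cvCD; first exact: cvC_cst.
apply: V => // [x Dx|].
  have [q [M [q0 M0 qM]]] := lb x Dx; exists q, (M + (nm x + q)); split=> //.
  apply: nearW => j; split=> [w _|w wq].
    apply: (cdiff_der (d := der (iter (t j) f) w - 1)).
    by apply: cdiffB; [exact: iter_diff|exact: cdiff_id].
  apply: le_trans (nmB _ _) _; have := qM (t j) w wq; have := nm_lerB w x; lra.
exists y => //; exists r => // w wr.
by rewrite -(subrr w); apply: cvCB; [exact: yr|exact: cvC_cst].
Qed.

End IdentityLimit.

(** * Recurrent orbits in an invariant component *)

Section Recurrence.
Variable R : realType.
Variable f : CC R -> CC R.
Hypothesis fh : forall z, cdiff f z (der f z).
Variable U : set (CC R).
Hypothesis Ucomp : Fatou_component f U.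
Hypothesis UI : forall z, U z -> U (f z).
Implicit Types (z w x y a b : R[i]) (r e M : R) (m n j : nat).

Lemma compact_image (K : set (CC R)) (g : CC R -> CC R) :
  (forall x, K x -> ccont g x) -> compact K -> compact (g @` K).
Proof.
move=> gc; apply: continuous_compact; apply: continuous_in_subspaceT => x.
rewrite inE => Kx V /nbhs_nmP[e e0 eV]; have [r r0 rP] := gc x Kx e e0.
apply: (iffRL (@nbhs_nmP R x (g @^-1` V))); exists r => // w /rP; exact: eV.
Qed.

Lemma iter_U n z : U z -> U (iter n f z).
Proof. by move=> Uz; elim: n => //= n; exact: UI. Qed.

Lemma nm_chain (v w x y a : R[i]) e : nm (w - v) < e / 4 -> nm (w - x) <= e / 4 ->
  nm (y - x) <= e / 4 -> nm (y - a) < e / 4 -> nm (v - a) <= e.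
Proof.
have := nm_tri w v a; have := nm_tri x w a; have := nm_tri y x a.
by rewrite [nm (v - w)]nm_distC [nm (x - y)]nm_distC; lra.
Qed.

(* By compactness of the closed ball around [a], finitely many return times serve for
   all visits: a point [f ^ n0 a] close to [f ^ n a] is carried back to [a] by
   [f ^ (t_j - n0)], and so is [f ^ n a] by equicontinuity. *)
Lemma return_times_gap a (t : nat -> nat) d : U a -> 0 < d ->
  (forall z, nm (z - a) <= d -> U z) -> (forall j, (j <= t j)%N) ->
  cvC \oo (fun j => iter (t j) f a) a ->
  exists N, forall n, (0 < n)%N -> nm (iter n f a - a) <= d ->
    exists2 l, (0 < l <= N)%N & ((l <= n)%N -> nm (iter (n - l) f a - a) <= d).
Proof.
move=> Ua d0 dU tj ta.
(* Phrased for points [w] instead of times [n], so that compactness of the ball applies; it is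
   vacuous off the orbit. *)
pose P N w := forall n, (0 < n)%N -> iter n f a = w ->
  exists2 l, (0 < l <= N)%N & ((l <= n)%N -> nm (iter (n - l) f a - a) <= d).
suff [N _ NP] : \forall N \near \oo, forall w, nm (w - a) <= d -> P N w.
  by exists N => n n0 nd; exact: (NP N (leqnn N) _ nd n n0 erefl).
apply: (@compact_uniform _ [set w | nm (w - a) <= d] _ _ P); first exact: closed_ball_compact.
move=> x /= xd; have d4 : 0 < d / 4 by lra.
have [r r0 rP] := Fatou_equicont fh (nm a + 1) (comp_Fatou Ucomp (dU _ xd)) d4.
exists r => //.
have [[n0 n00 n0r]|nn] := pselect (exists2 n, (0 < n)%N & nm (iter n f a - x) < r).
  exists n0 => // N /= Nn0 w wx n n1 nE; exists n0; first by rewrite n00.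
  move=> n0n; have [q q0 qP] := iter_cont fh (n - n0) a d4.
  have m0 : 0 < Num.min (Num.min q (d / 4)) 1 by rewrite !lt_min q0 d4 ltr01.
  have [J _ JP] := ta _ m0.
  pose j := maxn J n0; have := JP j (leq_maxl _ _); rewrite /= !lt_min => /andP[/andP[jq jd] j1].
  have n0t : (n0 <= t j)%N by apply: leq_trans (tj j); exact: leq_maxr.
  have tE : iter (t j - n0) f (iter n0 f a) = iter (t j) f a by rewrite -iterD subnK.
  have ex : exists2 w, nm (w - x) < r & nm (iter (t j - n0) f w) <= nm a + 1.
    by exists (iter n0 f a) => //; rewrite tE; have := nm_lerB (iter (t j) f a) a; lra.
  have h1 := rP _ ex _ n0r; rewrite tE in h1.
  have h2 := rP _ ex _ (_ : nm (iter n f a - x) < r); rewrite nE in h2; have {}h2 := h2 wx.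
  have h3 := qP _ jq.
  have E : iter (n - n0) f (iter (t j) f a) = iter (t j - n0) f w.
    rewrite -nE -!iterD; congr (iter _ f a).
    by move: (t j) n0t n0n => T; clear; lia.
  rewrite E in h3.
  exact: nm_chain h3 h2 h1 jd.
exists 0%N => // N _ w wx n n1 nE; exfalso; apply: nn; exists n => //.
by rewrite nE.
Qed.

(** With return gaps at most [N], every orbit point is the image under some [iter i f], [i <= N], of
    a point of a fixed closed ball in [U]; finitely many images of the ball cover the orbit. *)
Lemma orbit_compact a (t : nat -> nat) : U a -> (forall j, (j <= t j)%N) ->
  cvC \oo (fun j => iter (t j) f a) a ->
  exists K : set (CC R), [/\ compact K, K `<=` U & forall n, K (iter n f a)].
Proof.
move=> Ua tj ta; have [r r0 rU] := comp_open Ucomp Ua.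
pose d := r / 2; have d0 : 0 < d by rewrite /d; lra.
have dU z : nm (z - a) <= d -> U z by move=> h; apply: rU; rewrite /d in h; lra.
have [N NP] := return_times_gap Ua d0 dU tj ta.
have back m : exists2 i, (i <= N)%N & (i <= m)%N /\ nm (iter (m - i) f a - a) <= d.
  have ex : exists n, (m <= n)%N && (nm (iter n f a - a) <= d).
    have [J _ JP] := ta _ d0; exists (t (maxn J m)).
    rewrite (leq_trans (leq_maxr J m) (tj _)) /=.
    by apply: ltW; apply: JP; exact: leq_maxl.
  (* [n] is the first visit to the ball from time [m] on. Going back by a gap [l] lands, by
     minimality, on a visit before [m], or else [m] itself is less than [N]. *)
  have := ex_minnP ex => -[n /andP[mn nd] nmin].
  have [mE|mn'] := eqVneq m n; first by exists 0%N; rewrite // subn0 mE.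
  have {mn'}mn : (m < n)%N by rewrite ltn_neqAle mn' mn.
  have n0 : (0 < n)%N by exact: leq_ltn_trans mn.
  have [l /andP[l0 lN] ln] := NP n n0 nd.
  have [{}ln'|ln'] := leqP l n; last first.
    exists m => //; first by apply: ltnW; apply: leq_trans lN; exact: ltn_trans ln'.
    by rewrite subnn /= subrr nm0 ltW.
  have h := ln ln'.
  have lt : (n - l < m)%N.
    rewrite ltnNge; apply/negP => mnl; have := nmin (n - l)%N.
    by rewrite mnl h => /(_ isT); rewrite leqNgt ltn_subrL l0 n0.
  exists (m - (n - l))%N; first by lia.
  by split; [exact: leq_subr|rewrite subKn // ltnW].
have [K [cK KU KP]] : exists K : set (CC R), [/\ compact K, K `<=` U &
    forall i y, (i <= N)%N -> nm (y - a) <= d -> K (iter i f y)].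
  elim: (N) => [|n [K [cK KU KP]]].
    exists [set w | nm (w - a) <= d]; split; [exact: closed_ball_compact|by move=> w /dU|].
    by move=> i y; rewrite leqn0 => /eqP->.
  exists (K `|` (iter n.+1 f @` [set w | nm (w - a) <= d])); split.
  - apply: compactU => //; apply: compact_image; last exact: closed_ball_compact.
    by move=> x _; exact: iter_cont.
  - by move=> w [/KU//|[y /= /dU yU <-]]; exact: (iter_U n.+1).
  - move=> i y; rewrite leq_eqVlt => /orP[/eqP-> yd|]; first by right; exists y.
    by rewrite ltnS => iN yd; left; exact: KP.
exists K; split=> // n; have [i iN [im h]] := back n.
by have := KP i _ iN h; rewrite -iterD subnKC.
Qed.

Lemma bdd_U a : U a -> bdd f a -> forall z, U z -> bdd f z.
Proof.
move=> Ua ba; apply: (connected_ind (comp_connected Ucomp)).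
- by exists a.
- move=> x Ux bx; have [r r0 rP] := Fatou_bdd (comp_Fatou Ucomp Ux).
  by exists r => // w _ wr; apply: (rP x) => //; rewrite subrr nm0.
- move=> x Ux bx; have [r r0 rP] := Fatou_bdd (comp_Fatou Ucomp Ux).
  by exists r => // w _ wr bw; apply: bx; apply: (rP w) => //; rewrite subrr nm0.
Qed.

Lemma locally_bdd z : U z -> bdd f z -> exists r M, [/\ 0 < r, 0 <= M &
  forall n w, nm (w - z) < r -> nm (iter n f w) <= M].
Proof.
move=> Uz [M zM]; have [r r0 rP] := Fatou_equicont fh M (comp_Fatou Ucomp Uz) ltr01.
have M0 : 0 <= M by exact: le_trans (nm_ge0 _) (zM 0%N).
exists r, (M + 1); split=> //; first by lra.
move=> n w wr; have ex : exists2 w, nm (w - z) < r & nm (iter n f w) <= M.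
  by exists z; rewrite ?subrr ?nm0.
have := rP n ex w wr; have := zM n; have := nm_lerB (iter n f w) (iter n f z); lra.
Qed.

End Recurrence.

(** * Nonconstant limit functions *)

Section NonconstantLimit.
Variable R : realType.
Variable f : CC R -> CC R.
Hypothesis fh : forall z, cdiff f z (der f z).
Variable U : set (CC R).
Hypothesis Ucomp : Fatou_component f U.
Hypothesis UI : forall z, U z -> U (f z).
Implicit Types (z w x y a b : R[i]) (r e M : R) (m n j : nat).
Variables (s : nat -> nat) (phi : CC R -> CC R).
Hypothesis sh : {homo s : i j / (i < j)%N}.
Hypothesis sphi : loc_unif_cvg U (iterates f \o s) (Some phi).

Lemma limit_pointwise z : U z -> cvC \oo (fun n => iter (s n) f z) (phi z).
Proof.
move=> Uz e e0; have [r r0 /(_ e e0)] := (luc_Some _ _ _).1 sphi z Uz.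
by apply: filterS => n /(_ z); rewrite subrr nm0; exact.
Qed.

Lemma limit_diff z : U z -> cdiff phi z (der phi z).
Proof.
move=> Uz; have [r r0 /(_ _ ltr01)[N _ NP]] := (luc_Some _ _ _).1 sphi z Uz.
have [q q0 qU] := comp_open Ucomp Uz.
have [p p0 pP] := iter_cont fh (s N) z ltr01.
pose t := Num.min r (Num.min q p).
have t0 : 0 < t by rewrite !lt_min r0 q0 p0.
have tP w : nm (w - z) < t -> [/\ nm (w - z) < r, U w & nm (w - z) < p].
  by rewrite !lt_min => /and3P[? /qU ? ?].
have [||d hd _] := @limit_cdiff _ nat \oo _ (fun n => iter (s n) f) phi z t
    (nm (iter (s N) f z) + 3) t0.
- exists N => // n /= Nn; split=> [w _|w /tP[wr Uw wp]]; first exact: iter_diff.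
  have h1 := NP N (leqnn N) w wr Uw; have h2 := NP n Nn w wr Uw; have h3 := pP w wp.
  rewrite /= /iterates in h1 h2.
  have := nm_lerB (iter (s n) f w) (phi w); have := nm_lerB (phi w) (iter (s N) f w).
  have := nm_lerB (iter (s N) f w) (iter (s N) f z).
  by rewrite [nm (phi w - _)]nm_distC; lra.
- by move=> w /tP[_ Uw _]; exact: limit_pointwise.
exact: cdiff_der hd.
Qed.

Hypothesis nonconst : exists x y, [/\ U x, U y & phi x <> phi y].

Lemma limit_der_neq0 : exists2 z, U z & der phi z != 0.
Proof.
apply: contrapT => nex; have d0 z : U z -> der phi z = 0.
  by move=> Uz; apply/eqP/negPn/negP => dz; apply: nex; exists z.
have locconst x w r : 0 < r -> (forall w, nm (w - x) < r -> U w) -> nm (w - x) < r ->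
    phi w = phi x.
  move=> r0 rU wr; apply/eqP; rewrite -subr_eq0 -nm_eq0; apply/eqP/le_anti.
  rewrite nm_ge0 andbT -(mul0r (nm (w - x))).
  apply: (@mean_value_ball _ phi x r) => //; last by rewrite subrr nm0.
    by move=> v /rU; exact: limit_diff.
  by move=> v /rU /d0 ->; rewrite nm0.
have [x [y [Ux Uy]]] := nonconst; apply; apply/esym.
move: (y) Uy; apply: (connected_ind (comp_connected Ucomp)); first by exists x.
- move=> v Uv vx; have [r r0 rU] := comp_open Ucomp Uv.
  by exists r => // w _ wr; rewrite /= -vx; exact: (locconst _ _ r).
- move=> v Uv vx; have [r r0 rU] := comp_open Ucomp Uv.
  by exists r => // w _ wr wx; apply: vx; rewrite -wx; apply/esym/(locconst _ _ r).
Qed.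

(** If [phi] omitted [b] near [z], then [1 / (phi - b)] would be holomorphic there. On a contour of
    half side [t] the derivative keeps [nm (phi w - b)] above [c * t / 4], so [center_est] forces
    [nm (phi z - b)] to be at least [c * t / 8]. *)
Lemma limit_open z : U z -> der phi z != 0 -> exists r e, [/\ 0 < r, 0 < e &
  forall b, nm (b - phi z) < e -> exists w, [/\ nm (w - z) <= r, U w & phi w = b]].
Proof.
move=> Uz dz; have c0 : 0 < nm (der phi z) by rewrite nm_gt0.
set c := nm _ in c0; have c2 : 0 < c / 2 by lra.
have [q q0 qU] := comp_open Ucomp Uz.
have [p p0 pP] := (cdiffP _ _ _).1 (limit_diff Uz) _ c2.
pose t := Num.min q p / 3.
have t0 : 0 < t by rewrite divr_gt0 // lt_min q0 p0.
have tP w : nm (w - z) <= 2 * t -> U w /\ nm (w - z) < p.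
  move=> wt; have tq : 3 * t <= q by rewrite mulrC divfK // ge_min lexx.
  have tp : 3 * t <= p by rewrite mulrC divfK // ge_min lexx orbT.
  by split; [apply: qU|]; lra.
have ct : 0 < c * t by rewrite mulr_gt0.
exists (2 * t), (c * t / 8); split; [lra|lra|].
move=> b bz; apply: contrapT => /forallNP nb.
have pb w : nm (w - z) <= 2 * t -> phi w - b != 0.
  by move=> wt; apply/eqP => /subr0_eq pw; apply: (nb w); have [] := tP w wt.
have zz : nm (z - z) <= 2 * t by rewrite subrr nm0; lra.
have dw w : nm (w - z) <= 2 * t -> cdiff (fun w => (phi w - b)^-1) w
    (- (der phi w - 0) / (phi w - b) ^+ 2).
  move=> wt; apply: (@cdiffV _ (fun w => phi w - b)); first exact: pb.
  by apply: cdiffB; [exact: limit_diff (tP w wt).1|exact: cdiff_cst].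
have : nm (phi z - b)^-1 <= 2 * (4 / (c * t)).
  apply: (@center_est _ (fun w => (phi w - b)^-1) z t _ t0).
  - exact: cdiff_cont (dw z zz).
  - by move=> w _ wt; eexists; exact: dw.
  move=> w /andP[w1 w2]; have [Uw wp] := tP w w2.
  have := pP w wp; set D := phi w - _ - _ => hD.
  have E : der phi z * (w - z) = (phi w - phi z) - D by rewrite /D; ring.
  have h1 : c * nm (w - z) <= nm (phi w - phi z) + c / 2 * nm (w - z).
    by rewrite -nmM E; apply: le_trans (nmB _ _) _; rewrite lerD2l.
  have h2 : c * t <= c * nm (w - z) by rewrite ler_pM2l.
  have h3 := nm_tri b (phi w) (phi z).
  have h4 : c * t / 4 <= nm (phi w - b) by lra.
  have h5 : 0 < nm (phi w - b) by rewrite nm_gt0; exact: pb.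
  by rewrite nmV -[4 / _]invrK invf_div lef_pV2 ?posrE // !divr_gt0.
rewrite nmV -[leRHS]invrK lef_pV2 ?posrE ?nm_gt0 ?pb //.
  have -> : (2 * (4 / (c * t)))^-1 = c * t / 8 by field; rewrite !gt_eqF.
  by rewrite nm_distC; lra.
by rewrite invr_gt0 mulr_gt0 // divr_gt0.
Qed.

Lemma homo_add i j : (s i + j <= s (i + j))%N.
Proof.
elim: j => [|j IH]; first by rewrite !addn0.
by rewrite !addnS; apply: leq_ltn_trans IH (sh _).
Qed.

(** With [t j = s (j + j) - s j], the iterate of order [t j] carries [iter (s j) f w] to
    [iter (s (j + j)) f w], and both are close to [phi w]; equicontinuity at [x = phi w] makes it
    nearly fix [x]. As [phi z] itself might lie on the boundary of [U], the base point is an iterate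
    of [z] close to [phi z], where all points are still values of [phi]. *)
Lemma local_recurrence : exists t : nat -> nat, (forall j, (j <= t j)%N) /\
  exists2 a, U a & exists2 r, 0 < r &
    forall x, nm (x - a) < r -> cvC \oo (fun j => iter (t j) f x) x.
Proof.
have [z Uz dz] := limit_der_neq0.
have [q [e [q0 e0 qP]]] := limit_open Uz dz.
have tE j : (s (j + j) - s j + s j)%N = s (j + j)%N.
  by rewrite subnK //; apply: leq_trans (homo_add j j); exact: leq_addr.
exists (fun j => (s (j + j) - s j)%N); split.
  by move=> j; have := homo_add j j; clear; move: (s (j + j)) (s j); lia.
have e2 : 0 < e / 2 by lra.
have [J _ /(_ J (leqnn J)) /= aJ] := limit_pointwise Uz e2.
have Ua : U (iter (s J) f z) by exact: iter_U.
have [p p0 pU] := comp_open Ucomp Ua.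
exists (iter (s J) f z) => //; exists (Num.min p (e / 2)); first by rewrite lt_min p0.
move=> x; rewrite lt_min => /andP[/pU Ux xe].
have [|w [_ Uw wx]] := qP x.
  by apply: le_lt_trans (nm_tri (iter (s J) f z) _ _) _; lra.
have sx := limit_pointwise Uw; rewrite wx in sx.
move=> d d0; have d2 : 0 < d / 2 by lra.
have [r r0 rP] := Fatou_equicont fh (nm x + 1) (comp_Fatou Ucomp Ux) d2.
have m0 : 0 < Num.min (Num.min r 1) (d / 2) by rewrite !lt_min r0 ltr01 d2.
have [N _ NP] := sx _ m0; exists N => // j /= Nj.
have := NP j Nj; rewrite /= !lt_min => /andP[/andP[jr _] _].
have := NP (j + j)%N (leq_trans Nj (leq_addr _ _)); rewrite /= !lt_min.
move=> /andP[/andP[_ j1] jd].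
have E : iter (s (j + j) - s j) f (iter (s j) f w) = iter (s (j + j)) f w.
  by rewrite -iterD tE.
have ex : exists2 w, nm (w - x) < r & nm (iter (s (j + j) - s j) f w) <= nm x + 1.
  by exists (iter (s j) f w) => //; rewrite E; have := nm_lerB (iter (s (j + j)) f w) x; lra.
have := rP _ ex _ jr; rewrite E => h.
have := nm_tri (iter (s (j + j)) f w) (iter (s (j + j) - s j) f x) x.
by rewrite nm_distC in h; lra.
Qed.

Lemma recurrence : exists t : nat -> nat, [/\ forall j, (j <= t j)%N, locbdd f U,
  forall z, U z -> cvC \oo (fun j => iter (t j) f z) z &
  exists a K, [/\ U a, compact K, K `<=` U & forall n, K (iter n f a)]].
Proof.
have [t [tj [a Ua [r r0 ta]]]] := local_recurrence.
have taa : cvC \oo (fun j => iter (t j) f a) a by apply: ta; rewrite subrr nm0.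
have [K [cK KU Ka]] := orbit_compact fh Ucomp UI Ua tj taa.
have [B B0 KB] := compact_nm_bounded cK.
have ba : bdd f a by exists B => n; exact: KB.
have lb : locbdd f U.
  by move=> z Uz; apply: (locally_bdd fh Ucomp Uz); exact: (bdd_U Ucomp Ua ba).
exists t; split=> //; last by exists a, K.
apply: (vitali_id fh (comp_connected Ucomp) lb).
by exists a => //; exists r.
Qed.

End NonconstantLimit.

(** * The union of the component and the hull *)

Section Filling.
Variable R : realType.
Implicit Types (f : CC R -> CC R) (z w x y a p : R[i]) (r e M d : R) (m n j q : nat).
Implicit Types (U K L : set (CC R)).

Lemma compact_thickening (C : set (CC R)) U : compact C -> C !=set0 -> C `<=` U ->
  (forall z, U z -> exists2 r, 0 < r & forall w, nm (w - z) < r -> U w) ->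
  exists2 d, 0 < d & exists L, [/\ compact L, L `<=` U &
    forall x w, C x -> nm (w - x) <= d -> L w].
Proof.
move=> cC [x0 Cx0] CU Uo.
have [N _ /(_ N (leqnn N)) NP] : \forall n \near \oo, forall x, C x ->
    forall w, nm (w - x) < 1 / n.+1%:R -> U w.
  apply: (@compact_uniform _ C _ _ (fun n x => forall w, nm (w - x) < 1 / n.+1%:R -> U w)) => //.
  move=> x Cx; have [r r0 rU] := Uo x (CU x Cx); have r2 : 0 < r / 2 by lra.
  exists (r / 2) => //; apply: filterS (inv_succ_cvg 1 r2) => n /= nr y yx w wy.
  apply: rU; apply: le_lt_trans (nm_tri y _ _) _.
  by move: (1 / _) nr wy => u; lra.
pose d : R := 1 / N.+1%:R / 2.
have d0 : 0 < d by rewrite !divr_gt0.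
have dU x w : C x -> nm (w - x) <= d -> U w.
  move=> Cx wd; apply: (NP x Cx); apply: le_lt_trans wd _.
  by rewrite ltr_pdivrMr // mulr_natr mulr2n ltrDl divr_gt0.
pose L : set (CC R) := [set w | exists2 x, C x & nm (w - x) <= d].
exists d => //; exists L; split; [|by move=> w [x Cx /(dU x w Cx)]|by move=> x w; exists x].
have [B B0 CB] := compact_nm_bounded cC.
apply: (@compactC _ _ (B + d)) => [w [x /CB xB wx]|z zL].
  by have := nm_lerB w x; lra.
have [|c Cc cP] := @compact_max _ C (fun x => - nm (x - z)) cC (ex_intro _ x0 Cx0).
  move=> x Cx e e0.
  have [s s0 sP] := nm_ccont (ccontB (ccont_id x) (ccont_cst z x)) e0.
  by exists s => // w /sP; rewrite -opprD normrN.
exists c => //; rewrite nm_distC; apply/ler_addgt0Pl => e e0.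
have [w [x Cx wx] wz] := zL e e0.
have := cP x Cx; have := nm_tri w x z; rewrite [nm (x - w)]nm_distC; lra.
Qed.

Lemma iter_lip f U : (forall z, cdiff f z (der f z)) -> locbdd f U ->
  forall z, U z -> exists r C, [/\ 0 < r, 0 <= C &
  forall n w w', nm (w - z) < r -> nm (w' - z) < r ->
    nm (iter n f w' - iter n f w) <= C * nm (w' - w)].
Proof.
move=> fh lb z Uz; have [r [M [r0 M0 rM]]] := lb z Uz.
exists (r / 2), (8 * M / (r / 2)); split; first by lra.
  by apply: divr_ge0; [exact: mulr_ge0|lra].
have r2 : 2 * (r / 2) = r by field.
move=> n w w'; apply: lip_ball; rewrite ?r2; first by lra.
  by move=> v _; exact: iter_diff.
exact: rM.
Qed.

Lemma recurrence_uniform f U (t : nat -> nat) L e :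
  (forall z, cdiff f z (der f z)) -> locbdd f U ->
  (forall z, U z -> cvC \oo (fun j => iter (t j) f z) z) ->
  compact L -> L `<=` U -> 0 < e ->
  \forall j \near \oo, forall w, L w -> nm (iter (t j) f w - w) <= e.
Proof.
move=> fh lb ta cL LU e0.
apply: (@compact_uniform _ L _ _ (fun j w => nm (iter (t j) f w - w) <= e)) => // x Lx.
have [r [C [r0 C0 rC]]] := iter_lip fh lb (LU x Lx).
have C1 : 0 < C + 1 by lra.
exists (Num.min r (e / 2 / (C + 1))); first by rewrite lt_min r0 !divr_gt0.
have e2 : 0 < e / 2 by lra.
apply: filterS (ta x (LU x Lx) _ e2) => j jx w; rewrite lt_min => /andP[wr].
rewrite ltr_pdivlMr // => we.
have xr : nm (x - x) < r by rewrite subrr nm0.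
have := rC (t j) x w xr wr; have := nm_tri (iter (t j) f x) (iter (t j) f w) w.
have := nm_tri x (iter (t j) f x) w; rewrite [nm (x - w)]nm_distC.
have := nm_ge0 (w - x); nra.
Qed.

Section Hull.
Variables (f : CC R -> CC R) (U K L : set (CC R)).
Hypothesis fh : forall z, cdiff f z (der f z).
Hypothesis Uo : forall z, U z -> exists2 r, 0 < r & forall w, nm (w - z) < r -> U w.
Hypothesis Uc : connected U.
Hypothesis lb : locbdd f U.
Hypotheses (cK : compact K) (cL : compact L) (LU : L `<=` U).
Hypothesis Kint : forall z, K z -> ~ L z ->
  exists2 r, 0 < r & forall w, nm (w - z) < r -> K w.

Lemma entire_max g M : (forall z, cdiff g z (der g z)) ->
  (forall z, L z -> nm (g z) <= M) -> forall z, K z -> nm (g z) <= M.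
Proof.
move=> gh gL; apply: (@max_principle _ K L g M cK) => [z _||z _ /gL//].
  by exists 1 => // w _; exact: gh.
exact: Kint.
Qed.

(** The hull may leave [U], but iterates are entire, so their common bound on [L] holds on [K] by
    the maximum principle. *)
Lemma iter_bounded_hull : exists2 M, 0 <= M & forall n w, K w -> nm (iter n f w) <= M.
Proof.
have [N _ /(_ N (leqnn N)) NP] : \forall N \near \oo, forall w, L w ->
    forall n, nm (iter n f w) <= N%:R.
  apply: (@compact_uniform _ L _ _ (fun N w => forall n, nm (iter n f w) <= N%:R)) => //.
  move=> x Lx; have [r [M [r0 M0 rM]]] := lb (LU Lx).
  exists r => //; exists (Num.bound M) => // n /= Mn w wr k.
  apply: le_trans (rM k w wr) _; apply: ltW.
  by apply: lt_le_trans (archi_boundP M0) _; rewrite ler_nat.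
exists N%:R => // n; apply: entire_max => [z|z Lz]; first exact: iter_diff.
exact: NP.
Qed.

Lemma hull_open z : (U `|` K) z ->
  exists2 r, 0 < r & forall w, nm (w - z) < r -> (U `|` K) w.
Proof.
case=> [/Uo[r r0 rU]|Kz]; first by exists r => // w /rU; left.
have [/LU/Uo[r r0 rU]|nL] := pselect (L z); first by exists r => // w /rU; left.
by have [r r0 rK] := Kint Kz nL; exists r => // w /rK; right.
Qed.

Lemma hull_locbdd : locbdd f (U `|` K).
Proof.
move=> z [/lb//|Kz]; have [/LU/lb//|nL] := pselect (L z).
have [r r0 rK] := Kint Kz nL; have [M M0 KM] := iter_bounded_hull.
by exists r, M; split=> // n w /rK; exact: KM.
Qed.

(** Otherwise [A] would lie in [K] and be both compact and open, which its point of greatest real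
    part forbids. Applied to a clopen set and to its complement, this reduces connectedness of the
    union to that of [U]. *)
Lemma clopen_meets (A : set (CC R)) : A !=set0 -> A `<=` U `|` K ->
  (forall x, A x -> exists2 r, 0 < r & forall w, nm (w - x) < r -> A w) ->
  (forall x, (U `|` K) x -> ~ A x ->
     exists2 r, 0 < r & forall w, nm (w - x) < r -> ~ A w) ->
  exists2 x, U x & A x.
Proof.
move=> [a Aa] AUK Ao Ac; apply: contrapT => nU.
have AK : A `<=` K by move=> x Ax; have [Ux|//] := AUK x Ax; case: nU; exists x.
have cA : compact A.
  by apply: (compact_sub cK AK) => x Kx nA; apply: Ac => //; right.
have [|c Ac' cP] := @compact_max _ A (fun w => Re w) cA (ex_intro _ a Aa).
  move=> x _ e e0; exists e => // w; apply: le_lt_trans; apply: le_trans (Re_le_nm _).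
  by case: w x => [? ?] [? ?].
have [r r0 rA] := Ao c Ac'; have r2 : 0 < r / 2 by lra.
have /cP : A (c + (r / 2)%:C).
  apply: rA; rewrite (_ : _ - c = (r / 2)%:C); last by ring.
  by rewrite nm_real gtr0_norm //; lra.
by case: (c) => u v /=; lra.
Qed.

Lemma hull_connected : connected (U `|` K).
Proof.
move=> B B0 [C1 oC1 BC1] [C2 cC2 BC2].
have interE (P : set (CC R)) x : open P -> P x ->
    exists2 r, 0 < r & forall w, nm (w - x) < r -> P w.
  by rewrite openE => oP /oP /nbhs_nmP.
have Bo x : B x -> exists2 r, 0 < r & forall w, nm (w - x) < r -> B w.
  rewrite BC1 => -[/hull_open[r r0 rUK] /(interE _ _ oC1)[s s0 sC]].
  exists (Num.min r s) => [|w]; first by rewrite lt_min r0.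
  by rewrite lt_min => /andP[/rUK ? /sC ?].
have Bc x : (U `|` K) x -> ~ B x ->
    exists2 r, 0 < r & forall w, nm (w - x) < r -> ~ B w.
  move=> UKx; rewrite BC2 => nB; have nC : (~` C2) x by move=> C2x; apply: nB.
  have [r r0 rC] := interE _ _ (closed_openC cC2) nC.
  by exists r => // w /rC nCw [].
have [x Ux Bx] : exists2 x, U x & B x.
  by apply: clopen_meets => // x; rewrite BC1 => -[].
have UB : U `<=` B.
  apply: (connected_ind Uc); first by exists x.
  - by move=> w Uw /Bo[r r0 rB]; exists r => // v _ /rB.
  - by move=> w Uw /(Bc w (or_introl Uw))[r r0 rB]; exists r => // v _ /rB.
apply/seteqP; split=> [w|w UKw]; first by rewrite BC1 => -[].
apply: contrapT => nBw.
have [y Uy [_ nBy]] : exists2 y, U y & ((U `|` K) `&` ~` B) y.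
  apply: clopen_meets.
  - by exists w.
  - by move=> v [].
  - move=> v [UKv nBv]; have [r r0 rUK] := hull_open UKv; have [s s0 sB] := Bc v UKv nBv.
    exists (Num.min r s) => [|u]; first by rewrite lt_min r0.
    by rewrite lt_min => /andP[/rUK ? /sB ?].
  - move=> v UKv nn; have /Bo[r r0 rB] : B v.
      by apply: contrapT => nBv; apply: nn.
    by exists r => // u /rB Bu [].
exact: nBy (UB y Uy).
Qed.

End Hull.

(** [fixed_point_in_hull] is applied to an iterate close to the identity on a thickening [L] of the
    compact set containing the orbit of [a], with that orbit as the invariant set. *)
Lemma periodic_point f U (C : set (CC R)) (t : nat -> nat) a :
  (forall z, cdiff f z (der f z)) ->
  (forall z, U z -> exists2 r, 0 < r & forall w, nm (w - z) < r -> U w) ->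
  locbdd f U -> (forall j, (j <= t j)%N) ->
  (forall z, U z -> cvC \oo (fun j => iter (t j) f z) z) ->
  compact C -> C `<=` U -> (forall n, C (iter n f a)) ->
  exists K L, [/\ compact K, compact L, L `<=` U &
   (forall z, K z -> ~ L z -> exists2 r, 0 < r & forall w, nm (w - z) < r -> K w) /\
   exists q p, [/\ (0 < q)%N, K p & iter q f p = p]].
Proof.
move=> fh Uo lb tj ta cC CU Ca.
have [d d0 [L [cL LU CL]]] := compact_thickening cC (ex_intro _ a (Ca 0%N)) CU Uo.
have [K [cK LK Kint Kgood]] := hull_exists cL.
exists K, L; split=> //; split=> //.
(* By Cauchy's estimate on discs of radius [d / 2], [iter q f - id] then has Lipschitz constant 1/4,
   as [fixed_point_in_hull] demands. *)
have e0 : 0 < d / 64 by lra.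
have [N _ NP] := recurrence_uniform fh lb ta cL LU e0.
(* The successor guarantees [0 < q], because [j <= t j]. *)
pose q := t N.+1; exists q.
have [||||p Kp pq] := @fixed_point_in_hull _ (iter q f) K L [set iter n f a | n in setT]
    cK cL LK Kgood; last by exists p; split=> //; exact: leq_trans (tj _).
- by move=> z; exact: iter_diff.
- by exists a; exists 0%N.
- by move=> _ [n _ <-]; exists (q + n)%N => //; rewrite iterD.
move=> w s [n _ <-] /andP[s0 s1]; set u := iter n f a.
have Lv v : nm (v - u) <= d -> L v by apply: CL; exact: Ca.
have De v : nm (v - u) <= d -> nm (iter q f v - v) <= d / 64.
  by move=> /Lv; apply: NP; exact: leqnSn.
have uu : nm (u - u) <= d by rewrite subrr nm0 ltW.
set x := u + _; have xu : x - u = (iter q f u - u) * s%:C by rewrite /x; ring.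
have nxu : nm (x - u) <= nm (iter q f u - u).
  by rewrite xu nm_scaled ger0_norm // ler_piMr ?nm_ge0.
have Du := De u uu; split; first by apply: Lv; lra.
have d2 : 0 < d / 2 by lra.
have dd : 2 * (d / 2) = d by field.
have E : 8 * (d / 64) / (d / 2) = 4^-1 by field; rewrite gt_eqF.
apply: le_trans (_ : 8 * (d / 64) / (d / 2) * nm (x - u) <= _); last first.
  by rewrite E mulrC ler_pM2r ?invr_gt0.
apply: (@lip_ball _ (fun v => iter q f v - v) u (d / 2) (d / 64)) => //.
- move=> v _; apply: (cdiff_der (d := der (iter q f) v - 1)).
  by apply: cdiffB; [exact: iter_diff|exact: cdiff_id].
- by move=> v; rewrite dd => /ltW; exact: De.
- by rewrite subrr nm0.
- by lra.
Qed.

End Filling.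

(** * The multiplier of the fixed point *)

Section FixedPoint.
Variable R : realType.
Implicit Types (f : CC R -> CC R) (z w x y a p : R[i]) (r e M d : R) (m n j q N : nat).
Implicit Types (U K L : set (CC R)).

(** By the identity theorem the iterate would be the identity everywhere, hence injective, whereas
    [f c = f 0]. *)
Lemma not_locally_id f n z r : (forall z, cdiff f z (der f z)) ->
  (exists c, c != 0 /\ forall z, f (z + c) = f z) -> (0 < n)%N -> 0 < r ->
  ~ (forall w, nm (w - z) < r -> iter n f w = w).
Proof.
move=> fh [c [c0 fc]] n0 r0 Hid.
have glob w : iter n f w = w.
  pose s := nm (w - z) + 1; have s0 : 0 < s by rewrite ltr_wpDl ?nm_ge0.
  pose F v := iter n f v - v.
  have Fh v : cdiff F v (der F v).
    by apply: (cdiff_der (d := der (iter n f) v - 1)); apply: cdiffB;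
      [exact: iter_diff|exact: cdiff_id].
  have K0 : [set v : CC R | nm (v - z) <= 8 * s] !=set0.
    by exists z => /=; rewrite subrr nm0 mulr_ge0 // ltW.
  have [|b _ bP] := @compact_max _ _ (fun v => nm (F v)) (@closed_ball_compact R z (8 * s)) K0.
    by move=> x _; apply: nm_ccont; exact: cdiff_cont (Fh x).
  apply/subr0_eq; apply: (@identity_local _ F z s (nm (F b)) s0).
  - by move=> v _; exact: Fh.
  - by move=> v vs; apply: bP; exact: ltW.
  - by exists r => // v /Hid vE; rewrite /F vE subrr.
  - by rewrite /s; lra.
case: n n0 glob {Hid} => // n _ glob.
have := glob c; rewrite iterSr -[c in f c]add0r fc -iterSr glob => /esym cE.
by rewrite cE eqxx in c0.
Qed.

Lemma mean_bound N (u : nat -> R[i]) M : (forall n, nm (u n) <= M) ->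
  nm (N.+1%:R^-1 * \sum_(n < N.+1) u n) <= M.
Proof.
move=> uM; rewrite nmM nmV nm_nat mulrC ler_pdivrMr //.
apply: le_trans (nm_sum _ _ _) _.
apply: (@le_trans _ _ (\sum_(n < N.+1) M)); first by apply: ler_sum => i _; exact: uM.
by rewrite sumr_const card_ord -[leLHS]mulr_natr.
Qed.

(** The Cesaro means of the iterates whose orders run through [m], [q + m], [2 q + m] and so on. *)
Definition avg f q m N z := N.+1%:R^-1 * \sum_(n < N.+1) iter (q * n + m) f z.

Section Average.
Variables (f : CC R -> CC R) (q m : nat).
Hypothesis fh : forall z, cdiff f z (der f z).

Lemma avg_diff N z : cdiff (avg f q m N) z (der (avg f q m N) z).
Proof.
apply: (cdiff_der (d := N.+1%:R^-1 * \sum_(n < N.+1) der (iter (q * n + m) f) z)).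
by apply: cdiffZ; apply: (@cdiff_sum _ _ _ (fun n : 'I_N.+1 => iter (q * n + m) f)) => n;
  exact: iter_diff.
Qed.

Lemma avg_shift N z : avg f q m N (iter q f z) - avg f q m N z =
  N.+1%:R^-1 * (iter (q * N.+1 + m) f z - iter m f z).
Proof.
rewrite /avg -mulrBr; congr (_ * _).
under eq_bigr => n _ do rewrite -iterD addnAC -mulnSr.
rewrite big_ord_recr [X in _ - X]big_ord_recl /= muln0 add0n.
under [X in _ - (_ + X)]eq_bigr => n _ do rewrite /bump /= add1n.
by rewrite opprD addrA addrAC; congr (_ - _); rewrite addrAC subrr add0r.
Qed.

Lemma avg_fixed N p : iter q f p = p -> avg f q m N p = iter m f p.
Proof.
move=> pq; have pn n : iter (q * n + m) f p = iter m f p.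
  rewrite addnC iterD; congr iter; elim: n => [|n IH]; first by rewrite muln0.
  by rewrite mulnSr iterD pq.
rewrite /avg (eq_bigr (fun _ => iter m f p)) => [|n _]; last exact: pn.
by rewrite sumr_const card_ord -[X in _ * X]mulr_natr mulrCA mulVf ?mulr1 // pnatr_eq0.
Qed.

Lemma avg_bound U : locbdd f U -> forall z, U z -> exists r M, [/\ 0 < r, 0 <= M &
  forall N w, nm (w - z) < r -> nm (avg f q m N w) <= M].
Proof.
move=> lb z /lb[r [M [r0 M0 rM]]]; exists r, M; split=> // N w wr.
by apply: (@mean_bound N (fun n => iter (q * n + m) f w)) => n; exact: rM.
Qed.

Lemma avg_lip U : locbdd f U -> forall z, U z -> exists r C, [/\ 0 < r, 0 <= C &
  forall N w, nm (w - z) < r -> nm (avg f q m N w - avg f q m N z) <= C * nm (w - z)].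
Proof.
move=> lb z /(iter_lip fh lb)[r [C [r0 C0 rC]]]; exists r, C; split=> // N w wr.
rewrite /avg -mulrBr -sumrB.
apply: (@mean_bound N (fun n => iter (q * n + m) f w - iter (q * n + m) f z)) => n.
by apply: rC => //; rewrite subrr nm0.
Qed.

End Average.

Section Domain.
Variables (f : CC R -> CC R) (U : set (CC R)) (t : nat -> nat) (q : nat).
Hypothesis fh : forall z, cdiff f z (der f z).
Hypothesis fper : exists c, c != 0 /\ forall z, f (z + c) = f z.
Hypothesis Uo : forall z, U z -> exists2 r, 0 < r & forall w, nm (w - z) < r -> U w.
Hypothesis Uc : connected U.
Hypothesis UI : forall z, U z -> U (f z).
Hypothesis lb : locbdd f U.
Hypothesis tj : forall j, (j <= t j)%N.
Hypothesis ta : forall z, U z -> cvC \oo (fun j => iter (t j) f z) z.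
Hypothesis q0 : (0 < q)%N.

(** The Lipschitz constant near [z] is the same for all iterates, so one further block of [t j]
    steps moves the result by little. *)
Lemma recurrence_mul i z : U z -> cvC \oo (fun j => iter (i * t j) f z) z.
Proof.
move=> Uz; elim: i => [|i IH]; first exact: cvC_cst.
have [r [C [r0 C0 rC]]] := iter_lip fh lb Uz.
move=> e e0; have e2 : 0 < e / 2 by lra.
have C1 : 0 < C + 1 by lra.
have m0 : 0 < Num.min r (e / 2 / (C + 1)) by rewrite lt_min r0 !divr_gt0.
apply: filterS2 (IH _ e2) (ta Uz m0) => j h1.
rewrite lt_min => /andP[h2]; rewrite ltr_pdivlMr // => h3.
have zr : nm (z - z) < r by rewrite subrr nm0.
have := rC (i * t j)%N z _ zr h2; rewrite -iterD -mulSnr => h4.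
have := nm_tri (iter (i * t j) f z) (iter (i.+1 * t j) f z) z.
have := nm_ge0 (iter (t j) f z - z); nra.
Qed.

(* The limit [P] of the means satisfies [P (iter (q * t j) f w) = P w]: as
   [iter (q * t j) f w] tends to [w], [P] is not injective near [w], for then some
   iterate of [f] would be the identity there. *)
Lemma average_const m (G : set_system nat) : UltraFilter G -> (\oo : set_system nat) `<=` G ->
  exists c, forall z, U z -> cvC G (avg f q m ^~ z) c.
Proof.
move=> UG oG; have PG : ProperFilter G by exact: ultra_proper.
have [[z0 Uz0]|U0] := pselect (exists z, U z); last first.
  by exists 0 => z Uz; case: U0; exists z.
have /choice[P PP] : forall z, exists l, U z -> cvC G (avg f q m ^~ z) l.
  move=> z; have [Uz|nUz] := pselect (U z); last by exists 0.
  have [r [M [r0 M0 rM]]] := avg_bound q m lb Uz.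
  have [|l hl] := @ultra_cvC _ _ G (avg f q m ^~ z) M UG; last by exists l.
  by apply: nearW => N; apply: rM; rewrite subrr nm0.
have Ph z : U z -> cdiff P z (der P z).
  move=> Uz; have [r [M [r0 M0 rM]]] := avg_bound q m lb Uz.
  have [s s0 sU] := Uo Uz.
  have p0 : 0 < Num.min r s by rewrite lt_min r0.
  have [||d hd _] := @limit_cdiff _ nat G PG (avg f q m) P z _ M p0.
  - apply: nearW => N; split=> [w _|w]; first exact: avg_diff.
    by rewrite lt_min => /andP[/rM].
  - by move=> w; rewrite lt_min => /andP[_ /sU]; exact: PP.
  exact: cdiff_der hd.
have Pq z : U z -> P (iter q f z) = P z.
  move=> Uz; have Uq := iter_U UI q Uz.
  apply: (@cvC_uniq _ _ G PG (avg f q m ^~ (iter q f z))); first exact: PP.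
  rewrite -[P z]addr0; apply: (cvC_eq (a := fun N => avg f q m N z +
      (avg f q m N (iter q f z) - avg f q m N z))).
    by apply: nearW => N; rewrite subrKC.
  apply: cvCD; first exact: PP.
  have [r [M [r0 M0 rM]]] := lb Uz.
  apply: cvC_sub oG _ => e e0.
  apply: filterS (inv_succ_cvg (2 * M) e0) => N; apply: le_lt_trans.
  rewrite subr0 avg_shift nmM nmV nm_nat mulrC ler_pM2r ?invr_gt0 //.
  have zz : nm (z - z) < r by rewrite subrr nm0.
  apply: le_trans (nmB _ _) _; have := rM m z zz; have := rM (q * N.+1 + m)%N z zz; lra.
have Pqi i z : U z -> P (iter (q * i) f z) = P z.
  move=> Uz; elim: i => [|i IH]; first by rewrite muln0.
  by rewrite mulnS iterD Pq //; exact: iter_U.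
have dP z : U z -> der P z = 0.
  move=> Uz; apply/eqP/negPn/negP => dz.
  have c0 : 0 < nm (der P z) by rewrite nm_gt0.
  have [s s0 sU] := Uo Uz.
  have PB : holoB P z s by move=> w /sU; exact: Ph.
  have [d2 hd2] := der_diff s0 PB.
  have c2 : 0 < nm (der P z) / 2 by lra.
  have [r r0 rP] := cdiff_cont hd2 c2.
  pose v := Num.min r s; have v0 : 0 < v by rewrite lt_min r0.
  have vP w : nm (w - z) < v -> nm (w - z) < r /\ nm (w - z) < s.
    by rewrite lt_min => /andP.
  have inj x w : nm (x - z) < v -> nm (w - z) < v -> P x = P w -> x = w.
    move=> xv wv Pxw; apply/eqP; rewrite -subr_eq0 -nm_eq0.
    have : nm ((P x - der P z * x) - (P w - der P z * w)) <= nm (der P z) / 2 * nm (x - w).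
      apply: (mean_value (f := fun u => P u - der P z * u)) => s' s'P.
      have uv := nm_segment wv xv s'P; set u := w + _ in uv *.
      have [ur us] := vP u uv; exists (der P u - der P z).
        apply: cdiffB; first exact: PB.
        by rewrite -[X in cdiff _ _ X]mulr1; apply: cdiffZ; exact: cdiff_id.
      exact: ltW (rP u ur).
    rewrite Pxw (_ : _ - _ = - der P z * (x - w)); last by ring.
    rewrite nmM nmN => h; apply/eqP/le_anti; rewrite nm_ge0 andbT leNgt; apply/negP => xw.
    by move: h; rewrite ler_pM2r //; lra.
  have v2 : 0 < v / 2 by lra.
  have v4 : 0 < v / 4 by lra.
  have BU : [set w : CC R | nm (w - z) <= v / 2] `<=` U.
    by move=> w /= wv; apply: sU; have [] := vP w _; lra.
  (* [P] is only known to be invariant under [iter q f], so orders that are multiples of [q] are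
     used. *)
  have [J _ JP] := recurrence_uniform fh lb (recurrence_mul q)
    (@closed_ball_compact R z (v / 2)) BU v4.
  have n0 : (0 < q * t J.+1)%N by rewrite muln_gt0 q0 (leq_trans _ (tj _)).
  apply: (not_locally_id fh fper n0 v2 (z := z)) => w wv.
  have h := JP J.+1 (leqnSn J) w (ltW wv).
  apply: inj; [|by lra|exact: Pqi (BU _ (ltW wv))].
  by apply: le_lt_trans (nm_tri w _ _) _; lra.
exists (P z0) => z Uz; suff <- : P z = P z0 by exact: PP.
have locconst x w r : 0 < r -> (forall w, nm (w - x) < r -> U w) -> nm (w - x) < r ->
    P w = P x.
  move=> r0 rU wr; apply/eqP; rewrite -subr_eq0 -nm_eq0; apply/eqP/le_anti.
  rewrite nm_ge0 andbT -(mul0r (nm (w - x))).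
  apply: (@mean_value_ball _ P x r) => //; last by rewrite subrr nm0.
    by move=> v /rU; exact: Ph.
  by move=> v /rU /dP ->; rewrite nm0.
move: (z) Uz; apply: (connected_ind Uc); first by exists z0.
- move=> v Uv vx; have [r r0 rU] := Uo Uv.
  by exists r => // w _ wr; rewrite /= -vx; exact: (locconst _ _ r).
- move=> v Uv vx; have [r r0 rU] := Uo Uv.
  by exists r => // w _ wr wx; apply: vx; rewrite -wx; apply/esym/(locconst _ _ r).
Qed.

(** At [p] all means with offset [m] equal [iter m f p]. Near a constant [c] on [L], they are near
    [c] on the hull as well, so [iter m f p = c]. The offsets 0 and 1 share the same constant, since
    the mean with offset 1 at [z] is the mean with offset 0 at [f z]. *)
Lemma periodic_point_fixed K L p : compact K -> compact L -> L `<=` U ->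
  (forall z, K z -> ~ L z -> exists2 r, 0 < r & forall w, nm (w - z) < r -> K w) ->
  K p -> iter q f p = p -> f p = p.
Proof.
move=> cK cL LU Kint Kp pq.
have [G [UG oG]] := ultraFilterLemma (eventually_filter : ProperFilter \oo).
have PG : ProperFilter G by exact: ultra_proper.
have transfer m c : (forall z, U z -> cvC G (avg f q m ^~ z) c) -> iter m f p = c.
  move=> mc; apply/subr0_eq/eqP; rewrite -nm_eq0; apply/eqP/le_anti.
  rewrite nm_ge0 andbT; apply/ler_addgt0Pl => e e0; rewrite addr0.
  have e2 : 0 < e / 2 by lra.
  have : \forall N \near G, forall w, L w -> nm (avg f q m N w - c) <= e.
    apply: (@compact_uniform _ L _ G (fun N w => nm (avg f q m N w - c) <= e)) => // x Lx.
    have [r [C [r0 C0 rC]]] := avg_lip q m fh lb (LU x Lx).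
    have C1 : 0 < C + 1 by lra.
    exists (Num.min r (e / 2 / (C + 1))); first by rewrite lt_min r0 !divr_gt0.
    apply: filterS (mc x (LU x Lx) _ e2) => N Nx w; rewrite lt_min => /andP[wr].
    rewrite ltr_pdivlMr // => we.
    have := rC N w wr; have := nm_tri (avg f q m N x) (avg f q m N w) c.
    have := nm_ge0 (w - x); nra.
  move=> /filter_ex[N NL]; rewrite -(avg_fixed m N pq).
  apply: (entire_max cK Kint _ NL) => // z.
  apply: (cdiff_der (d := der (avg f q m N) z - 0)).
  by apply: cdiffB; [exact: avg_diff|exact: cdiff_cst].
have [c cP] := average_const 0 UG oG.
have p0 := transfer 0%N c cP.
suff : iter 1 f p = c by rewrite /= -p0.
apply: transfer => z Uz; apply: cvC_eq (cP (f z) (UI Uz)).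
by apply: nearW => N; rewrite /avg; congr (_ * _); apply: eq_bigr => n _; rewrite addn0 addn1 iterSr.
Qed.

End Domain.

End FixedPoint.

(** * Rotation near the fixed point *)

Section Rotation.
Variable R : realType.
Implicit Types (f : CC R -> CC R) (z w x y a p la : R[i]) (r e M d : R) (m n j q N k b : nat).
Implicit Types (U K L : set (CC R)).

Lemma der_iter_fixed f p n : (forall z, cdiff f z (der f z)) -> f p = p ->
  der (iter n f) p = der f p ^+ n.
Proof.
move=> fh fp; apply: derE; elim: n => [|n IH]; first exact: cdiff_id.
have E : iter n f p = p by elim: (n) => //= i ->.
have := cdiff_comp IH (fh _); rewrite E -exprS; exact.
Qed.

(* The means [T] of [la ^- n * (f ^ n - p)] satisfy [T (f w) = la * T w] up to
   O(1/N) and have derivative 1 at [p], so they are uniformly bi-Lipschitz near [p]. *)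
Lemma rotation_estimate f p r M : (forall z, cdiff f z (der f z)) -> f p = p ->
  nm (der f p) = 1 -> 0 < r -> 0 <= M ->
  (forall n w, nm (w - p) < r -> nm (iter n f w) <= M) ->
  exists s C, [/\ 0 < s, 0 <= C & forall n w, nm (w - p) < s ->
    nm (iter n f w - w) <= C * nm (der f p ^+ n - 1)].
Proof.
move=> fh fp; set la := der f p => la1 r0 M0 fM.
have la0 : la != 0 by rewrite -nm_gt0 la1.
pose M' := M + nm p; have M'0 : 0 <= M' by rewrite addr_ge0 ?nm_ge0.
have fM' n w : nm (w - p) < r -> nm (iter n f w - p) <= M'.
  by move=> wr; apply: le_trans (nmB _ _) _; rewrite lerD2r; exact: fM.
have lan n : nm (la ^- n) = 1 by rewrite nmV nmX la1 expr1n invr1.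
pose T N z := N.+1%:R^-1 * \sum_(n < N.+1) la ^- n * (iter n f z - p).
have pr : nm (p - p) < r by rewrite subrr nm0.
have Td N z : cdiff (T N) z (N.+1%:R^-1 * \sum_(n < N.+1) la ^- n * (der (iter n f) z - 0)).
  apply: cdiffZ.
  apply: (@cdiff_sum _ _ _ (fun (n : 'I_N.+1) z => la ^- n * (iter n f z - p))) => n.
  by apply: cdiffZ; apply: cdiffB; [exact: iter_diff|exact: cdiff_cst].
have Th N z : cdiff (T N) z (der (T N) z) by exact: cdiff_der (Td N z).
have Tp N : der (T N) p = 1.
  rewrite (derE (Td N p)) (eq_bigr (fun=> 1)) => [|n _].
    by rewrite sumr_const card_ord mulVf // pnatr_eq0.
  by rewrite der_iter_fixed // subr0 mulVf // expf_neq0.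
have TM N w : nm (w - p) < r -> nm (T N w) <= M'.
  move=> wr; apply: (@mean_bound _ N (fun n => la ^- n * (iter n f w - p))) => n.
  by rewrite nmM lan mul1r; exact: fM'.
pose q := r / 8; have q0 : 0 < q by rewrite divr_gt0.
have q8 : 8 * q = r by rewrite /q; field.
pose C1 := 16 * M' / q ^+ 2.
have C10 : 0 <= C1 by apply: divr_ge0; [exact: mulr_ge0|by apply: exprn_ge0; exact: ltW].
(* Small enough for the derivative of every [T N] to stay within 1/2 of its value 1 at [p]. *)
pose s1 := Num.min q (2^-1 / (C1 + 1)).
have C11 : 0 < C1 + 1 by lra.
have s10 : 0 < s1 by rewrite lt_min q0 divr_gt0 // invr_gt0.
have s1q : s1 <= q by rewrite ge_min lexx.
have s1C : s1 * (C1 + 1) <= 2^-1 by rewrite -ler_pdivlMr // ge_min lexx orbT.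
have biLip N x y : nm (x - p) < s1 -> nm (y - p) < s1 ->
    nm (x - y) <= 2 * nm (T N x - T N y).
  move=> xs ys.
  have : nm ((T N x - x) - (T N y - y)) <= 2^-1 * nm (x - y).
    apply: (@mean_value_ball _ (fun z => T N z - z) p s1) => //.
      move=> w _; apply: (cdiff_der (d := der (T N) w - 1)).
      by apply: cdiffB => //; exact: cdiff_id.
    move=> w ws; rewrite (derE (cdiffB (Th N w) (cdiff_id w))) -(Tp N).
    have wq : nm (w - p) < q by lra.
    have pq : nm (p - p) < q by rewrite subrr nm0.
    apply: le_trans (@der_lip _ (T N) p q M' p w q0 _ _ pq wq) _.
    - by move=> v _.
    - by move=> v; rewrite q8; exact: TM.
    rewrite -/C1; have := nm_ge0 (w - p); nra.
  have -> : (T N x - x) - (T N y - y) = (T N x - T N y) - (x - y) by ring.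
  by have := nm_lerB (x - y) (T N x - T N y); rewrite [nm (x - y - _)]nm_distC; lra.
have shift N w : nm (w - p) < r -> nm (T N (f w) - la * T N w) <= 2 * M' / N.+1%:R.
  move=> wr.
  have -> : T N (f w) - la * T N w =
      N.+1%:R^-1 * (la * (la ^- N.+1 * (iter N.+1 f w - p) - (w - p))).
    rewrite /T mulrCA -mulrBr; congr (_ * _).
    rewrite (eq_bigr (fun n : 'I_N.+1 => la * (la ^- n.+1 * (iter n.+1 f w - p)))).
      rewrite -mulr_sumr -mulrBr; congr (_ * _).
      rewrite big_ord_recr [X in _ - X]big_ord_recl /= expr0 invr1 mul1r.
      by rewrite opprD addrA addrAC; congr (_ - _); rewrite addrAC subrr add0r.
    move=> n _; rewrite -iterSr mulrA; congr (_ * _).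
    by rewrite exprS invfM mulrA mulfV // mul1r.
  rewrite !nmM nmV nm_nat la1 mul1r mulrC ler_pM2r ?invr_gt0 //.
  apply: le_trans (nmB _ _) _; rewrite nmM lan mul1r.
  by have := fM' N.+1 w wr; have := fM' 0%N w wr => /=; lra.
have r2 : 2 * (r / 2) = r by field.
pose C0 := 8 * M / (r / 2).
have C00 : 0 <= C0 by apply: divr_ge0; [exact: mulr_ge0|lra].
have C01 : 0 < C0 + 1 by lra.
have pn n : iter n f p = p by elim: n => //= i ->.
have itl n w : nm (w - p) < r / 2 -> nm (iter n f w - p) <= C0 * nm (w - p).
  move=> wr; rewrite -{1}(pn n).
  apply: (@lip_ball _ (iter n f) p (r / 2) M); rewrite ?r2 //.
  - by rewrite divr_gt0.
  - by move=> v _; exact: iter_diff.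
  - by move=> v; exact: fM.
  - by rewrite subrr nm0 divr_gt0.
(* Orbits that start within [s] of [p] stay within [s1] of [p], by the common Lipschitz constant
   [C0]. *)
pose s := Num.min (r / 2) (s1 / (C0 + 1)).
have s0 : 0 < s by rewrite lt_min !divr_gt0.
exists s, (2 * M'); split=> //; first exact: mulr_ge0.
move=> n w; rewrite lt_min => /andP[wr ws].
have its i : nm (iter i f w - p) < s1.
  apply: le_lt_trans (itl i w wr) _; move: ws; rewrite ltr_pdivlMr //.
  by have := nm_ge0 (w - p); nra.
have itr i : nm (iter i f w - p) < r by apply: lt_le_trans (its i) _; lra.
have wr1 := itr 0%N.
have chain N i : nm (T N (iter i f w) - la ^+ i * T N w) <= i%:R * (2 * M' / N.+1%:R).
  elim: i => [|i IH]; first by rewrite mul1r subrr nm0 mul0r.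
  rewrite /= (_ : _ - _ = (T N (f (iter i f w)) - la * T N (iter i f w)) +
    la * (T N (iter i f w) - la ^+ i * T N w)); last by rewrite exprS; ring.
  apply: le_trans (nmD _ _) _; rewrite nmM la1 mul1r -natr1 mulrDl mul1r addrC.
  by apply: lerD => //; exact: shift.
(* Here [n] is fixed and the number [N] of averaged terms is large: the error of the functional
   equation, summed over [n] steps, tends to 0. *)
apply/ler_addgt0Pl => e e0.
have [N _ /(_ N (leqnn N)) /= NP] := inv_succ_cvg (2 * (n%:R * (2 * M'))) e0.
apply: le_trans (biLip N _ _ (its n) (its 0%N)) _.
have h1 := chain N n; have h2 := TM N w wr1.
have h3 : nm (T N (iter n f w) - T N w) <=
    n%:R * (2 * M' / N.+1%:R) + nm (la ^+ n - 1) * M'.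
  rewrite (_ : _ - _ = (T N (iter n f w) - la ^+ n * T N w) + (la ^+ n - 1) * T N w).
    apply: le_trans (nmD _ _) _; rewrite nmM; apply: lerD => //.
    by apply: ler_wpM2l => //; exact: nm_ge0.
  by ring.
have E : 2 * (n%:R * (2 * M')) / N.+1%:R = 2 * (n%:R * (2 * M' / N.+1%:R)) by ring.
by rewrite E in NP; move: h3 NP; move: (n%:R * (_ / _)) => v; lra.
Qed.

Lemma nm1_Re (x : R[i]) : nm x = 1 -> nm (x - 1) ^+ 2 = 2 * (1 - Re x).
Proof.
move=> x1; have := nm_sqr x; rewrite x1 nm_sqr; case: x {x1} => u v /=.
rewrite ?(oppr0, addr0, expr1n) => h.
by have -> : (u - 1) ^+ 2 = u ^+ 2 - 2 * u + 1 by [ring]; lra.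
Qed.

(* With [w] a value of [la ^+ r], [r = b %[mod k]], whose real part is almost
   maximal, rotating [w] by a small angle in either direction does not increase
   [Re w] by much; hence [w] is close to 1. *)
Lemma unit_recurrence la (t : nat -> nat) k b e : nm la = 1 ->
  (forall d : nat, (0 < d)%N -> la ^+ d != 1) -> (forall j, (j <= t j)%N) ->
  cvC \oo (fun j => la ^+ t j) 1 -> (0 < k)%N -> 0 < e ->
  exists n, nm (la ^+ (k * n + b) - 1) < e.
Proof.
move=> la1 lad tj tla k0 e0.
(* The argument ends with [1 - Re w <= 4 d], so that [nm (w - 1) ^+ 2 = 2 * (1 - Re w)] is at most
   [e ^+ 2 / 2]. *)
pose d : R := Num.min 8^-1 (e ^+ 2 / 16).
have e20 : 0 < e ^+ 2 by rewrite exprn_gt0.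
have d0 : 0 < d by rewrite lt_min; apply/andP; split; lra.
have d8 : d <= 8^-1 by rewrite ge_min lexx.
have de : d <= e ^+ 2 / 16 by rewrite ge_min lexx orbT.
have tk : cvC \oo (fun j => la ^+ (k * t j)) 1.
  have [q q0 qP] := cdiff_cont (cdiffX k (cdiff_id (1 : R[i]))) d0.
  move=> e' e'0.
  have [q' q'0 q'P] := cdiff_cont (cdiffX k (cdiff_id (1 : R[i]))) e'0.
  by apply: filterS (tla _ q'0) => j /q'P; rewrite expr1n mulnC exprM.
have lan n : nm (la ^+ n) = 1 by rewrite nmX la1 expr1n.
have ReB (x y : R[i]) : Re (x - y) = Re x - Re y by case: x y => [? ?] [? ?].
have [J _ JP] := tk _ d0.
pose T := t J.+1; have T0 : (0 < T)%N by exact: leq_trans (tj _).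
have nuP : nm (la ^+ (k * T) - 1) < d by apply: JP; exact: leqnSn.
set nu := la ^+ (k * T) in nuP.
have nu1 : nu != 1 by apply: lad; rewrite muln_gt0 k0 T0.
have nun : nm nu = 1 by exact: lan.
pose S := [set Re (la ^+ (k * n + b)) | n in setT].
have Re1 n : Re (la ^+ n) <= 1 by rewrite -(lan n); exact: le_trans (ler_norm _) (Re_le_nm _).
have hS : has_sup S.
  by split; [exists (Re (la ^+ (k * 0 + b))); exists 0%N|exists 1 => _ [n _ <-]].
have pp : Re nu < 1.
  have := nm1_Re nun; have : 0 < nm (nu - 1) ^+ 2 by rewrite exprn_gt0 // nm_gt0 subr_eq0.
  by lra.
have pd : 1 - Re nu < d.
  apply: le_lt_trans nuP; rewrite nm_distC.
  apply: le_trans (_ : Re (1 - nu) <= _); first by case: (nu).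
  exact: le_trans (ler_norm _) (Re_le_nm _).
have eta0 : 0 < (1 - Re nu) * d by rewrite mulr_gt0 // subr_gt0.
have [_ [n _ <-] nS] := sup_adherent eta0 hS.
have supS m : Re (la ^+ (k * m + b)) <= sup S.
  by apply: sup_upper_bound => //; exists m.
exists n; set w := la ^+ (k * n + b) in nS *.
have wn : nm w = 1 by exact: lan.
have h1 : Re (w * nu) <= sup S.
  by rewrite /w /nu -exprD addnAC -mulnDr.
have h2 : Re (w * nu^-1) <= sup S.
  (* [w * nu^-1] need not be an admissible power of [la], since the exponent could be negative;
     multiplied by [la ^+ (k * t i)], which is close to 1, it becomes one. *)
  apply/ler_addgt0Pl => e' e'0.
  have [J' _ J'P] := tk _ e'0; pose i := maxn J' T.
  have Ti : (T <= t i)%N by apply: leq_trans (tj i); exact: leq_maxr.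
  have hi := J'P i (leq_maxl _ _); rewrite /= in hi.
  have nu0 : nu != 0 by rewrite -nm_gt0 nun.
  have E : la ^+ (k * (n + (t i - T)) + b) = w * nu^-1 * la ^+ (k * t i).
    have -> : la ^+ (k * t i) = nu * la ^+ (k * (t i - T)).
      by rewrite /nu -exprD -mulnDr subnKC.
    by rewrite mulrA mulfVK // /w -exprD mulnDr addnAC.
  have := supS (n + (t i - T))%N; rewrite E => h.
  have : Re (w * nu^-1) - Re (w * nu^-1 * la ^+ (k * t i)) <= nm (la ^+ (k * t i) - 1).
    have -> : nm (la ^+ (k * t i) - 1) = nm (w * nu^-1 * (1 - la ^+ (k * t i))).
      by rewrite !nmM wn nmV nun invr1 !mul1r nm_distC.
    rewrite mulrBr mulr1 -ReB; exact: le_trans (ler_norm _) (Re_le_nm _).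
  by lra.
have nuV : nu^-1 = (nu^*)%C.
  have nu0 : nu != 0 by rewrite -nm_gt0 nun.
  by rewrite invc_norm normE nun rmorph1 expr1n invr1 mul1r.
rewrite nuV in h2.
have w2 := nm_sqr w; have nu2 := nm_sqr nu; rewrite wn nun expr1n in w2 nu2.
have := nm1_Re wn.
move: nS h1 h2 w2 nu2 pp pd; case: (w) => u v; case: (nu) => x y /=.
move=> nS h1 h2 w2 nu2 pp pd hw.
(* The two rotations give [|v * y| <= D * (u + d) <= 2 * D], while [y ^+ 2 = D * (1 + x) >= D];
   hence [v ^+ 2 <= 4 * D < 4 * d]. *)
pose D := 1 - x; have D0 : 0 < D by rewrite /D; lra.
have uD : 0 <= u + d.
  have : 0 <= D * (u + d) by rewrite /D; lra.
  by rewrite pmulr_rge0.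
have u1 : u <= 1 by have := sqr_ge0 v; nra.
have vy : (v * y) ^+ 2 <= (D * 2) ^+ 2.
  have a1 : v * y <= D * (u + d) by rewrite /D; lra.
  have a2 : - (v * y) <= D * (u + d) by rewrite /D; lra.
  have a3 : D * (u + d) <= D * 2 by rewrite ler_pM2l //; lra.
  rewrite -[leLHS]real_normK ?num_real // lerXn2r ?nnegrE //; first by rewrite mulr_ge0 ?ltW.
  by rewrite ler_norml; apply/andP; split; lra.
have y2 : D <= y ^+ 2 by rewrite /D in D0 *; nra.
have v2 : v ^+ 2 <= 4 * D.
  have : v ^+ 2 * D <= 4 * D * D.
    apply: le_trans (_ : v ^+ 2 * y ^+ 2 <= _); first by rewrite ler_wpM2l ?sqr_ge0.
    by rewrite -exprMn; move: vy; rewrite exprMn; lra.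
  by rewrite ler_pM2r.
have Dd : D < d by rewrite /D; lra.
have up : 0 < u by rewrite ltNge; apply/negP => u0; nra.
have uu : 1 - 4 * d <= u by nra.
rewrite -(@ltr_pXn2r _ 2) ?nnegrE ?nm_ge0 ?ltW // hw.
by lra.
Qed.

End Rotation.

(** * Iterates of order a multiple of k *)

Section Subsequences.
Variable R : realType.
Implicit Types (f g : CC R -> CC R) (z w p c : R[i]) (r e M : R) (m n j k : nat).
Implicit Types (U : set (CC R)) (phi : limit_fun R) (h : nat -> CC R -> CC R).

Lemma luc_subseq U h phi (t : nat -> nat) : (forall j, (j <= t j)%N) ->
  loc_unif_cvg U h phi -> loc_unif_cvg U (h \o t) phi.
Proof.
move=> tj; case: phi => [psi|].
  move=> /luc_Some H; apply/luc_Some => z Uz; have [r r0 rP] := H z Uz.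
  exists r => // e /rP[N _ NP]; exists N => // n /= Nn; apply: NP.
  exact: leq_trans (tj n).
move=> /luc_None H; apply/luc_None => z Uz; have [r r0 rP] := H z Uz.
exists r => // M; have [N _ NP] := rP M; exists N => // n /= Nn; apply: NP.
exact: leq_trans (tj n).
Qed.

Lemma luc_monotone U h phi (l : nat -> nat) : (forall j, (j <= l j)%N) ->
  loc_unif_cvg U (h \o l) phi ->
  exists s : nat -> nat, [/\ {homo s : i j / (i < j)%N}, forall j, (0 < s j)%N &
    loc_unif_cvg U (h \o s) phi].
Proof.
(* Starting at 1 makes all terms positive. This matters for [g \o f]: its zeroth iterate, the
   identity, lacks the translation by [c]. *)
move=> lj hl; pose t j := iter j (fun i => (l i).+1) 1%N.
have tS j : (l (t j) < t j.+1)%N by [].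
have tj j : (j < t j)%N.
  by elim: j => // j IH; apply: leq_ltn_trans (tS j); apply: leq_trans (lj _).
exists (l \o t); split; last exact: (@luc_subseq U (h \o l) phi t (fun j => ltnW (tj j))).
  apply: homo_ltn => [|j]; first exact: ltn_trans.
  by apply: leq_trans (lj _); exact: tS.
by move=> j; apply: leq_trans (lj _); exact: leq_ltn_trans (tj j).
Qed.

Lemma luc_addc U h phi c : loc_unif_cvg U h phi ->
  loc_unif_cvg U (fun n w => h n w + c) (limit_addc phi c).
Proof.
case: phi => [psi|].
  move=> /luc_Some H; apply/luc_Some => z Uz; have [r r0 rP] := H z Uz.
  exists r => // e /rP; apply: filterS => n nP w wr Uw.
  by rewrite opprD addrACA subrr addr0; exact: nP.
move=> /luc_None H; apply/luc_None => z Uz; have [r r0 rP] := H z Uz.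
exists r => // M; apply: filterS (rP (M + nm c)) => n nP w wr Uw.
have := nP w wr Uw; have := nm_lerB (h n w) (- c); rewrite opprK nmN; lra.
Qed.

End Subsequences.

Section Multiples.
Variable R : realType.
Variable f : CC R -> CC R.
Hypothesis fh : forall z, cdiff f z (der f z).
Implicit Types (z w p : R[i]) (r e M : R) (m n j i : nat).
Variables (U : set (CC R)) (s : nat -> nat) (k : nat).
Hypothesis sh : {homo s : i j / (i < j)%N}.
Hypothesis k0 : (0 < k)%N.

Let ceil_ge j : (j <= s (k * j) %/ k)%N.
Proof. by rewrite leq_divRL // mulnC homo_ge. Qed.

(** Rounding up is strict: a multiple of [k] moves to the next one, and the number of added steps
    lies between 1 and [k]. *)
Let ceilE n : (k * (n %/ k).+1 = (k - n %% k) + n)%N.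
Proof.
have := divn_eq n k; have := ltn_pmod n k0; move: (n %/ k)%N (n %% k)%N => a b bk nE.
by rewrite mulnS nE; lia.
Qed.

Lemma iter_ball_bounded M i : exists B, forall j w, (j < i)%N -> nm w <= M ->
  nm (iter j f w) <= B.
Proof.
elim: i => [|i [B IH]]; first by exists 0.
have [M0|M0] := ltP M 0.
  by exists 0 => j w _ wM; have := nm_ge0 w; lra.
have K0 : [set w : CC R | nm (w - 0) <= M] !=set0 by exists 0; rewrite /= subrr nm0.
have [|b _ bP] := @compact_max _ _ (fun v => nm (iter i f v)) (@closed_ball_compact R 0 M) K0.
  by move=> x _; apply: nm_ccont; exact: iter_cont.
exists (Num.max B (nm (iter i f b))) => j w; rewrite ltnS leq_eqVlt => /orP[/eqP->|ji] wM.
  by rewrite le_max; apply/orP; right; apply: bP; rewrite /= subr0.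
by rewrite le_max IH.
Qed.

Lemma multiples_infinity : loc_unif_cvg U (iterates f \o s) None ->
  exists l : nat -> nat, (forall j, (j <= l j)%N) /\
    loc_unif_cvg U (fun j => iter (k * l j) f) None.
Proof.
(* Passing to the index [k * j] keeps the quotient at least [j]. *)
move=> /luc_None H; exists (fun j => s (k * j) %/ k)%N; split=> //.
apply/luc_None => z Uz; have [r r0 rP] := H z Uz; exists r => // M.
have [B BP] := iter_ball_bounded M k.
have [N _ NP] := rP B; exists N => // j /= Nj w wr Uw.
have Nkj : (N <= k * j)%N by apply: leq_trans Nj _; exact: leq_pmull.
rewrite ltNge; apply/negP => /(BP (s (k * j) %% k)%N _ (ltn_pmod _ k0)).
rewrite -iterD addnC mulnC -divn_eq leNgt => /negP; apply.
exact: NP.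
Qed.

Lemma iter_fixed_cont p i : f p = p -> forall e, 0 < e -> exists2 r, 0 < r &
  forall j w, (j <= i)%N -> nm (w - p) < r -> nm (iter j f w - p) < e.
Proof.
move=> fp e e0; have pn n : iter n f p = p by elim: n => //= n ->.
elim: i => [|i [r r0 IH]].
  by exists e => // j w; rewrite leqn0 => /eqP->.
have [q q0 qP] := iter_cont fh i.+1 p e0.
exists (Num.min r q) => [|j w]; first by rewrite lt_min r0.
rewrite leq_eqVlt lt_min => /orP[/eqP->|ji] /andP[wr wq]; last exact: IH.
by rewrite -[X in _ - X](pn i.+1); exact: qP.
Qed.

Lemma multiples_const (psi : CC R -> CC R) p : (forall z, U z -> U (f z)) -> U !=set0 ->
  (forall z, U z -> psi z = p) -> loc_unif_cvg U (iterates f \o s) (Some psi) ->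
  exists l : nat -> nat, (forall j, (j <= l j)%N) /\
    loc_unif_cvg U (fun j => iter (k * l j) f) (Some psi).
Proof.
move=> UI [a Ua] psip H; have H' := H; move/luc_Some: H => H.
(* The iterates at [f a], a point of [U], tend to [p]; they are also the images under [f] of the
   iterates at [a], which tend to [f p]. *)
have fp : f p = p.
  have h1 : cvC \oo (fun n => iter (s n) f (f a)) p.
    by rewrite -(psip _ (UI _ Ua)); exact: (limit_pointwise H' (UI _ Ua)).
  apply: cvC_uniq h1.
  move=> e e0; have [r r0 rP] := cdiff_cont (fh p) e0.
  have h2 : cvC \oo (fun n => iter (s n) f a) p.
    by rewrite -(psip _ Ua); exact: (limit_pointwise H' Ua).
  by apply: filterS (h2 r r0) => n /rP; rewrite -iterSr.
exists (fun j => (s (k * j) %/ k).+1); split; first by move=> j; exact: leqW.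
apply/luc_Some => z Uz; have [r r0 rP] := H z Uz; exists r => // e e0.
have [q q0 qP] := iter_fixed_cont k fp e0.
have [N _ NP] := rP q q0; exists N => // j /= Nj w wr Uw.
have Nkj : (N <= k * j)%N by apply: leq_trans Nj _; exact: leq_pmull.
rewrite ceilE iterD psip //; apply: qP; first exact: leq_subr.
by have := NP _ Nkj w wr Uw; rewrite /= psip.
Qed.

Section Nonconstant.
Variable psi : CC R -> CC R.
Hypothesis fper : exists c, c != 0 /\ forall z, f (z + c) = f z.
Hypothesis Ucomp : Fatou_component f U.
Hypothesis UI : forall z, U z -> U (f z).
Hypothesis spsi : loc_unif_cvg U (iterates f \o s) (Some psi).
Hypothesis nonconst : exists x y, [/\ U x, U y & psi x <> psi y].

(** Convergence to the identity with prescribed residues is first obtained on a disc about the fixed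
    point by [rotation_estimate], then carried to [U] by Vitali's theorem on the union of [U] and
    the hull. *)
Lemma residue_recurrence : locbdd f U /\ forall b : nat -> nat,
  exists n : nat -> nat, forall z, U z ->
    cvC \oo (fun j => iter (k * n j + b j) f z) z.
Proof.
have [t [tj lb ta [a [C [Ua cC CU Ca]]]]] := recurrence fh Ucomp UI sh spsi nonconst.
split=> // b.
have Uo z : U z -> exists2 r, 0 < r & forall w, nm (w - z) < r -> U w.
  exact: (comp_open Ucomp).
have [K [L [cK cL LU [Kint [q [p [q0 Kp pq]]]]]]] :=
  periodic_point fh Uo lb tj ta cC CU Ca.
have Uc := comp_connected Ucomp.
have fp := periodic_point_fixed fh fper Uo Uc UI lb tj ta q0 cK cL LU Kint Kp pq.
have Do := hull_open Uo LU Kint.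
have Dc := hull_connected Uo Uc cK LU Kint.
have Db := hull_locbdd fh lb cK cL LU Kint.
have Dp : (U `|` K) p by right.
have [r [M [r0 M0 rM]]] := Db p Dp; have [d d0 dD] := Do p Dp.
have tD : forall z, (U `|` K) z -> cvC \oo (fun j => iter (t j) f z) z.
  apply: (vitali_id fh Dc Db); exists a; first by left.
  by have [d' d'0 d'U] := Uo a Ua; exists d' => // w /d'U; exact: ta.
(* Iterates converging to the identity near [p] have derivatives at [p] converging to 1. Powers of a
   multiplier of modulus other than 1 could not do so. *)
have lat : cvC \oo (fun j => der f p ^+ t j) 1.
  have m0 : 0 < Num.min r d by rewrite lt_min r0.
  have [||l hl hd] := @limit_cdiff _ nat \oo _ (fun j => iter (t j) f) id p (Num.min r d) M m0.
  - apply: nearW => j; split=> [w _|w]; first exact: iter_diff.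
    by rewrite lt_min => /andP[/rM].
  - by move=> w; rewrite lt_min => /andP[_ /dD]; exact: tD.
  rewrite (cdiff_uniq (cdiff_id p) hl); apply: cvC_eq hd; apply: nearW => j.
  exact: der_iter_fixed.
have la1 : nm (der f p) = 1.
  apply/eqP; rewrite eq_le !leNgt; apply/andP; split; apply/negP => la.
    have e0 : 0 < nm (der f p) - 1 by lra.
    have [N _ /(_ N.+1 (leqnSn N))] := lat _ e0; apply/negP; rewrite -leNgt.
    apply: le_trans (nm_lerB _ _); rewrite nm1 nmX lerD2r.
    by rewrite -{1}(expr1 (nm _)) ler_eXn2l // (leq_trans _ (tj _)).
  have e0 : 0 < 1 - nm (der f p) by lra.
  have [N _ /(_ N.+1 (leqnSn N))] := lat _ e0; apply/negP; rewrite -leNgt nm_distC.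
  apply: le_trans (nm_lerB _ _); rewrite nm1 nmX lerD2l lerN2.
  rewrite -[leRHS]expr1; apply: ler_wiXn2l; rewrite ?nm_ge0 ?ltW //.
  exact: leq_trans (tj _).
have [v [A [v0 A0 vA]]] := rotation_estimate fh fp la1 r0 M0 rM.
have lad n : (0 < n)%N -> der f p ^+ n != 1.
  move=> n0; apply/eqP => l1; apply: (not_locally_id fh fper n0 v0 (z := p)) => w /(vA n).
  by rewrite l1 subrr nm0 mulr0 => h; apply/subr0_eq/eqP; rewrite -nm_eq0 eq_le h nm_ge0.
have /choice[n nP] : forall j, exists n, nm (der f p ^+ (k * n + b j) - 1) < 1 / j.+1%:R.
  by move=> j; apply: unit_recurrence la1 lad tj lat k0 _; rewrite divr_gt0.
exists n => z Uz; apply: (vitali_id fh Dc Db _ (t := fun j => (k * n j + b j)%N)); last by left.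
exists p => //; exists v => // w /vA wA e e0.
have A1 : 0 < A + 1 by lra.
have e1 : 0 < e / (A + 1) by rewrite divr_gt0.
apply: filterS (inv_succ_cvg 1 e1) => j; move=> /(lt_trans (nP j)).
rewrite ltr_pdivlMr // => h; apply: le_lt_trans (wA _) _.
by have := nm_ge0 (der f p ^+ (k * n j + b j) - 1); nra.
Qed.

(** The correction [iter (b j) f] acts before [iter (s (k * j)) f]: it moves points of [U] only
    slightly, and the Lipschitz constant shared by all iterates keeps this shift small
    afterwards. *)
Lemma multiples_nonconst : exists l : nat -> nat, (forall j, (j <= l j)%N) /\
  loc_unif_cvg U (fun j => iter (k * l j) f) (Some psi).
Proof.
have [lb H] := residue_recurrence.
have [n nP] := H (fun j => (k - s (k * j) %% k)%N).
(* The second summand completes [s (k * j)] to a multiple of [k]; the first brings [iter (b j) f]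
   close to the identity. *)
pose b j := (k * n j + (k - s (k * j) %% k))%N.
exists (fun j => ((s (k * j) %/ k).+1 + n j)%N); split.
  by move=> j; rewrite (leq_trans (ceil_ge j)) // addSn leqW // leq_addr.
apply/luc_Some => z Uz; have [r r0 rP] := (luc_Some _ _ _).1 spsi z Uz.
have [d d0 dU] := comp_open Ucomp Uz.
have [q [C [q0 C0 qC]]] := iter_lip fh lb Uz.
pose v := Num.min (Num.min r d) q / 2.
have m0 : 0 < Num.min (Num.min r d) q by rewrite !lt_min r0 d0.
have v0 : 0 < v by rewrite divr_gt0.
have vP w : nm (w - z) < 2 * v -> [/\ nm (w - z) < r, U w & nm (w - z) < q].
  by rewrite /v mulrC divfK // !lt_min => /andP[/andP[? /dU ?] ?].
exists v => // e e0.
have C1 : 0 < C + 1 by lra.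
pose e1 := Num.min (v / 2) (e / 2 / (C + 1)).
have e10 : 0 < e1 by rewrite lt_min !divr_gt0.
have e1v : e1 <= v / 2 by rewrite ge_min lexx.
have e1C : e1 * (C + 1) <= e / 2 by rewrite -ler_pdivlMr // ge_min lexx orbT.
have BU : [set w : CC R | nm (w - z) <= v] `<=` U.
  by move=> w /= wv; have [] := vP w _; first by lra.
have [J _ JP] := recurrence_uniform fh lb nP (@closed_ball_compact R z v) BU e10.
have e2 : 0 < e / 2 by lra.
have [N _ NP] := rP _ e2.
exists (maxn J N) => // j /=; rewrite geq_max => /andP[Jj Nj] w wv Uw.
have h1 := JP j Jj w (ltW wv).
have E : (k * ((s (k * j) %/ k).+1 + n j) = s (k * j) + b j)%N.
  by rewrite mulnDr ceilE /b addnAC addnC [X in (_ + X)%N]addnC.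
have w2 : nm (w - z) < 2 * v by lra.
have b2 : nm (iter (b j) f w - z) < 2 * v.
  by apply: le_lt_trans (nm_tri w _ _) _; rewrite /b; lra.
have [wr _ wq] := vP w w2; have [_ _ bq] := vP _ b2.
rewrite E iterD.
have h2 := qC (s (k * j)) w (iter (b j) f w) wq bq.
have Nkj : (N <= k * j)%N by apply: leq_trans Nj _; exact: leq_pmull.
have h3 := NP _ Nkj w wr Uw; rewrite /= /iterates in h3.
apply: le_lt_trans (nm_tri (iter (s (k * j)) f w) _ _) _.
rewrite -/(b j) in h1.
have h4 : C * nm (iter (b j) f w - w) <= C * e1 by rewrite ler_wpM2l.
have h5 : C * e1 < e / 2.
  by apply: lt_le_trans e1C; rewrite mulrDr mulr1 [e1 * C]mulrC ltrDl.
rewrite [ltRHS](splitr e); apply: ltrD h3.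
exact: le_lt_trans (le_trans h2 h4) h5.
Qed.

End Nonconstant.

End Multiples.

Section Conclusion.
Variable R : realType.
Implicit Types (f : CC R -> CC R) (z w c : R[i]) (U : set (CC R)) (phi : limit_fun R).

Lemma limit_of_multiples f c U phi k : (forall z, cdiff f z (der f z)) ->
  has_period f c -> Fatou_component f U -> f @` U `<=` U ->
  limit_function (iterates f) U phi -> (0 < k)%N ->
  exists s : nat -> nat, [/\ {homo s : i j / (i < j)%N}, forall j, (0 < s j)%N &
    loc_unif_cvg U (fun j => iter (k * s j) f) phi].
Proof.
move=> fh [c0 fc] Ucomp UfU [s [sh sphi]] k0.
have UI z : U z -> U (f z) by move=> Uz; apply: UfU; exists z.
suff [l [lj lphi]] : exists l : nat -> nat, (forall j, (j <= l j)%N) /\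
    loc_unif_cvg U (fun j => iter (k * l j) f) phi.
  exact: (@luc_monotone _ _ (fun j => iter (k * j) f) _ l).
case: phi sphi => [psi|] sphi; last exact: (multiples_infinity fh sh k0 sphi).
have [nonconst|const] := pselect (exists x y, [/\ U x, U y & psi x <> psi y]).
  by apply: (multiples_nonconst fh sh k0 _ Ucomp) => //; exists c.
have [a Ua] : U !=set0.
  by case: Ucomp => x Fx ->; exists x; exact: connected_component_refl.
apply: (multiples_const fh sh k0 (p := psi a) UI) => //; first by exists a.
by move=> z Uz; apply: contrapT => za; apply: const; exists z, a.
Qed.

End Conclusion.

Theorem theorem2p9 (R : realType) (f g : CC R -> CC R) (c : CC R) (m : nat)
    (U : set (CC R)) (phi : limit_fun R)
    (f_transcendental : transcendental_entire f)
    (f_periodic : has_period f c)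
    (g_def : forall z, g z = iterates f m z + c)
    (U_component : Fatou_component f U)
    (U_invariant : f @` U `<=` U)
    (phi_limit : limit_function (iterates f) U phi) :
  limit_function (iterates (f \o g)) U phi /\
  limit_function (iterates (g \o f)) U (limit_addc phi c).
Proof.
have [c0 fc] := f_periodic.
have fh z : cdiff f z (der f z).
  by have [d hd] := cdiff_derivable (f_transcendental.1 z); exact: cdiff_der hd.
have [s [sh s0 sphi]] :=
  limit_of_multiples fh f_periodic U_component U_invariant phi_limit (ltn0Sn m).
have fgE n : iterates (f \o g) n = iter (m.+1 * n) f.
  apply/funext => z; rewrite /iterates; elim: n => [|n IH]; first by rewrite muln0.
  by rewrite mulnS iterD /= IH g_def fc.
have gfE n : (0 < n)%N -> iterates (g \o f) n = fun z => iter (m.+1 * n) f z + c.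
  case: n => // n _; apply/funext => z; rewrite /iterates.
  have gfz w : g (f w) = iter m.+1 f w + c by rewrite g_def /iterates -iterSr.
  elim: n => [|n IH]; first by rewrite muln1 /= gfz.
  by rewrite iterS IH [LHS]gfz iterSr fc -iterSr [in RHS]mulnS [in RHS]iterD.
split; exists s; split=> //.
  by move: sphi; congr loc_unif_cvg; apply/funext => j; rewrite /= fgE.
have := luc_addc c sphi; congr loc_unif_cvg; apply/funext => j.
by rewrite /= gfE.
Qed.
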